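(* Let $\mathcal{A}=\mathcal{O}(G_q)$ be a compact quantum group (CQG) algebra, with quantum enveloping algebra $U_q(\mathfrak g)$, let $\sigma=K_{2\rho}\in U_q(\mathfrak g)$ and let $h:\mathcal{O}(G_q)\to k$ be the Haar functional. Then the maps $$\chi_q(y^1\otimes\cdots\otimes y^n)(f^0,\ldots,f^n):=h\big(f^0\,y^1(f^1)\cdots y^n(f^n)\big),\qquad y^i\in U_q(\mathfrak g),\ f^j\in\mathcal{O}(G_q),$$ induce a (characteristic) map on cyclic cohomology $$\chi_q:HC^\ast(U_q(\mathfrak g),{}^{\sigma}k)\longrightarrow HC^\ast_{\sigma^{-1}}(\mathcal{O}(G_q)).$$
   Context: $k$ is a field of characteristic $0$. QUE algebra. $\mathfrak g$ is a finite dimensional complex semisimple Lie algebra with Cartan matrix $[a_{ij}]_{1\le i,j\le\ell}$, $d_i\in\{1,2,3\}$ are such that $[d_ia_{ij}]$ is symmetric, $q$ is a fixed nonzero number with $q_i^2\ne1$ where $q_i=q^{d_i}$. $U_q(\mathfrak g)$ is the Hopf algebra generated by $E_i,F_i,K_i,K_i^{-1}$ with $K_iK_j=K_jK_i$, $K_iK_i^{-1}=K_i^{-1}K_i=1$, $K_iE_jK_i^{-1}=q_i^{a_{ij}}E_j$, $K_iF_jK_i^{-1}=q_i^{-a_{ij}}F_j$, $E_iF_j-F_jE_i=\delta_{ij}\frac{K_i-K_i^{-1}}{q_i-q_i^{-1}}$ and the quantum Serre relations; $\Delta(K_i)=K_i\otimes K_i$, $\Delta(E_i)=E_i\otimes K_i+1\otimes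 E_i$, $\Delta(F_i)=F_i\otimes1+K_i^{-1}\otimes F_i$, $\varepsilon(K_i)=1$, $\varepsilon(E_i)=\varepsilon(F_i)=0$, $S(K_i)=K_i^{-1}$, $S(E_i)=-E_iK_i^{-1}$, $S(F_i)=-K_iF_i$. For $\lambda=\sum n_i\alpha_i$ ($n_i\in\mathbb Z$, $\alpha_i$ the simple roots), $K_\lambda=K_1^{n_1}\cdots K_\ell^{n_\ell}$; $\rho$ is the half-sum of positive roots, and $\sigma:=K_{2\rho}$ satisfies $S^2(a)=\sigma a\sigma^{-1}$ for all $a$. CQG algebra. A Hopf $\ast$-algebra is a CQG algebra if it is the linear span of all matrix elements of its finite dimensional unitary corepresentations; it has a unique normalized left and right invariant functional, the Haar functional $h$. $\mathcal{O}(G_q)$ is the standard coordinate Hopf algebra of the $q$-deformation of a compact group $G$ with (complexified) Lie algebra $\mathfrak g$, with its standard Hopf pairing $\langle\,,\rangle$ with $U_q(\mathfrak g)$. Coregular actions: $y(f)=y\triangleright f=f_{(1)}\langle y,f_{(2)}\rangle$ and $f\triangleleft y=\langle y,f_{(1)}\rangle f_{(2)}$. Hopf-cyclic cohomology. $HC^\ast(U_q(\mathfrak g),{}^\sigma k)$ is the cyclic cohomology of the cocyclic module $C^n=U_q(\mathfrak g)^{\otimes n}$ with cofaces $d_0(y^1\otimes\cdots\otimes y^n)=1\otimes y^1\otimes\cdots\otimes y^n$, $d_i(\ldots)=y^1\otimes\cdots\otimes\Delta(y^i)\otimes\cdots\otimes y^n$ ($1\le i\le n$), $d_{n+1}(\ldots)=y^1\otimes\cdots\otimes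 y^n\otimes\sigma$; codegeneracies $s_j(\ldots)=y^1\otimes\cdots\otimes\varepsilon(y^{j+1})\otimes\cdots\otimes y^n$; cyclic operator $t_n(y^1\otimes\cdots\otimes y^n)=S(y^1)\cdot(y^2\otimes\cdots\otimes y^n\otimes\sigma)$ (diagonal action). Twisted cyclic cohomology. For an automorphism $\theta$ of an algebra $\mathcal A$, $HC^\ast_\theta(\mathcal A)$ is the cyclic cohomology of the cocyclic module $C^n_\theta(\mathcal A)$ of linear $\varphi:\mathcal A^{\otimes n+1}\to k$ with $\varphi(\theta(a_0),\ldots,\theta(a_n))=\varphi(a_0,\ldots,a_n)$, with cofaces $d_i\varphi(a_0,\ldots,a_{n+1})=\varphi(\ldots,a_ia_{i+1},\ldots)$ for $0\le i\le n$, $d_{n+1}\varphi(a_0,\ldots,a_{n+1})=\varphi(\theta(a_{n+1})a_0,a_1,\ldots,a_n)$, codegeneracies inserting $1$ after $a_j$, and $t_n\varphi(a_0,\ldots,a_n)=\varphi(\theta(a_n),a_0,\ldots,a_{n-1})$. $HC^\ast_{\sigma^{-1}}(\mathcal{O}(G_q))$ means $HC^\ast_\theta$ for $\theta(f)=f\triangleleft\sigma^{-1}$. *)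

(* Defs.v *)
From HB Require Import structures.
From mathcomp Require Import all_boot all_order all_algebra.
From mathcomp Require Import zify.
From mathcomp Require Import boolp classical_sets functions.

Set Implicit Arguments.
Unset Strict Implicit.
Unset Printing Implicit Defensive.

Import Order.TTheory GRing.Theory Num.Theory.
Local Open Scope ring_scope.
Local Open Scope quotient_scope.

Record subspace (k : fieldType) (V : lmodType k) := Subspace {
  insub_pred :> V -> Prop;
  subspace0 : insub_pred 0;
  subspaceP : forall a x y, insub_pred x -> insub_pred y ->
    insub_pred (a *: x + y) }.

Section SubQuotient.
Variables (k : fieldType) (V : lmodType k) (P : subspace V).

Definition subspace_mem (x : V) : bool := `[< P x >].

Lemma subspace_mem_closed : submod_closed subspace_mem.
Proof.
split=> [|a x y]; rewrite !unfold_in /=.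
  by apply/asboolP; exact: subspace0.
by move=> /asboolP Px /asboolP Py; apply/asboolP; apply: subspaceP.
Qed.
HB.instance Definition _ := GRing.isSubmodClosed.Build k V subspace_mem
  subspace_mem_closed.

Definition subspace_type := {x : V | subspace_mem x}.
HB.instance Definition _ := SubChoice.on subspace_type.
HB.instance Definition _ :=
  [SubChoice_isSubLmodule of subspace_type by <:].

Lemma subspace_valP (x : subspace_type) : P (val x).
Proof. by have /asboolP := valP x. Qed.

Lemma subspace_val0 : val (0 : subspace_type) = 0.
Proof. exact: raddf0. Qed.

Lemma subspace_val_linear : linear (val : subspace_type -> V).
Proof. exact: linearP. Qed.

Definition Sub_subspace (x : V) (Px : P x) : subspace_type :=
  exist _ x (asboolT Px).

Definition quotient_space := @Quotient.quot V (GRing.ZmodClosed.clone V subspace_mem _).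
HB.instance Definition _ := GRing.Zmodule.on quotient_space.

Definition qscale (a : k) (x : quotient_space) : quotient_space :=
  \pi_quotient_space (a *: repr x).

Definition qclass (x : V) : quotient_space := \pi_quotient_space x.

Lemma qclass_eq x y : (qclass x == qclass y) = subspace_mem (x - y).
Proof. by rewrite -Quotient.idealrBE. Qed.

Lemma qscaleE a x : qscale a (qclass x) = qclass (a *: x).
Proof.
apply/eqP; rewrite qclass_eq -scalerBr; apply: rpredZ.
by rewrite -[_ \in _]qclass_eq /qclass reprK.
Qed.

Lemma qclassD x y : qclass (x + y) = qclass x + qclass y.
Proof. by rewrite /qclass !piE. Qed.

Lemma qclass_ind (Q : quotient_space -> Prop) :
  (forall x, Q (qclass x)) -> forall u, Q u.
Proof. by move=> h u; rewrite -[u]reprK; apply: h. Qed.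

Lemma qscaleA a b v : qscale a (qscale b v) = qscale (a * b) v.
Proof. by elim/qclass_ind: v => v; rewrite !qscaleE scalerA. Qed.
Lemma qscale1 : left_id 1 qscale.
Proof. by elim/qclass_ind=> v; rewrite !qscaleE scale1r. Qed.
Lemma qscaleDr : right_distributive qscale +%R.
Proof.
by move=> a; elim/qclass_ind=> u; elim/qclass_ind=> v;
  rewrite -qclassD !qscaleE -qclassD scalerDr.
Qed.
Lemma qscaleDl v : {morph qscale^~ v : a b / a + b}.
Proof.
by move=> a b; elim/qclass_ind: v => v; rewrite !qscaleE -qclassD scalerDl.
Qed.
HB.instance Definition _ := GRing.Zmodule_isLmodule.Build k quotient_space
  qscaleA qscale1 qscaleDr qscaleDl.

Lemma qclass_linear : linear qclass.
Proof. by move=> a x y; rewrite qclassD -qscaleE. Qed.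
HB.instance Definition _ := GRing.isLinear.Build k V quotient_space _ qclass
  qclass_linear.
End SubQuotient.

Section Multilinear.
Variables (k : fieldType) (V : lmodType k) (n : nat).

Definition tset (t : n.-tuple V) (i : 'I_n) (x : V) : n.-tuple V :=
  [tuple if j == i then x else tnth t j | j < n].

Definition multilinear (W : lmodType k) (phi : n.-tuple V -> W) : Prop :=
  forall (i : 'I_n) (t : n.-tuple V), linear (fun x => phi (tset t i x)).

Definition fsum := seq (k * n.-tuple V).

Definition feval (W : lmodType k) (phi : n.-tuple V -> W) (s : fsum) : W :=
  \sum_(p <- s) p.1 *: phi p.2.

(* The n-th tensor power V^{(x)n}: finite formal sums of scaled n-tuples,
   two of them being identified when every multilinear map, with values in
   any module, agrees on them (the kernel pair of the universal multilinear
   map).  For n = 0 this is the field k. *)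
Definition feq (s s' : fsum) : bool :=
  `[< forall (W : lmodType k) (phi : n.-tuple V -> W),
        multilinear phi -> feval phi s = feval phi s' >].

Lemma feq_equiv : equiv_class_of feq.
Proof.
split=> [s|s s'|s' s s''].
- exact/asboolP.
- by apply/asboolP/asboolP => h W phi mphi; rewrite h.
- move=> /asboolP h1 /asboolP h2; apply/asboolP => W phi mphi.
  by rewrite h1 // h2.
Qed.
Canonical feq_equivRel := EquivRelPack feq_equiv.
Canonical feq_encModRel := defaultEncModRel feq.

Definition tpow := {eq_quot feq}.
HB.instance Definition _ := Choice.on tpow.
HB.instance Definition _ : EqQuotient fsum feq tpow := EqQuotient.on tpow.

(* [teval phi z] is Sweedler notation: the sum of a *: phi t over a
   decomposition z = sum of a *: pure t.  It is independent of the
   decomposition, and linear in z, exactly when phi is multilinear; see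
   [teval_pure] and [teval_linear]. *)
Definition teval (W : lmodType k) (phi : n.-tuple V -> W) (z : tpow) : W :=
  feval phi (repr z).

Definition tclass (s : fsum) : tpow := \pi_tpow s.
Definition pure (t : n.-tuple V) : tpow := tclass [:: (1, t)].

Lemma tclassP s s' :
  (forall (W : lmodType k) (phi : n.-tuple V -> W),
        multilinear phi -> feval phi s = feval phi s') ->
  tclass s = tclass s'.
Proof. by move=> h; apply/eqmodP/asboolP. Qed.

Lemma teval_class (W : lmodType k) (phi : n.-tuple V -> W) s :
  multilinear phi -> teval phi (tclass s) = feval phi s.
Proof.
move=> mphi; rewrite /teval /tclass.
have /eqmodP/asboolP : repr (\pi_tpow s) = s %[mod tpow] by rewrite reprK.
exact.
Qed.

Lemma tclass_ind (Q : tpow -> Prop) :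
  (forall s, Q (tclass s)) -> forall u, Q u.
Proof. by move=> h u; rewrite -[u]reprK; apply: h. Qed.

Lemma feval_cat (W : lmodType k) (phi : n.-tuple V -> W) s s' :
  feval phi (s ++ s') = feval phi s + feval phi s'.
Proof. by rewrite /feval big_cat. Qed.

Definition fscale a (s : fsum) : fsum := [seq (a * p.1, p.2) | p <- s].

Lemma feval_scale (W : lmodType k) (phi : n.-tuple V -> W) a s :
  feval phi (fscale a s) = a *: feval phi s.
Proof.
rewrite /feval big_map scaler_sumr.
by apply: eq_bigr => p _; rewrite scalerA.
Qed.

Definition tadd (x y : tpow) : tpow := tclass (repr x ++ repr y).
Definition tscale a (x : tpow) : tpow := tclass (fscale a (repr x)).
Definition topp (x : tpow) : tpow := tscale (-1) x.

Lemma taddE s s' : tadd (tclass s) (tclass s') = tclass (s ++ s').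
Proof.
apply: tclassP => W phi mphi.
by rewrite !feval_cat -!/(teval _ _) !teval_class.
Qed.
Lemma tscaleE a s : tscale a (tclass s) = tclass (fscale a s).
Proof.
apply: tclassP => W phi mphi.
by rewrite !feval_scale -!/(teval _ _) !teval_class.
Qed.

Lemma taddA : associative tadd.
Proof.
elim/tclass_ind=> x; elim/tclass_ind=> y; elim/tclass_ind=> z.
by rewrite !taddE catA.
Qed.
Lemma taddC : commutative tadd.
Proof.
elim/tclass_ind=> x; elim/tclass_ind=> y; rewrite !taddE.
by apply: tclassP => W phi mphi; rewrite !feval_cat addrC.
Qed.
Lemma tadd0 : left_id (tclass [::]) tadd.
Proof. by elim/tclass_ind=> x; rewrite taddE. Qed.
Lemma taddN : left_inverse (tclass [::]) topp tadd.
Proof.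
elim/tclass_ind=> x; rewrite /topp tscaleE taddE.
apply: tclassP => W phi mphi.
by rewrite feval_cat feval_scale scaleN1r addNr /feval big_nil.
Qed.
HB.instance Definition _ := GRing.isZmodule.Build tpow taddA taddC tadd0 taddN.

Lemma tscaleA a b v : tscale a (tscale b v) = tscale (a * b) v.
Proof.
elim/tclass_ind: v => v; rewrite !tscaleE; apply: tclassP => W phi mphi.
by rewrite !feval_scale scalerA.
Qed.
Lemma tscale1 : left_id 1 tscale.
Proof.
elim/tclass_ind=> v; rewrite tscaleE; apply: tclassP => W phi mphi.
by rewrite !feval_scale scale1r.
Qed.
Lemma tscaleDr : right_distributive tscale +%R.
Proof.
move=> a; elim/tclass_ind=> u; elim/tclass_ind=> v.
rewrite [u in tscale a u]taddE !tscaleE [RHS]taddE.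
by apply: tclassP => W phi mphi; rewrite ?(feval_cat, feval_scale) scalerDr.
Qed.
Lemma tscaleDl v : {morph tscale^~ v : a b / a + b}.
Proof.
move=> a b; elim/tclass_ind: v => v.
rewrite !tscaleE [RHS]taddE.
by apply: tclassP => W phi mphi; rewrite ?(feval_cat, feval_scale) scalerDl.
Qed.
HB.instance Definition _ := GRing.Zmodule_isLmodule.Build k tpow
  tscaleA tscale1 tscaleDr tscaleDl.

Lemma tclassD s s' : tclass s + tclass s' = tclass (s ++ s').
Proof. exact: taddE. Qed.
Lemma tclassZ a s : a *: tclass s = tclass (fscale a s).
Proof. exact: tscaleE. Qed.

Lemma teval_pure (W : lmodType k) (phi : n.-tuple V -> W) t :
  multilinear phi -> teval phi (pure t) = phi t.
Proof.
by move=> mphi; rewrite /pure teval_class // /feval big_cons big_nil addr0 scale1r.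
Qed.

Lemma teval_linear (W : lmodType k) (phi : n.-tuple V -> W) :
  multilinear phi -> linear (teval phi).
Proof.
move=> mphi a u v; elim/tclass_ind: u => x; elim/tclass_ind: v => y.
rewrite tclassZ tclassD !teval_class //.
by rewrite feval_cat feval_scale.
Qed.

Lemma pureP (z : tpow) :
  exists s : fsum, z = \sum_(p <- s) p.1 *: pure p.2.
Proof.
elim/tclass_ind: z => s; exists s.
elim: s => [|[a t] s IH]; first by rewrite big_nil.
by rewrite big_cons -IH /pure tclassZ tclassD /= mulr1.
Qed.

Lemma pure_multilinear : multilinear pure.
Proof.
move=> i t a x y; rewrite /pure tclassZ tclassD.
apply: tclassP => W phi mphi.
by rewrite /feval /= !(big_cons, big_nil) /= !addr0 !scale1r mulr1 mphi.
Qed.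

Lemma nth_tset (t : n.-tuple V) i x (r : nat) :
  (tset t i x)`_r = if r == i :> nat then x else t`_r.
Proof.
have [rn|nr] := ltnP r n.
  by rewrite -[r]/(val (Ordinal rn)) -!tnth_nth tnth_mktuple -val_eqE.
rewrite !nth_default ?size_tuple //.
by case: eqP nr => // ->; rewrite leqNgt ltn_ord.
Qed.
End Multilinear.

Section MultilinearComp.
Variables (k : fieldType).

Lemma linear_slot (V V' W : lmodType k) m (phi : m.-tuple V' -> W)
    (g : V -> m.-tuple V') (j : nat) (L : V -> V') :
  multilinear phi -> (j < m)%N -> linear L ->
  (forall x (r : nat), (r < m)%N ->
     (g x)`_r = if r == j then L x else (g 0)`_r) ->
  linear (fun x => phi (g x)).
Proof.
move=> mphi jm linL hg a x y.
have e z : g z = tset (g 0) (Ordinal jm) (L z).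
  apply: eq_from_tnth => r; rewrite tnth_mktuple -val_eqE /=.
  by rewrite !(tnth_nth 0) hg.
by rewrite (e (a *: x + y)) (e x) (e y) linL mphi.
Qed.

Lemma teval_param (V W X : lmodType k) n (phi : X -> n.-tuple V -> W) z :
  (forall p, linear (phi^~ p)) -> linear (fun x => teval (phi x) z).
Proof.
move=> h a x y; rewrite /teval /feval scaler_sumr -big_split /=.
by apply: eq_bigr => p _; rewrite h scalerDr !scalerA mulrC.
Qed.

End MultilinearComp.

Lemma nth_mktup (V : nmodType) n (F : nat -> V) (r : nat) :
  (r < n)%N -> [tuple F j | j < n]`_r = F r.
Proof.
move=> rn; rewrite -[r in LHS]/(val (Ordinal rn)) -tnth_nth.
by rewrite tnth_mktuple.
Qed.

Section HopfOperations.
Variables (k : fieldType) (H : algType k).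

Definition tmul n (x y : tpow H n) : tpow H n :=
  teval (fun s : n.-tuple H =>
    teval (fun t : n.-tuple H => pure [tuple s`_j * t`_j | j < n]) y) x.

Variable comul : {linear H -> tpow H 2}.

(* Positions are counted from 0: [comul_at i] applies the coproduct to the
   (i+1)-st tensor factor. *)
Definition insert2 n (i : nat) (t : n.-tuple H) (p : 2.-tuple H) :
    n.+1.-tuple H :=
  [tuple if (j < i)%N then t`_j
         else if j == i :> nat then p`_0
         else if j == i.+1 :> nat then p`_1 else t`_j.-1 | j < n.+1].

Definition comul_at n (i : nat) : tpow H n -> tpow H n.+1 :=
  teval (fun t : n.-tuple H =>
    teval (fun p : 2.-tuple H => pure (insert2 i t p)) (comul t`_i)).

(* [iter_comul n y] is y_(1) (x) ... (x) y_(n+1). *)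
Fixpoint iter_comul n (y : H) : tpow H n.+1 :=
  if n is m.+1 then comul_at 0 (iter_comul m y) else pure [tuple y].

Lemma tmul_multilinear_r n (s : n.-tuple H) :
  multilinear (fun t : n.-tuple H => pure [tuple s`_j * t`_j | j < n]).
Proof.
move=> i t; apply: (@linear_slot _ _ _ _ _ _ _ i (fun x => s`_i * x)) => //.
- exact: pure_multilinear.
- by move=> a x y; rewrite mulrDr scalerAr.
move=> x r rn; rewrite !(nth_mktup (fun j => s`_j * _`_j)) // !nth_tset.
by case: eqP => // ->.
Qed.

Lemma tmul_multilinear_l n (y : tpow H n) :
  multilinear (fun s : n.-tuple H =>
    teval (fun t : n.-tuple H => pure [tuple s`_j * t`_j | j < n]) y).
Proof.
move=> i s; apply: teval_param => t.
apply: (@linear_slot _ _ _ _ _ _ _ i (fun x => x * t`_i)) => //.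
- exact: pure_multilinear.
- by move=> a x z; rewrite mulrDl scalerAl.
move=> x r rn; rewrite !(nth_mktup (fun j => _`_j * t`_j)) // !nth_tset.
by case: eqP => // ->.
Qed.

Lemma tmul_linear_l n (y : tpow H n) : linear (fun x => tmul x y).
Proof. exact: teval_linear (tmul_multilinear_l y). Qed.

Lemma tmul_linear_r n (x : tpow H n) : linear (tmul x).
Proof.
by apply: teval_param => s; apply/teval_linear/tmul_multilinear_r.
Qed.

Lemma nth_insert2 n i (t : n.-tuple H) (p : 2.-tuple H) (r : nat) :
  (r < n.+1)%N ->
  (insert2 i t p)`_r = if (r < i)%N then t`_r else if r == i then p`_0
    else if r == i.+1 then p`_1 else t`_r.-1.
Proof. exact: nth_mktup (fun j => if (j < i)%N then _ else _) r. Qed.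

Lemma insert2_multilinear n i (t : n.-tuple H) : (i < n)%N ->
  multilinear (fun p : 2.-tuple H => pure (insert2 i t p)).
Proof.
move=> lt_in j p; apply: (@linear_slot _ _ _ _ _ _ _ (i + j)%N id) => //.
- exact: pure_multilinear.
- by case: j => -[|[|]] //= _; lia.
move=> x r rn; rewrite !nth_insert2 // !nth_tset.
case: j => -[|[|]] //= _; case: ifP => //; case: ifP => //;
  do ?case: ifP => //; lia.
Qed.

Lemma comul_at_multilinear n i : (i < n)%N ->
  multilinear (fun t : n.-tuple H =>
    teval (fun p : 2.-tuple H => pure (insert2 i t p)) (comul t`_i)).
Proof.
move=> lt_in j t; have [eq_ji|neq_ji] := eqVneq (j : nat) i.
  have e x : teval (fun p => pure (insert2 i (tset t j x) p))
      (comul (tset t j x)`_i)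
      = teval (fun p => pure (insert2 i t p)) (comul x).
    rewrite nth_tset eq_ji eqxx /teval; apply: eq_bigr => p _.
    congr (_ *: pure _); apply: eq_from_tnth => r.
    rewrite !(tnth_nth 0) !nth_insert2 // !nth_tset -eq_ji.
    by do ?case: ifP => //; lia.
  by move=> a x y; rewrite !e linearP (teval_linear (insert2_multilinear t _)).
have e x : (tset t j x)`_i = t`_i by rewrite nth_tset eq_sym (negPf neq_ji).
move=> a x y; rewrite !e; move: a x y; apply: teval_param => p.
apply: (@linear_slot _ _ _ _ _ _ _ (if (j < i)%N then (j : nat) else j.+1) id)
  => //.
- exact: pure_multilinear.
- by case: ifP; have := ltn_ord j; lia.
move=> x r rn; rewrite !nth_insert2 // !nth_tset.
by move: neq_ji; do ?case: ifP => //; lia.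
Qed.

Lemma comul_at_linear n i : (i < n)%N -> linear (@comul_at n i).
Proof. by move=> lt_in; apply/teval_linear/comul_at_multilinear. Qed.
End HopfOperations.

Record hopf_alg (k : fieldType) := HopfAlg {
  hopf_sort :> algType k;
  comul : {linear hopf_sort -> tpow hopf_sort 2};
  counit : {scalar hopf_sort};
  antipode : {linear hopf_sort -> hopf_sort};
  comul1 : comul 1 = pure [tuple 1; 1];
  comulM : forall x y, comul (x * y) = tmul (comul x) (comul y);
  counit1 : counit 1 = 1;
  counitM : forall x y, counit (x * y) = counit x * counit y;
  comulA : forall x,
    comul_at comul 0 (comul x) = comul_at comul 1 (comul x);
  counitl : forall x, teval (fun p => counit p`_0 *: p`_1) (comul x) = x;
  counitr : forall x, teval (fun p => counit p`_1 *: p`_0) (comul x) = x;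
  antipodel : forall x,
    teval (fun p => antipode p`_0 * p`_1) (comul x) = counit x *: 1;
  antipoder : forall x,
    teval (fun p => p`_0 * antipode p`_1) (comul x) = counit x *: 1 }.

(* The structure maps of a cocyclic module; only the indices i <= n+1 of
   [coface n i] and j <= n of [codegen n j] are meaningful.  The cocyclic
   identities are not recorded: the cyclic complex below is formed from the
   structure maps alone, and its coboundaries are taken inside its cocycles. *)
Record cocyclic_data (k : fieldType) := Cocyclic {
  cochain : nat -> lmodType k;
  coface : forall n, nat -> cochain n -> cochain n.+1;
  codegen : forall n, nat -> cochain n.+1 -> cochain n;
  cyclic_op : forall n, cochain n -> cochain n;
  coface_linear : forall n i, (i < n.+2)%N -> linear (@coface n i);
  codegen_linear : forall n j, (j < n.+1)%N -> linear (@codegen n j);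
  cyclic_op_linear : forall n, linear (@cyclic_op n) }.

Section CyclicCohomology.
Variables (k : fieldType) (C : cocyclic_data k).

Definition cob n (c : cochain C n) : cochain C n.+1 :=
  \sum_(i < n.+2) (-1) ^+ i *: coface i c.

Definition clambda n (c : cochain C n) : cochain C n :=
  (-1) ^+ n *: cyclic_op c.

Lemma cob_linear n : linear (@cob n).
Proof.
move=> a x y; rewrite /cob scaler_sumr -big_split /=.
apply: eq_bigr => i _.
by rewrite (coface_linear (ltn_ord i)) scalerDr !scalerA mulrC.
Qed.

Lemma clambda_linear n : linear (@clambda n).
Proof.
by move=> a x y; rewrite /clambda cyclic_op_linear scalerDr !scalerA mulrC.
Qed.

Lemma linear_at0 (U V : lmodType k) (f : U -> V) : linear f -> f 0 = 0.
Proof.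
by move=> lf; have := lf (-1) 0 0; rewrite !scaleN1r !addNr.
Qed.

(* Cyclic cohomology by Connes' complex, which over a field of
   characteristic 0 is the cyclic cohomology of the cocyclic module:
   cyclic cochains are those fixed by (-1)^n t_n, with differential
   b = sum_i (-1)^i d_i. *)
Definition is_cyclic n (c : cochain C n) : Prop := clambda c = c.

Lemma cyclic_cocycle0 n :
  (fun c : cochain C n => is_cyclic c /\ cob c = 0) 0.
Proof.
by split; [exact: linear_at0 (@clambda_linear n)
          | exact: linear_at0 (@cob_linear n)].
Qed.
Lemma cyclic_cocycleP n a (x y : cochain C n) :
  is_cyclic x /\ cob x = 0 -> is_cyclic y /\ cob y = 0 ->
  is_cyclic (a *: x + y) /\ cob (a *: x + y) = 0.
Proof.
move=> [cx bx] [cy by_]; split; last by rewrite cob_linear bx by_ scaler0 addr0.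
by rewrite /is_cyclic clambda_linear cx cy.
Qed.
Definition cyclic_cocycle n : subspace (cochain C n) :=
  Subspace (@cyclic_cocycle0 n) (@cyclic_cocycleP n).

Definition is_cyclic_coboundary n (z : cochain C n) : Prop :=
  match n return cochain C n -> Prop with
  | 0 => fun z => z = 0
  | m.+1 => fun z => exists2 c : cochain C m, is_cyclic c & z = cob c
  end z.

Lemma cyclic_coboundary0 n :
  is_cyclic_coboundary (val (0 : subspace_type (cyclic_cocycle n))).
Proof.
rewrite subspace_val0; case: n => [|n] //=; exists 0.
  exact: linear_at0 (@clambda_linear n).
by rewrite (linear_at0 (@cob_linear n)).
Qed.
Lemma cyclic_coboundaryP n a (x y : subspace_type (cyclic_cocycle n)) :
  is_cyclic_coboundary (val x) -> is_cyclic_coboundary (val y) ->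
  is_cyclic_coboundary (val (a *: x + y)).
Proof.
rewrite subspace_val_linear; case: n x y => [|n] x y /=.
  by move=> -> ->; rewrite scaler0 addr0.
move=> [c cc ->] [c' cc' ->]; exists (a *: c + c'); last by rewrite cob_linear.
by rewrite /is_cyclic clambda_linear cc cc'.
Qed.
Definition cyclic_coboundary n : subspace (subspace_type (cyclic_cocycle n)) :=
  Subspace (insub_pred := fun z => is_cyclic_coboundary (val z))
    (@cyclic_coboundary0 n) (@cyclic_coboundaryP n).

Definition HC n : lmodType k := quotient_space (cyclic_coboundary n).
Definition HC_class n (z : subspace_type (cyclic_cocycle n)) : HC n :=
  qclass (cyclic_coboundary n) z.
End CyclicCohomology.

(* The Hopf-cyclic module of H with coefficients in the comodule k given by
   sigma.  Tensors y^1 (x) ... (x) y^n are stored as y`_0, ..., y`_n.-1. *)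
Section HopfCyclic.
Variables (k : fieldType) (H : hopf_alg k) (sigma : H).

Definition hopf_coface n (i : nat) : tpow H n -> tpow H n.+1 :=
  if i == 0 then
    teval (fun y : n.-tuple H =>
      pure [tuple if j == 0 :> nat then 1 else y`_j.-1 | j < n.+1])
  else if (i <= n)%N then comul_at (comul H) i.-1
  else teval (fun y : n.-tuple H =>
      pure [tuple if j == n :> nat then sigma else y`_j | j < n.+1]).

Definition hopf_codegen n (i : nat) : tpow H n.+1 -> tpow H n :=
  teval (fun y : n.+1.-tuple H =>
    counit H y`_i *:
      pure [tuple if (j < i)%N then y`_j else y`_j.+1 | j < n]).

Definition hopf_cyclic_op n : tpow H n -> tpow H n :=
  match n with
  | 0 => id
  | m.+1 => teval (fun y : m.+1.-tuple H =>
      tmul (iter_comul (comul H) m (antipode H y`_0))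
        (pure [tuple if j == m :> nat then sigma else y`_j.+1 | j < m.+1]))
  end.

Lemma hopf_coface_linear n i : (i < n.+2)%N -> linear (@hopf_coface n i).
Proof.
move=> lt_i; rewrite /hopf_coface; case: eqP => [_|/eqP i0].
  apply: teval_linear => j t.
  apply: (@linear_slot _ _ _ _ _ _ _ j.+1 id) => //.
  - exact: pure_multilinear.
  - exact: ltn_ord.
  move=> x r rn; rewrite !(nth_mktup (fun j => if j == 0 then 1 else _`_j.-1)) //.
  by rewrite !nth_tset; case: r rn => [|r] //= _; rewrite eqSS; case: ifP.
case: leqP => [le_in|_].
  by apply: comul_at_linear; lia.
apply: teval_linear => j t; apply: (@linear_slot _ _ _ _ _ _ _ j id) => //.
- exact: pure_multilinear.
- by have := ltn_ord j; lia.
move=> x r rn; rewrite !(nth_mktup (fun j => if j == n then sigma else _`_j)) //.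
by rewrite !nth_tset; have := ltn_ord j; do ?case: eqP => //; lia.
Qed.

Lemma hopf_codegen_linear n i : (i < n.+1)%N -> linear (@hopf_codegen n i).
Proof.
move=> lt_i; apply: teval_linear => j t.
pose g x := [tuple if (r < i)%N then (tset t j x)`_r else (tset t j x)`_r.+1
            | r < n].
have ng x r : (r < n)%N -> (g x)`_r =
    if (r < i)%N then (tset t j x)`_r else (tset t j x)`_r.+1.
  exact: nth_mktup (fun r => if (r < i)%N then _ else _) r.
have [eq_ji|neq_ji] := eqVneq (j : nat) i.
  have eg x : g x = g 0.
    apply: eq_from_tnth => r; rewrite !(tnth_nth 0) !ng // !nth_tset.
    by rewrite eq_ji; do ?case: ifP => //; lia.
  move=> a x y; rewrite -/(g (a *: x + y)) -/(g x) -/(g y) (eg (a *: x + y)) (eg x) (eg y).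
  by rewrite !nth_tset eq_ji eqxx linearP scalerDl scalerA.
have lg : linear (fun x => pure (g x)).
  apply: (@linear_slot _ _ _ _ _ _ _ (if (j < i)%N then j : nat else j.-1) id)
    => //.
  - exact: pure_multilinear.
  - by move: neq_ji (ltn_ord j); case: ifP; lia.
  move=> x r rn; rewrite !ng // !nth_tset.
  by move: neq_ji; do ?case: ifP => //; lia.
move=> a x y; rewrite -/(g (a *: x + y)) -/(g x) -/(g y) lg !nth_tset.
by rewrite eq_sym (negPf neq_ji) scalerDr !scalerA mulrC.
Qed.

Lemma iter_comul_linear n : linear (iter_comul (comul H) n).
Proof.
elim: n => [|n IH] a x y /=.
  have : linear (fun x : H => pure [tuple x]); last exact.
  apply: (@linear_slot _ _ _ _ _ _ _ 0 id) => //; first exact: pure_multilinear.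
  by move=> {}x [|r].
by rewrite IH comul_at_linear.
Qed.

Lemma hopf_cyclic_op_linear n : linear (@hopf_cyclic_op n).
Proof.
case: n => [|n] //; apply: teval_linear => -[[|j] lt_j] t.
  pose w := pure [tuple if j == n :> nat then sigma else t`_j.+1 | j < n.+1].
  have e x : pure [tuple if j == n :> nat then sigma else
      (tset t (Ordinal lt_j) x)`_j.+1 | j < n.+1] = w.
    by congr pure; apply: eq_from_tnth => r; rewrite !tnth_mktuple nth_tset.
  move=> a x y; rewrite !e !nth_tset /= linearP iter_comul_linear.
  by rewrite tmul_linear_l.
move=> a x y; rewrite !nth_tset /= -tmul_linear_r; congr tmul; move: a x y.
apply: (@linear_slot _ _ _ _ _ _ _ j id) => //; first exact: pure_multilinear.
  exact: ltnW.
move=> x r rn.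
rewrite !(nth_mktup (fun j => if j == n then sigma else _`_j.+1)) //.
by rewrite !nth_tset /= eqSS; do ?case: eqP => //; lia.
Qed.

Definition hopf_cocyclic : cocyclic_data k :=
  Cocyclic hopf_coface_linear hopf_codegen_linear hopf_cyclic_op_linear.
End HopfCyclic.

(* The n-cochains are linear forms on A^{(x)(n+1)}, given as multilinear forms
   in n+1 arguments. *)
Section TwistedCyclic.
Variables (k : fieldType) (A : algType k) (theta : {lrmorphism A -> A}).

Definition is_twisted_cochain n (phi : n.+1.-tuple A -> k^o) : Prop :=
  multilinear phi /\ forall a, phi (map_tuple theta a) = phi a.

Lemma twisted_cochain0 n : @is_twisted_cochain n 0.
Proof.
split=> // i t a x y.
by change ((0 : k^o) = a *: (0 : k^o) + 0); rewrite scaler0 addr0.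
Qed.
Lemma twisted_cochainP n b phi psi :
  @is_twisted_cochain n phi -> is_twisted_cochain psi ->
  is_twisted_cochain (b *: phi + psi).
Proof.
move=> [mphi iphi] [mpsi ipsi].
have e u : (b *: phi + psi) u = b *: phi u + psi u by [].
split=> [i t a x y|a]; last by rewrite !e iphi ipsi.
rewrite !e mphi mpsi !scalerDr !scalerA [b * a]mulrC -!addrA.
by congr (_ + _); rewrite !addrA [b *: _ + _]addrC.
Qed.
Definition twisted_subspace n : subspace (n.+1.-tuple A -> k^o) :=
  Subspace (@twisted_cochain0 n) (@twisted_cochainP n).

Definition twisted_cochain n : lmodType k :=
  subspace_type (twisted_subspace n).

(* The last coface (i = n+1) is the twisted one. *)
Definition contract_args n (i : nat) (a : n.+2.-tuple A) : n.+1.-tuple A :=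
  if (i <= n)%N then
    [tuple if (j < i)%N then a`_j
           else if j == i :> nat then a`_i * a`_i.+1 else a`_j.+1 | j < n.+1]
  else
    [tuple if j == 0 :> nat then theta a`_n.+1 * a`_0 else a`_j | j < n.+1].

Definition insert_one n (i : nat) (a : n.+1.-tuple A) : n.+2.-tuple A :=
  [tuple if (j <= i)%N then a`_j
         else if j == i.+1 :> nat then 1 else a`_j.-1 | j < n.+2].

Definition rotate_args n (a : n.+1.-tuple A) : n.+1.-tuple A :=
  [tuple if j == 0 :> nat then theta a`_n else a`_j.-1 | j < n.+1].

Lemma nth_theta n (a : n.-tuple A) (r : nat) :
  (map_tuple theta a)`_r = theta a`_r.
Proof.
have [lt_r|ge_r] := ltnP r n; first by rewrite (nth_map 0) ?size_tuple.
by rewrite !nth_default ?size_tuple ?rmorph0.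
Qed.

Lemma contract_cochain n i (phi : twisted_cochain n) :
  is_twisted_cochain (fun a => val phi (contract_args i a)).
Proof.
have [mphi iphi] := subspace_valP phi.
rewrite /contract_args; have [le_in|lt_ni] := leqP i n; split.
- pose g (a : n.+2.-tuple A) : n.+1.-tuple A :=
    [tuple if (j < i)%N then a`_j
           else if j == i :> nat then a`_i * a`_i.+1 else a`_j.+1 | j < n.+1].
  have ng a r : (r < n.+1)%N -> (g a)`_r = if (r < i)%N then a`_r
           else if r == i :> nat then a`_i * a`_i.+1 else a`_r.+1.
    exact: nth_mktup (fun j => if (j < i)%N then _ else _) r.
  move=> j t; have lt_j := ltn_ord j.
  have [eq_ji|neq_ji] := eqVneq (j : nat) i.
    apply: (@linear_slot _ _ _ _ _ _ _ i (fun x => x * t`_i.+1)) => //.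
      by move=> a x y; rewrite mulrDl scalerAl.
    move=> x r rn; rewrite !ng // !nth_tset eq_ji.
    by do ?case: ifP => //; lia.
  have [eq_ji1|neq_ji1] := eqVneq (j : nat) i.+1.
    apply: (@linear_slot _ _ _ _ _ _ _ i (fun x => t`_i * x)) => //.
      by move=> a x y; rewrite mulrDr scalerAr.
    move=> x r rn; rewrite !ng // !nth_tset eq_ji1.
    by do ?case: ifP => //; lia.
  apply: (@linear_slot _ _ _ _ _ _ _ (if (j < i)%N then j : nat else j.-1) id)
    => //.
    by case: ifP; lia.
  move=> x r rn; rewrite !ng // !nth_tset.
  by move: neq_ji neq_ji1; do ?case: ifP => //; lia.
- move=> a; rewrite -[RHS]iphi; congr (val phi _).
  apply: eq_from_tnth => r; rewrite tnth_mktuple tnth_map tnth_mktuple !nth_theta.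
  by do ?case: ifP => // _; rewrite rmorphM.
- pose g (a : n.+2.-tuple A) : n.+1.-tuple A :=
    [tuple if j == 0 :> nat then theta a`_n.+1 * a`_0 else a`_j | j < n.+1].
  have ng a r : (r < n.+1)%N ->
      (g a)`_r = if r == 0 then theta a`_n.+1 * a`_0 else a`_r.
    exact: nth_mktup (fun j => if j == 0 then _ else _) r.
  move=> j t; have lt_j := ltn_ord j.
  have [eq_j|neq_j] := eqVneq (j : nat) 0.
    apply: (@linear_slot _ _ _ _ _ _ _ 0 (fun x => theta t`_n.+1 * x)) => //.
      by move=> a x y; rewrite mulrDr scalerAr.
    move=> x r rn; rewrite !ng // !nth_tset eq_j.
    by do ?case: ifP => //; lia.
  have [eq_j1|neq_j1] := eqVneq (j : nat) n.+1.
    apply: (@linear_slot _ _ _ _ _ _ _ 0 (fun x => theta x * t`_0)) => //.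
      by move=> a x y; rewrite linearP mulrDl scalerAl.
    move=> x r rn; rewrite !ng // !nth_tset eq_j1.
    by do ?case: ifP => //; lia.
  apply: (@linear_slot _ _ _ _ _ _ _ j id) => //.
    by lia.
  move=> x r rn; rewrite !ng // !nth_tset.
  by move: neq_j neq_j1; do ?case: ifP => //; lia.
- move=> a; rewrite -[RHS]iphi; congr (val phi _).
  apply: eq_from_tnth => r; rewrite tnth_mktuple tnth_map tnth_mktuple !nth_theta.
  by case: ifP => // _; rewrite rmorphM.
Qed.

Lemma insert_one_cochain n i (phi : twisted_cochain n.+1) :
  is_twisted_cochain (fun a => val phi (insert_one i a)).
Proof.
have [mphi iphi] := subspace_valP phi.
have ng (a : n.+1.-tuple A) r : (r < n.+2)%N -> (insert_one i a)`_r =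
    if (r <= i)%N then a`_r else if r == i.+1 :> nat then 1 else a`_r.-1.
  exact: nth_mktup (fun j => if (j <= i)%N then _ else _) r.
split=> [j t|a].
  have lt_j := ltn_ord j.
  apply: (@linear_slot _ _ _ _ _ _ _ (if (j <= i)%N then j : nat else j.+1) id)
    => //.
    by case: ifP; lia.
  move=> x r rn; rewrite !ng // !nth_tset.
  by do ?case: ifP => //; lia.
rewrite -[RHS]iphi; congr (val phi _).
apply: eq_from_tnth => r; rewrite tnth_mktuple tnth_map tnth_mktuple !nth_theta.
by do ?case: ifP => // _; rewrite rmorph1.
Qed.

Lemma rotate_cochain n (phi : twisted_cochain n) :
  is_twisted_cochain (fun a => val phi (rotate_args a)).
Proof.
have [mphi iphi] := subspace_valP phi.
have ng (a : n.+1.-tuple A) r : (r < n.+1)%N -> (rotate_args a)`_r =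
    if r == 0 then theta a`_n else a`_r.-1.
  exact: nth_mktup (fun j => if j == 0 then _ else _) r.
split=> [j t|a].
  have lt_j := ltn_ord j; have [eq_j|neq_j] := eqVneq (j : nat) n.
    apply: (@linear_slot _ _ _ _ _ _ _ 0 theta) => //; first exact: linearP.
    move=> x r rn; rewrite !ng // !nth_tset eq_j.
    by do ?case: ifP => //; lia.
  apply: (@linear_slot _ _ _ _ _ _ _ j.+1 id) => //.
    by lia.
  move=> x r rn; rewrite !ng // !nth_tset.
  by move: neq_j; do ?case: ifP => //; lia.
rewrite -[RHS]iphi; congr (val phi _).
apply: eq_from_tnth => r; rewrite tnth_mktuple tnth_map tnth_mktuple !nth_theta.
by case: ifP.
Qed.

Definition twisted_coface n (i : nat) (phi : twisted_cochain n) :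
    twisted_cochain n.+1 :=
  Sub_subspace (P := twisted_subspace n.+1) (contract_cochain i phi).

Definition twisted_codegen n (i : nat) (phi : twisted_cochain n.+1) :
    twisted_cochain n :=
  Sub_subspace (P := twisted_subspace n) (insert_one_cochain i phi).

Definition twisted_cyclic_op n (phi : twisted_cochain n) : twisted_cochain n :=
  Sub_subspace (P := twisted_subspace n) (rotate_cochain phi).

Lemma twisted_coface_linear n i :
  (i < n.+2)%N -> linear (@twisted_coface n i).
Proof. by move=> _ a x y; apply: val_inj. Qed.
Lemma twisted_codegen_linear n i :
  (i < n.+1)%N -> linear (@twisted_codegen n i).
Proof. by move=> _ a x y; apply: val_inj. Qed.
Lemma twisted_cyclic_op_linear n : linear (@twisted_cyclic_op n).
Proof. by move=> a x y; apply: val_inj. Qed.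

Definition twisted_cocyclic : cocyclic_data k :=
  Cocyclic twisted_coface_linear twisted_codegen_linear
    twisted_cyclic_op_linear.
End TwistedCyclic.

(* A finite dimensional complex semisimple Lie algebra is given by its root
   system and a base.  Vectors of 'rV[int]_l are coordinates on the simple
   roots alpha_i, which are thus [delta_mx 0 i].  The form is the one with
   (alpha_i, alpha_j) = d_i a_ij, so that a_ij = 2 (alpha_i, alpha_j) /
   (alpha_i, alpha_i); the base axiom says that the coordinates of a root are
   all nonnegative or all nonpositive. *)
Definition root_form l (a : 'M[int]_l) (d : 'I_l -> nat) (b c : 'rV[int]_l)
    : int :=
  \sum_(i < l) \sum_(j < l) (d i)%:Z * a i j * b 0 i * c 0 j.

Record semisimple_datum (l : nat) := SemisimpleDatum {
  cartan : 'M[int]_l;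
  symd : 'I_l -> nat;
  roots : seq 'rV[int]_l;
  symd_range : forall i, symd i \in [:: 1; 2; 3]%N;
  cartan_symm : forall i j,
    (symd i)%:Z * cartan i j = (symd j)%:Z * cartan j i;
  cartan_diag : forall i, cartan i i = 2;
  root_form_pos : forall b, b != 0 -> 0 < root_form cartan symd b b;
  roots_uniq : uniq roots;
  roots_simple : forall i, delta_mx 0 i \in roots;
  roots_reflection : forall b c, b \in roots -> c \in roots ->
    exists2 m : int, 2 * root_form cartan symd c b = m * root_form cartan symd b b
                   & c - m *: b \in roots;
  roots_reduced : forall b (m : int), b \in roots -> m *: b \in roots ->
    m = 1 \/ m = -1;
  roots_base : forall b, b \in roots ->
    (forall i, 0 <= b 0 i) \/ (forall i, b 0 i <= 0) }.

(* rho is half of this sum of positive roots; only 2 rho is needed. *)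
Definition two_rho l (g : semisimple_datum l) : 'rV[int]_l :=
  \sum_(b <- roots g | [forall i, 0 <= b 0 i]) b.

(* Gaussian binomial coefficients for [n] = (x^n - x^-n) / (x - x^-1), by the
   q-Pascal rule: the quotient of q-factorials may be 0 / 0 at roots of
   unity. *)
Fixpoint qbinom (k : fieldType) (x : k) (n m : nat) : k :=
  match n, m with
  | _, 0 => 1
  | 0, _.+1 => 0
  | n'.+1, m'.+1 => x ^+ m * qbinom x n' m + x ^- (n - m) * qbinom x n' m'
  end.

Section QuantizedEnvelopingAlgebra.
Variables (k : fieldType) (l : nat) (g : semisimple_datum l) (q : k).

Definition qi (i : 'I_l) : k := q ^+ symd g i.

Definition serre (B : algType k) (X : 'I_l -> B) (i j : 'I_l) : B :=
  let n := `|1 - cartan g i j|%N in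
  \sum_(r < n.+1) ((-1) ^+ r * qbinom (qi i) n r) *:
    (X i ^+ (n - r) * X j * X i ^+ r).

Record Uq_relations (B : algType k) (E F K Ki : 'I_l -> B) : Prop := {
  Uq_KK : forall i j, K i * K j = K j * K i;
  Uq_KKi : forall i, K i * Ki i = 1;
  Uq_KiK : forall i, Ki i * K i = 1;
  Uq_KE : forall i j, K i * E j * Ki i = qi i ^ cartan g i j *: E j;
  Uq_KF : forall i j, K i * F j * Ki i = qi i ^ (- cartan g i j) *: F j;
  Uq_EF : forall i j, E i * F j - F j * E i =
    if i == j then (qi i - (qi i)^-1)^-1 *: (K i - Ki i) else 0;
  Uq_serreE : forall i j, i != j -> serre E i j = 0;
  Uq_serreF : forall i j, i != j -> serre F i j = 0 }.

(* U_q(g) is the algebra presented by E_i, F_i, K_i, K_i^-1 and the relations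
   above ([Uq_univ] and [Uq_gen] are the existence and uniqueness parts of the
   universal property), with its Hopf structure. *)
Record Uq := MkUq {
  Uq_hopf :> hopf_alg k;
  Uq_E : 'I_l -> Uq_hopf;
  Uq_F : 'I_l -> Uq_hopf;
  Uq_K : 'I_l -> Uq_hopf;
  Uq_Ki : 'I_l -> Uq_hopf;
  Uq_rel : Uq_relations Uq_E Uq_F Uq_K Uq_Ki;
  Uq_univ : forall (B : algType k) (e f t ti : 'I_l -> B),
    Uq_relations e f t ti -> exists phi : {lrmorphism Uq_hopf -> B},
      forall i, [/\ phi (Uq_E i) = e i, phi (Uq_F i) = f i,
                    phi (Uq_K i) = t i & phi (Uq_Ki i) = ti i];
  Uq_gen : forall (B : algType k) (phi psi : {lrmorphism Uq_hopf -> B}),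
    (forall i, [/\ phi (Uq_E i) = psi (Uq_E i), phi (Uq_F i) = psi (Uq_F i),
       phi (Uq_K i) = psi (Uq_K i) & phi (Uq_Ki i) = psi (Uq_Ki i)]) ->
    phi =1 psi;
  Uq_comulE : forall i, comul Uq_hopf (Uq_E i) =
    pure [tuple Uq_E i; Uq_K i] + pure [tuple 1; Uq_E i];
  Uq_comulF : forall i, comul Uq_hopf (Uq_F i) =
    pure [tuple Uq_F i; 1] + pure [tuple Uq_Ki i; Uq_F i];
  Uq_comulK : forall i,
    comul Uq_hopf (Uq_K i) = pure [tuple Uq_K i; Uq_K i];
  Uq_comulKi : forall i,
    comul Uq_hopf (Uq_Ki i) = pure [tuple Uq_Ki i; Uq_Ki i];
  Uq_counitE : forall i, counit Uq_hopf (Uq_E i) = 0;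
  Uq_counitF : forall i, counit Uq_hopf (Uq_F i) = 0;
  Uq_counitK : forall i, counit Uq_hopf (Uq_K i) = 1;
  Uq_counitKi : forall i, counit Uq_hopf (Uq_Ki i) = 1;
  Uq_antipodeE : forall i, antipode Uq_hopf (Uq_E i) = - (Uq_E i * Uq_Ki i);
  Uq_antipodeF : forall i, antipode Uq_hopf (Uq_F i) = - (Uq_K i * Uq_F i);
  Uq_antipodeK : forall i, antipode Uq_hopf (Uq_K i) = Uq_Ki i;
  Uq_antipodeKi : forall i, antipode Uq_hopf (Uq_Ki i) = Uq_K i }.

Variable U : Uq.

Definition Kexp (i : 'I_l) (m : int) : U :=
  match m with
  | Posz n => Uq_K U i ^+ n
  | Negz n => Uq_Ki U i ^+ n.+1
  end.

(* K_lambda for lambda = sum of (lam 0 i) alpha_i. *)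
Definition Kroot (lam : 'rV[int]_l) : U := \prod_(i < l) Kexp i (lam 0 i).

Definition sigma : U := Kroot (two_rho g).
Definition sigma_inv : U := Kroot (- two_rho g).

Definition grouplike (y : U) : Prop :=
  comul U y = pure [tuple y; y] /\ counit U y = 1.

Lemma linear_sum_scale (V W : lmodType k) (f : V -> W) (I : Type)
    (s : seq I) (c : I -> k) (x : I -> V) : linear f ->
  f (\sum_(i <- s) c i *: x i) = \sum_(i <- s) c i *: f (x i).
Proof.
move=> lf; elim: s => [|i s IH]; first by rewrite !big_nil linear_at0.
by rewrite !big_cons lf IH.
Qed.

Lemma tmul_pure (H : algType k) n (s t : n.-tuple H) :
  tmul (pure s) (pure t) = pure [tuple s`_j * t`_j | j < n].
Proof.
rewrite /tmul (teval_pure s (tmul_multilinear_l _)).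
exact: (teval_pure t (tmul_multilinear_r _)).
Qed.

Lemma tuple2E (T : nmodType) (F : nat -> T) :
  [tuple F j | j < 2] = [tuple F 0; F 1].
Proof. by apply: val_inj => /=; rewrite /= !enum_ordSl enum_ord0. Qed.

Lemma grouplike1 : grouplike 1.
Proof. by split; [exact: comul1 | exact: counit1]. Qed.

Lemma grouplikeM x y : grouplike x -> grouplike y -> grouplike (x * y).
Proof.
move=> [cx ex] [cy ey]; split; last by rewrite counitM ex ey mulr1.
rewrite comulM cx cy tmul_pure.
by rewrite (tuple2E (fun j => [tuple x; x]`_j * [tuple y; y]`_j)).
Qed.

Lemma grouplikeX x n : grouplike x -> grouplike (x ^+ n).
Proof.
move=> gx; elim: n => [|n IH]; first by rewrite expr0; apply: grouplike1.
by rewrite exprS; apply: grouplikeM.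
Qed.

Lemma Kroot_grouplike lam : grouplike (Kroot lam).
Proof.
rewrite /Kroot; apply: (big_ind grouplike).
- exact: grouplike1.
- exact: grouplikeM.
move=> i _; rewrite /Kexp; case: (lam 0 i) => n; apply: grouplikeX; split.
- exact: Uq_comulK.
- exact: Uq_counitK.
- exact: Uq_comulKi.
- exact: Uq_counitKi.
Qed.

(* A representation on k^(n+1), in a basis of weight vectors, with weights in
   X.  A weight mu is given by its coordinates mu_i = <mu, alpha_i^vee> on the
   fundamental weights, and K_i acts on it by q^(alpha_i, mu) = q_i^mu_i. *)
Definition weight_rep (X : {pred 'rV[int]_l}) n
    (pi : {lrmorphism U -> 'M[k]_n.+1}) : Prop :=
  exists2 mu : 'I_n.+1 -> 'rV[int]_l, forall s, mu s \in X &
    forall i, pi (Uq_K U i) = diag_mx (\row_s (qi i ^ mu s 0 i)).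

Definition matrix_coeff (X : {pred 'rV[int]_l}) (phi : U -> k) : Prop :=
  exists n (pi : {lrmorphism U -> 'M[k]_n.+1}) (u : 'rV[k]_n.+1)
      (v : 'cV[k]_n.+1),
    weight_rep X pi /\ forall y, phi y = (u *m pi y *m v) 0 0.

(* The compact connected group G with Lie algebra g is determined by its
   weight lattice X, between the root lattice (alpha_j has coordinates a_ij)
   and the lattice of all integral weights. *)
Definition weight_lattice (X : {pred 'rV[int]_l}) : Prop :=
  zmod_closed X /\ forall j, (\row_i cartan g i j) \in X.

(* O(G_q) is the Hopf algebra of matrix coefficients of the finite dimensional
   weight representations of U_q(g) with weights in X, paired with U_q(g) by
   evaluation: f is identified with the functional <-, f>. *)
Record OGq (X : {pred 'rV[int]_l}) := MkOGq {
  OGq_hopf :> hopf_alg k;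
  pairing : U -> OGq_hopf -> k;
  pairing_linl : forall f, scalar (pairing^~ f);
  pairing_linr : forall y, scalar (pairing y);
  pairing_mull : forall y z f, pairing (y * z) f =
    teval (fun p => (pairing y p`_0 * pairing z p`_1 : k^o))
      (comul OGq_hopf f);
  pairing_mulr : forall y f f', pairing y (f * f') =
    teval (fun p => (pairing p`_0 f * pairing p`_1 f' : k^o)) (comul U y);
  pairing_1l : forall f, pairing 1 f = counit OGq_hopf f;
  pairing_1r : forall y, pairing y 1 = counit U y;
  pairing_antipode : forall y f,
    pairing (antipode U y) f = pairing y (antipode OGq_hopf f);
  pairing_inj : forall f, (forall y, pairing y f = 0) -> f = 0;
  pairing_image : forall phi : U -> k,
    (exists f, forall y, pairing y f = phi y) <-> matrix_coeff X phi }.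

Arguments pairing {X} _ _ _.

Variables (X : {pred 'rV[int]_l}) (A : OGq X).

Definition lact (y : U) (f : A) : A :=
  teval (fun p => pairing A y p`_1 *: p`_0) (comul A f).

Definition ract (f : A) (y : U) : A :=
  teval (fun p => pairing A y p`_0 *: p`_1) (comul A f).

Lemma ract_multilinear (y : U) :
  multilinear (fun p : 2.-tuple A => pairing A y p`_0 *: p`_1).
Proof.
move=> [[|[|//]] lt_j] p a x z; rewrite !nth_tset /=.
  by rewrite pairing_linr scalerDl scalerA.
by rewrite scalerDr !scalerA mulrC.
Qed.

Lemma ract_linear (y : U) : linear (ract^~ y).
Proof.
by move=> a x z; rewrite /ract linearP (teval_linear (ract_multilinear y)).
Qed.

Lemma pairing_grouplike y f f' : grouplike y ->
  pairing A y (f * f') = pairing A y f * pairing A y f'.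
Proof.
move=> [cy _]; rewrite pairing_mulr cy teval_pure //.
move=> [[|[|//]] lt_j] p a x z; rewrite !nth_tset /=.
  by rewrite pairing_linl mulrDl -mulrA.
by rewrite pairing_linl mulrDr mulrCA.
Qed.

Lemma ract_grouplikeM y : grouplike y ->
  forall f f', ract (f * f') y = ract f y * ract f' y.
Proof.
move=> gy f f'; rewrite /ract comulM.
have linphi := teval_linear (ract_multilinear y).
have [s ->] := pureP (comul A f); have [s' ->] := pureP (comul A f').
rewrite (linear_sum_scale _ _ _ (tmul_linear_l _)).
rewrite !(linear_sum_scale _ _ _ linphi) mulr_suml; apply: eq_bigr => p _.
rewrite (linear_sum_scale _ _ _ (tmul_linear_r _)) (linear_sum_scale _ _ _ linphi).
rewrite mulr_sumr scaler_sumr; apply: eq_bigr => p' _.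
rewrite tmul_pure !(teval_pure _ (ract_multilinear y)).
rewrite (tuple2E (fun j => p.2`_j * p'.2`_j)) /= (pairing_grouplike _ _ gy).
by rewrite -!(scalerAl, scalerAr) !scalerA; congr (_ *: _); rewrite mulrACA.
Qed.

Lemma ract_grouplike1 y : grouplike y -> ract 1 y = 1.
Proof.
move=> [_ ey]; rewrite /ract comul1 (teval_pure _ (ract_multilinear y)) /=.
by rewrite pairing_1r ey scale1r.
Qed.

(* theta f = f <| sigma^-1, an algebra endomorphism as sigma^-1 is grouplike. *)
Definition theta_fun (f : A) : A := ract f sigma_inv.

HB.instance Definition _ := GRing.isLinear.Build k A A _ theta_fun
  (ract_linear sigma_inv).
HB.instance Definition _ := GRing.isMonoidMorphism.Build A A theta_fun
  (ract_grouplike1 (Kroot_grouplike _),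
   ract_grouplikeM (Kroot_grouplike _)).

Definition theta : {lrmorphism A -> A} := theta_fun.

End QuantizedEnvelopingAlgebra.

Section CompactQuantumGroups.
Variables (C : numClosedFieldType) (A : hopf_alg C).

(* The decomposition s of the coproduct is arbitrary, so [star_comul] says
   that comul intertwines star and star (x) star. *)
Record hopf_star (star : A -> A) : Prop := {
  star_semilinear : forall a x y, star (a *: x + y) = a^* *: star x + star y;
  starK : involutive star;
  starM : forall x y, star (x * y) = star y * star x;
  star_comul : forall x (s : seq (A * A)),
    comul A x = \sum_(p <- s) pure [tuple p.1; p.2] ->
    comul A (star x) = \sum_(p <- s) pure [tuple star p.1; star p.2];
  star_counit : forall x, counit A (star x) = (counit A x)^* }.

Record unitary_corep (star : A -> A) n (u : 'M[A]_n) : Prop := {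
  corep_comul : forall i j,
    comul A (u i j) = \sum_(r < n) pure [tuple u i r; u r j];
  corep_counit : forall i j, counit A (u i j) = (i == j)%:R;
  corep_unitaryl : forall i j,
    \sum_(r < n) star (u r i) * u r j = (i == j)%:R;
  corep_unitaryr : forall i j,
    \sum_(r < n) u i r * star (u j r) = (i == j)%:R }.

Definition unitary_matrix_element (star : A -> A) (a : A) : Prop :=
  exists n (u : 'M[A]_n) i j, unitary_corep star u /\ a = u i j.

Definition CQG (star : A -> A) : Prop :=
  hopf_star star /\
  forall a, exists2 s : seq (C * A),
    forall p, p \in s -> unitary_matrix_element star p.2
    & a = \sum_(p <- s) p.1 *: p.2.

Record haar_functional (h : {scalar A}) : Prop := {
  haar1 : h 1 = 1;
  haar_left : forall f,
    teval (fun p => h p`_1 *: p`_0) (comul A f) = h f *: 1;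
  haar_right : forall f,
    teval (fun p => h p`_0 *: p`_1) (comul A f) = h f *: 1 }.
End CompactQuantumGroups.

(* Main.v *)
From HB Require Import structures.
Require Import Defs.
From mathcomp Require Import all_boot all_order all_algebra.
From mathcomp Require Import ring zify.
From mathcomp Require Import boolp.

Set Implicit Arguments.
Unset Strict Implicit.
Unset Printing Implicit Defensive.

Import Order.TTheory GRing.Theory Num.Theory.
Local Open Scope ring_scope.

(** The formula for chi involves the left action of U_q(g) on the function
    algebra A, and compatibility with the cyclic structures needs three facts.
    Since A is a module algebra, coproducts of the y^i match products of
    neighbouring functions ([act_prod_comul]). Since h is invariant,
    h ((z |> f) f') = h (f (S(z) |> f')) ([haar_lact_adj]), which is what the
    Hopf-cyclic operator requires. Finally, the element sigma that appears in
    the last place has to be traded for the twist theta in the first one: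

      h (a (sigma |> c)) = h (theta(c) a)     ([haar_theta]).

    Given these, chi commutes with the cofaces and with the cyclic operators
    ([chi_coface], [chi_cyclic]), hence maps Connes' complex to Connes' complex
    and induces maps on cyclic cohomology ([induced_HC]).

    The last identity is the heart of the matter: it says that K_(2 rho) is
    the modular element of the Haar functional, with the right normalization.
    For a, b in A consider on U_q(g) the functional

      y |-> sum of h (a_2 S(b_1)) h (S(b_3) a_1) <y, b_2>     ([haar_char]).

    Invariance of h makes it a trace, and S^2 = conjugation by sigma makes its
    values at sigma and sigma^-1 equal to h (S(b <| sigma) a) and
    h (a S(sigma^-1 |> b)). So the identity amounts to the equality of these two
    values, for which there are two arguments.

    If q is not a root of unity, any trace tau on U_q(g) satisfies
    tau(K_lam) = tau(K_(s_i lam)) when the i-th coroot is even on lam. This is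
    rank one: the traces of T K_i^m and T K_i^(- m) agree when T commutes with
    the i-th copy of quantum sl2, by a recursion on m through the Casimir
    element ([trace_weyl]). Simple reflections at vectors with even coroot value
    lead from 2 rho to - 2 rho ([two_rho_descent]).

    If q is a root of unity, sigma has finite order on A. Every unitary
    corepresentation u carries an invertible positive matrix P that intertwines
    u with S^2(u): a sum of pull-backs of inner products along intertwiners from
    the conjugate of u to unitary corepresentations, which exist because the
    latter span A ([invertible_invariant_form]). A power of P commutes with u;
    by positivity so does P ([psd_root_comm]). Hence S^2 is the identity on A,
    the E_i vanish on A, each K_i agrees with its inverse there, and so do sigma
    and sigma^-1 ([sigma_selfinverse]). *)

(** * Sweedler calculus *)

Section LinearMaps.
Variable k : fieldType.

Lemma linZ (V W : lmodType k) (f : V -> W) a x :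
  linear f -> f (a *: x) = a *: f x.
Proof. by move=> lf; have := lf a x 0; rewrite (linear_at0 lf) !addr0. Qed.

Lemma linD (V W : lmodType k) (f : V -> W) x y :
  linear f -> f (x + y) = f x + f y.
Proof. by move=> lf; have := lf 1 x y; rewrite !scale1r. Qed.

Lemma lin_id (V : lmodType k) : linear (fun x : V => x).
Proof. by []. Qed.

Lemma lin_fun (V W : lmodType k) (f : {linear V -> W}) : linear f.
Proof. exact: linearP. Qed.

Lemma lin_scalar (V : lmodType k) (f : {scalar V}) : linear (f : V -> k^o).
Proof. exact: linearP. Qed.

Lemma lin_comp (U V W : lmodType k) (f : V -> W) (g : U -> V) :
  linear f -> linear g -> linear (fun x => f (g x)).
Proof. by move=> lf lg a x y; rewrite lg lf. Qed.

Lemma lin_mull (V : lmodType k) (B : algType k) (f : V -> B) (b : B) :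
  linear f -> linear (fun x => f x * b).
Proof. by move=> lf a x y; rewrite lf mulrDl scalerAl. Qed.

Lemma lin_mulr (V : lmodType k) (B : algType k) (f : V -> B) (b : B) :
  linear f -> linear (fun x => b * f x).
Proof. by move=> lf a x y; rewrite lf mulrDr scalerAr. Qed.

Lemma lin_scalel (V W : lmodType k) (f : V -> k^o) (w : W) :
  linear f -> linear (fun x => f x *: w).
Proof. by move=> lf a x y; rewrite lf scalerDl scalerA. Qed.

Lemma lin_scaler (V W : lmodType k) (f : V -> W) (c : k) :
  linear f -> linear (fun x => c *: f x).
Proof. by move=> lf a x y; rewrite lf scalerDr !scalerA mulrC. Qed.

End LinearMaps.

Lemma linear_teval (k : fieldType) (V W W' : lmodType k) n (f : W -> W')
    (phi : n.-tuple V -> W) (z : tpow V n) :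
  linear f -> f (teval phi z) = teval (fun t => f (phi t)) z.
Proof. exact: linear_sum_scale. Qed.

Section SweedlerNotation.
Variables (k : fieldType) (H : hopf_alg k).

(** The Sweedler sum of phi x_(1) x_(2). As it is a finite sum over a fixed
    representative of the coproduct, exchange of sums and linear maps pass
    through it for every phi; only statements that compare two decompositions
    of a tensor need phi to be bilinear. *)
Definition sw (W : lmodType k) (x : H) (phi : H -> H -> W) : W :=
  teval (fun p : 2.-tuple H => phi p`_0 p`_1) (comul H x).

Lemma swE (W : lmodType k) x (phi : H -> H -> W) :
  sw x phi = \sum_(p <- repr (comul H x)) p.1 *: phi p.2`_0 p.2`_1.
Proof. by []. Qed.

Lemma eq_sw (W : lmodType k) x (phi psi : H -> H -> W) :
  (forall a b, phi a b = psi a b) -> sw x phi = sw x psi.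
Proof. by move=> e; rewrite !swE; apply: eq_bigr => p _; rewrite e. Qed.

Lemma linear_sw (V W : lmodType k) (f : V -> W) x (phi : H -> H -> V) :
  linear f -> f (sw x phi) = sw x (fun a b => f (phi a b)).
Proof. by move=> lf; rewrite !swE linear_sum_scale. Qed.

Lemma sw_exchange (W : lmodType k) x y (phi : H -> H -> H -> H -> W) :
  sw x (fun a b => sw y (fun c d => phi a b c d)) =
  sw y (fun c d => sw x (fun a b => phi a b c d)).
Proof.
rewrite !swE; under eq_bigr => p _ do rewrite swE scaler_sumr.
rewrite exchange_big; apply: eq_bigr => p _ /=; rewrite swE scaler_sumr.
by apply: eq_bigr => r _; rewrite !scalerA mulrC.
Qed.

Lemma lin_sw (V W : lmodType k) x (phi : V -> H -> H -> W) :
  (forall a b, linear (fun v => phi v a b)) -> linear (fun v => sw x (phi v)).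
Proof.
move=> l a u v; rewrite !swE scaler_sumr -big_split; apply: eq_bigr => p _ /=.
by rewrite l scalerDr !scalerA mulrC.
Qed.

Definition bilinear2 (V V' W : lmodType k) (phi : V -> V' -> W) :=
  (forall b, linear (phi^~ b)) /\ (forall a, linear (phi a)).

Lemma bilinear2_multilinear (V W : lmodType k) (phi : V -> V -> W) :
  bilinear2 phi -> multilinear (fun p : 2.-tuple V => phi p`_0 p`_1).
Proof.
move=> [l r] [[|[|//]] lt_j] p a x y; rewrite !nth_tset /=.
  exact: l.
exact: r.
Qed.

Lemma lin_swx (V W : lmodType k) (f : V -> H) (phi : H -> H -> W) :
  linear f -> bilinear2 phi -> linear (fun x => sw (f x) phi).
Proof.
move=> lf bphi a x y; rewrite /sw lf linearP.
by rewrite (teval_linear (bilinear2_multilinear bphi)).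
Qed.

Lemma sw_pure (W : lmodType k) x a b (phi : H -> H -> W) :
  bilinear2 phi -> comul H x = pure [tuple a; b] -> sw x phi = phi a b.
Proof.
by move=> bphi e; rewrite /sw e teval_pure //; apply: bilinear2_multilinear.
Qed.

Lemma swM (W : lmodType k) x y (phi : H -> H -> W) : bilinear2 phi ->
  sw (x * y) phi = sw x (fun a b => sw y (fun c d => phi (a * c) (b * d))).
Proof.
move=> bphi; have m := bilinear2_multilinear bphi.
rewrite /sw comulM /tmul (linear_teval _ _ (teval_linear m)).
congr (teval _ _); apply/funext => s.
rewrite (linear_teval _ _ (teval_linear m)).
congr (teval _ _); apply/funext => t.
by rewrite (teval_pure _ m) !(nth_mktup (fun j => s`_j * t`_j)).
Qed.

Lemma sw_coassoc (W : lmodType k) x (phi : H -> H -> H -> W) :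
  (forall b c, linear (fun a => phi a b c)) ->
  (forall a c, linear (fun b => phi a b c)) ->
  (forall a b, linear (phi a b)) ->
  sw x (fun a b => sw a (fun c d => phi c d b)) =
  sw x (fun a b => sw b (fun c d => phi a c d)).
Proof.
move=> l1 l2 l3.
have m : multilinear (fun t : 3.-tuple H => phi t`_0 t`_1 t`_2).
  by move=> [[|[|[|//]]] lt_j] p; rewrite /= => a y z; rewrite !nth_tset /=;
    rewrite ?l1 ?l2 ?l3.
have := congr1 (teval (fun t : 3.-tuple H => phi t`_0 t`_1 t`_2)) (comulA x).
rewrite /comul_at !(linear_teval _ _ (teval_linear m)) => e.
transitivity (sw x (fun a b => sw a (fun c d => phi c d b))) => //.
move: e; congr (_ = _); congr (teval _ _); apply/funext => t.
  rewrite (linear_teval _ _ (teval_linear m)); congr (teval _ _).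
  by apply/funext => p; rewrite (teval_pure _ m) !nth_insert2.
rewrite (linear_teval _ _ (teval_linear m)); congr (teval _ _).
by apply/funext => p; rewrite (teval_pure _ m) !nth_insert2.
Qed.

Lemma sw_counitl (W : lmodType k) x (f : H -> W) : linear f ->
  sw x (fun a b => counit H a *: f b) = f x.
Proof.
move=> lf; rewrite -[in RHS](counitl x) (linear_teval _ _ lf).
by congr (teval _ _); apply/funext => p; rewrite (linZ _ _ lf).
Qed.

Lemma sw_counitr (W : lmodType k) x (f : H -> W) : linear f ->
  sw x (fun a b => counit H b *: f a) = f x.
Proof.
move=> lf; rewrite -[in RHS](counitr x) (linear_teval _ _ lf).
by congr (teval _ _); apply/funext => p; rewrite (linZ _ _ lf).
Qed.

Lemma sw_antipodel (W : lmodType k) x (f : H -> W) : linear f ->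
  sw x (fun a b => f (antipode H a * b)) = counit H x *: f 1.
Proof.
move=> lf; rewrite -(linZ _ _ lf) -antipodel.
by rewrite (linear_teval _ _ lf).
Qed.

Lemma sw_antipoder (W : lmodType k) x (f : H -> W) : linear f ->
  sw x (fun a b => f (a * antipode H b)) = counit H x *: f 1.
Proof.
move=> lf; rewrite -(linZ _ _ lf) -antipoder.
by rewrite (linear_teval _ _ lf).
Qed.

End SweedlerNotation.

(** Stands for the linearity lemmas that a call of [lin] may also use; it is
    extended below as further linear operations are introduced. *)
Ltac lin_action := fail.
Ltac lin := intros; rewrite /=; first
  [ exact: lin_id | exact: lin_fun | exact: lin_scalar | eassumption
  | match goal with H : forall _, linear _ |- _ => exact: H end
  | apply: lin_mull; lin | apply: lin_mulr; lin
  | apply: lin_scalel; lin | apply: lin_scaler; lin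
  | apply: lin_sw; lin
  | apply: lin_swx; [lin | split; lin]
  | lin_action; lin
  | apply: (lin_comp (lin_fun _)); lin
  | apply: (lin_comp (lin_scalar _)); lin
  ].
Ltac bilin := split; lin.

(** * The antipode *)

Section Antipode.
Variables (k : fieldType) (H : hopf_alg k).
Local Notation S := (antipode H).

(** Both sides are convolution inverses of the multiplication, as maps on
    H (x) H. The auxiliary term P below is their common value
    S(x_1 y_1) x_2 y_2 S(y_3) S(x_3). *)
Lemma antipodeM x y : S (x * y) = S y * S x.
Proof.
pose P := sw x (fun a b => sw y (fun c d => sw a (fun a1 a2 => sw c (fun c1 c2 =>
  S (a1 * c1) * (a2 * c2) * (S d * S b))))).
transitivity P; last first.
  transitivity (sw x (fun a b => sw y (fun c d =>
      (counit H a * counit H c) *: (S d * S b)))).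
    apply: eq_sw => a b; apply: eq_sw => c d.
    rewrite -(swM _ _ (phi := fun u v => S u * v * (S d * S b))); last by bilin.
    rewrite (sw_antipodel _ (f := fun u => u * (S d * S b))); last by lin.
    by rewrite counitM mul1r.
  transitivity (sw x (fun a b => counit H a *: (S y * S b))).
    apply: eq_sw => a b.
    rewrite -(sw_counitl y (f := fun d => counit H a *: (S d * S b))); last by lin.
    by apply: eq_sw => c d; rewrite scalerA mulrC.
  by rewrite (sw_counitl x (f := fun b => S y * S b)); last by lin.
transitivity (sw x (fun a b => sw a (fun a1 a2 => sw y (fun c d =>
    sw c (fun c1 c2 => S (a1 * c1) * (a2 * c2) * (S d * S b)))))); last first.
  by apply: eq_sw => a b; rewrite sw_exchange.
rewrite (sw_coassoc x (phi := fun a1 a2 b => sw y (fun c d => sw c (fun c1 c2 =>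
  S (a1 * c1) * (a2 * c2) * (S d * S b))))); try by lin.
rewrite -[LHS](sw_counitr x (f := fun a => S (a * y))); last by lin.
apply: eq_sw => a b.
transitivity (sw b (fun b1 b2 => S (a * y) * (b1 * S b2))).
  by rewrite (sw_antipoder b (f := fun z => S (a * y) * z)) ?mulr1; last by lin.
apply: eq_sw => b1 b2.
rewrite (sw_coassoc y (phi := fun c1 c2 d =>
  S (a * c1) * (b1 * c2) * (S d * S b2))); try by lin.
rewrite mulrA -(sw_counitr y (f := fun c => S (a * c) * b1 * S b2)); last by lin.
apply: eq_sw => c d.
rewrite -(mulr1 b1) [S _ * _]mulrA.
rewrite -(sw_antipoder d (f := fun z => S (a * c) * b1 * z * S b2)); last by lin.
by apply: eq_sw => d1 d2; rewrite mulr1 !mulrA.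
Qed.

Lemma antipode1 : S 1 = 1.
Proof.
rewrite -[LHS]mulr1.
rewrite -(sw_pure (x := 1) (phi := fun a b => S a * b)) ?comul1 //; last by bilin.
by rewrite (sw_antipodel 1 (f := id)) ?counit1 ?scale1r.
Qed.

End Antipode.

Lemma antipode_grouplike (k : fieldType) (H : hopf_alg k) (y y' : H) :
    comul H y = pure [tuple y; y] -> counit H y = 1 -> y * y' = 1 ->
  antipode H y = y'.
Proof.
move=> cy ey yy'; rewrite -[LHS]mulr1 -yy' mulrA.
suff -> : antipode H y * y = 1 by rewrite mul1r.
rewrite -(sw_pure (phi := fun a b => antipode H a * b) _ cy); last by bilin.
by rewrite (sw_antipodel y (f := id)) // ey scale1r.
Qed.

(** * The root system and 2 rho *)

Section RootSystem.
Variables (l : nat) (g : semisimple_datum l).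
Local Notation weight := 'rV[int]_l.
Local Notation simple i := (delta_mx 0 i : weight).
Local Notation Phi := (Defs.roots g).

(** The value of b on the simple coroot of index i; the entry a_ij of the
    Cartan matrix is the value on alpha_j. *)
Definition coroot (i : 'I_l) (b : weight) : int := \sum_j cartan g i j * b 0 j.
Definition simple_refl (i : 'I_l) (b : weight) : weight := b - coroot i b *: simple i.
Definition height (b : weight) : int := \sum_i b 0 i.
Definition positive (b : weight) : bool := [forall i, 0 <= b 0 i].

Lemma coroot_linear i : linear (coroot i : weight -> int^o).
Proof.
move=> a b c; rewrite /coroot scaler_sumr -big_split; apply: eq_bigr => j _.
by rewrite !mxE mulrDr mulrCA.
Qed.
HB.instance Definition _ i :=
  GRing.isLinear.Build int weight int^o _ (coroot i) (coroot_linear i).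

Lemma coroot_simple i j : coroot i (simple j) = cartan g i j.
Proof.
rewrite /coroot (bigD1 j) //= big1 ?addr0 => [|r ne].
  by rewrite mxE !eqxx mulr1.
by rewrite mxE (negPf ne) andbF mulr0.
Qed.

Lemma simple_reflK i : involutive (simple_refl i).
Proof.
move=> b; rewrite /simple_refl; set m := coroot i b.
have -> : coroot i (b - m *: simple i) = - m.
  by rewrite linearB linearZ /= coroot_simple cartan_diag -/m /GRing.scale /=; ring.
by rewrite scaleNr opprK subrK.
Qed.

Lemma reflect_linear i : linear (simple_refl i).
Proof.
move=> a b c; rewrite /simple_refl linearP scalerDl scalerBr scalerA opprD.
by rewrite addrACA.
Qed.
HB.instance Definition _ i :=
  GRing.isLinear.Build int weight weight _ (simple_refl i) (reflect_linear i).

Lemma simple_refl_simple i : simple_refl i (simple i) = - simple i.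
Proof.
rewrite /simple_refl coroot_simple cartan_diag -{1}[simple i]scale1r -scalerBl.
by rewrite -scaleN1r.
Qed.

Lemma root_form_simple i c :
  root_form (cartan g) (symd g) c (simple i) = (symd g i)%:Z * coroot i c.
Proof.
rewrite /root_form /coroot mulr_sumr; apply: eq_bigr => j _.
rewrite (bigD1 i) //= big1 ?addr0 => [|r ne].
  by rewrite mxE !eqxx mulr1 cartan_symm mulrA.
by rewrite mxE (negPf ne) andbF mulr0.
Qed.

(** The zero vector would be a multiple of itself by any integer. *)
Lemma root_neq0 b : b \in Phi -> b != 0.
Proof.
move=> rb; apply/eqP => b0; rewrite b0 in rb.
by have := @roots_reduced _ g _ 0 rb; rewrite scaler0 => /(_ rb) [].
Qed.

Lemma rootN b : b \in Phi -> - b \in Phi.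
Proof.
move=> rb; have [m] := roots_reflection rb rb.
have := root_form_pos g (root_neq0 rb); set f := root_form _ _ _ _ => fp e.
have -> : m = 2 by apply: (mulIf (lt0r_neq0 fp)).
by rewrite -{1}[b]scale1r -scalerBl -scaleN1r.
Qed.

Lemma root_simple_refl i b : b \in Phi -> simple_refl i b \in Phi.
Proof.
move=> rb; have [m] := roots_reflection (roots_simple g i) rb.
rewrite !root_form_simple coroot_simple cartan_diag => e.
suff -> : m = coroot i b by [].
have d0 : (symd g i)%:Z != 0 by have := symd_range g i; case: (symd g i).
by apply: (mulfI d0); apply: (@mulfI _ 2) => //; rewrite e; ring.
Qed.

Lemma height_linear : linear (height : weight -> int^o).
Proof.
move=> a b c; rewrite /height scaler_sumr -big_split; apply: eq_bigr => j _.
by rewrite !mxE.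
Qed.
HB.instance Definition _ :=
  GRing.isLinear.Build int weight int^o _ height height_linear.

Lemma weightE (b : weight) : b = \sum_i b 0 i *: simple i.
Proof.
apply/rowP => j; rewrite summxE (bigD1 j) //= big1 => [|i ne].
  by rewrite !mxE !eqxx mulr1 addr0.
by rewrite !mxE eq_sym (negPf ne) andbF mulr0.
Qed.

Lemma height_simple i : height (simple i) = 1.
Proof.
rewrite /height (bigD1 i) //= big1 ?addr0 => [|r ne]; first by rewrite mxE !eqxx.
by rewrite mxE (negPf ne) andbF.
Qed.

(** A regular linear form cuts the roots into two halves. The forms in the
    Weyl group orbit of the height are used in place of the group elements. *)
Definition regular (f : {linear weight -> int^o}) := forall b, b \in Phi -> f b != 0.
(** For the form [height \o w] this is the image of 2 rho under the inverse of
    w. *)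
Definition pos_sum (f : {linear weight -> int^o}) : weight :=
  \sum_(b <- Phi | 0 < f b) b.

(** An involution of the roots reindexes sums over the roots. *)
Lemma root_sum_sym (s F : weight -> weight) (P : pred weight) :
    involutive s -> {in Phi, forall b, s b \in Phi} ->
  \sum_(b <- Phi | P b) F b = \sum_(b <- Phi | P (s b)) F (s b).
Proof.
move=> sK sP; rewrite -(big_map s P F); apply: perm_big.
apply: uniq_perm; rewrite ?(map_inj_uniq (inv_inj sK)) ?roots_uniq //.
move=> b; apply/idP/mapP => [rb|[c rc ->]]; last exact: sP.
by exists (s b); rewrite ?sP ?sK.
Qed.

Lemma pos_sum_refl (f : {linear weight -> int^o}) i :
  pos_sum (f \o simple_refl i)%FUN = simple_refl i (pos_sum f).
Proof.
rewrite /pos_sum linear_sum.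
rewrite (root_sum_sym _ _ (simple_reflK i) (fun b => @root_simple_refl i b)) /=.
by apply: eq_bigl => b; rewrite simple_reflK.
Qed.

(** The roots on which f and f' agree in sign cancel. A root b with f b > 0
    and f' b < 0 contributes b to the first sum and its opposite contributes
    - b to the second one. *)
Lemma pos_sum_sub f f' : regular f -> regular f' ->
  pos_sum f - pos_sum f' = 2 *: \sum_(b <- Phi | (0 < f b) && (f' b < 0)) b.
Proof.
move=> rf rf'; rewrite /pos_sum.
rewrite (bigID (fun b => 0 < f' b)) /=.
rewrite (bigID (fun b => 0 < f b) (fun b => 0 < f' b)) /=.
have e1 : \sum_(b <- Phi | (0 < f b) && ~~ (0 < f' b)) b =
    \sum_(b <- Phi | (0 < f b) && (f' b < 0)) b.
  rewrite [LHS]big_seq_cond [RHS]big_seq_cond; apply: eq_bigl => b.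
  case rb: (b \in Phi) => //=; have := rf' _ rb.
  by case: (0 < f b) => //=; case: ltgtP.
have e2 : \sum_(b <- Phi | (0 < f' b) && ~~ (0 < f b)) b =
    - \sum_(b <- Phi | (0 < f b) && (f' b < 0)) b.
  rewrite (root_sum_sym _ _ (@opprK _) (@rootN)) sumrN; congr (- _).
  rewrite [LHS]big_seq_cond [RHS]big_seq_cond; apply: eq_bigl => b.
  case rb: (b \in Phi) => //=; have := rf _ rb.
  rewrite !linearN /= !oppr_gt0 andbC; case: (f' b < 0); rewrite ?andbF //=.
  by case: ltgtP.
have aux (x x' y : weight) : x = x' -> x + y - (x' - y) = 2 *: y.
  by move=> ->; rewrite opprB addrC addrA subrK -mulr2n scaler_nat.
by rewrite e1 e2; apply: aux; apply: eq_bigl => b; rewrite andbC.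
Qed.

Lemma height_eq0 (b : weight) : (forall i, 0 <= b 0 i) -> height b = 0 -> b = 0.
Proof.
move=> pb /psumr_eq0P h0; apply/rowP => i; rewrite mxE.
exact: h0 (fun i _ => pb i) i isT.
Qed.

Lemma root_positive b : b \in Phi -> positive b = (0 < height b).
Proof.
move=> rb; have b0 := root_neq0 rb; apply/forallP/idP => [pb|hb].
  rewrite lt_def sumr_ge0 // andbT; apply: contraNneq b0 => h0.
  by rewrite (height_eq0 pb h0).
case: (roots_base rb) => // nb; suff: height b <= 0 by rewrite leNgt hb.
by apply: sumr_le0.
Qed.

Lemma height_regular : regular height.
Proof.
move=> b rb; apply: contraNneq (root_neq0 rb) => h0.
case: (roots_base rb) => [pb|nb]; first by rewrite (height_eq0 pb h0).
have := @height_eq0 (- b); rewrite linearN /= h0 oppr0.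
by move=> /(_ (fun i => _) erefl)/eqP; rewrite oppr_eq0; apply => i; rewrite mxE oppr_ge0.
Qed.

Lemma two_rhoE : two_rho g = pos_sum height.
Proof.
rewrite /two_rho /pos_sum [LHS]big_seq_cond [RHS]big_seq_cond.
apply: eq_bigl => b; case rb: (b \in Phi) => //=; exact: root_positive.
Qed.

Lemma pos_sum_opp f : regular f -> (forall i, f (simple i) < 0) ->
  pos_sum f = - two_rho g.
Proof.
move=> rf nf; rewrite two_rhoE /pos_sum (root_sum_sym _ _ (@opprK _) (@rootN)).
rewrite sumrN; congr (- _); rewrite [LHS]big_seq_cond [RHS]big_seq_cond.
apply: eq_bigl => b; case rb: (b \in Phi) => //=.
rewrite -root_positive // linearN oppr_gt0 [in LHS](weightE b) linear_sum /=.
have e i : f (b 0 i *: simple i) = b 0 i * f (simple i) by rewrite linearZ.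
apply/idP/forallP => [nb i|pb].
  case: (roots_base rb) => // nb'; move: nb; rewrite ltNge sumr_ge0 // => j _.
  by rewrite e mulr_le0 // ltW.
rewrite lt_def; apply/andP; split.
  have := rf _ rb; rewrite [in X in X -> _](weightE b) linear_sum /= eq_sym; exact.
by apply: sumr_le0 => j _; rewrite e mulr_ge0_le0 // ltW.
Qed.

Section Descent.
Variable P : weight -> Prop.
Hypothesis Pstep : forall i b p, coroot i b = 2 * p -> P b -> P (simple_refl i b).

(** Let m be the coroot value. By [pos_sum_sub], m alpha_i is twice the sum B
    of the roots on which f is positive and its reflection negative: comparing
    coordinates, m is even; applying the coroot, m is the coroot value of B,
    a sum of positive integers in which alpha_i occurs. *)
Lemma coroot_pos_sum f i : regular f -> 0 < f (simple i) ->
  exists2 p, coroot i (pos_sum f) = 2 * p & 0 < p.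
Proof.
move=> rf fi; pose f' : {linear weight -> int^o} := (f \o simple_refl i)%FUN.
have rf' : regular f' by move=> b rb; apply/rf/root_simple_refl.
have := pos_sum_sub rf rf'; rewrite pos_sum_refl {1}/simple_refl subKr.
set m := coroot i _; set B := \sum_(b <- _ | _) b => e.
exists (B 0 i); first by have := congr1 (fun b : weight => b 0 i) e;
  rewrite !mxE !eqxx mulr1.
suff: 0 < coroot i B.
  have := congr1 (coroot i) e; rewrite !linearZ /= coroot_simple cartan_diag.
  have := congr1 (fun b : weight => b 0 i) e; rewrite !mxE !eqxx mulr1.
  rewrite /GRing.scale /=; lia.
have pos (b : weight) : 0 < f b -> f' b < 0 -> 0 < coroot i b.
  have -> : f' b = f b - coroot i b * f (simple i).
    by rewrite /f' /= /simple_refl linearB linearZ.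
  move=> fb; rewrite subr_lt0 => /(lt_trans fb).
  by rewrite pmulr_lgt0.
rewrite /B linear_sum big_mkcond (bigD1_seq (simple i)) ?roots_simple ?roots_uniq //=.
have f's : f' (simple i) < 0 by rewrite /f' /= simple_refl_simple linearN oppr_lt0.
rewrite fi f's ltr_wpDr ?pos //; apply: sumr_ge0 => b _.
by case: ifP => // /andP[fb f'b]; apply/ltW/pos.
Qed.

(** While f is positive on some simple root alpha_i, reflecting in alpha_i
    lowers the height of [pos_sum f] by [coroot_pos_sum]. When f is negative on
    all simple roots, [pos_sum f] is - 2 rho. The bound makes the height shifted
    by the sum of the absolute heights of all roots a natural number. *)
Lemma height_descent n (f : {linear weight -> int^o}) :
    regular f -> P (pos_sum f) ->
    height (pos_sum f) + \sum_(b <- Phi) `|height b| < n%:Z ->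
  P (- two_rho g).
Proof.
elim: n f => [|n IH] f rf Pf.
  rewrite ltNge -lerBlDr sub0r => /negP [].
  rewrite linear_sum -sumrN [leRHS]big_mkcond /=; apply: ler_sum => b _.
  case: ifP => _; last by rewrite oppr_le0.
  by rewrite lerNl -normrN ler_norm.
move=> lt_n; case: (pickP (fun i => 0 < f (simple i))) => [i fi|nf]; last first.
  rewrite -(pos_sum_opp rf) // => i.
  by have := rf _ (roots_simple g i); have := nf i; case: ltgtP.
have [p ep p0] := coroot_pos_sum rf fi.
apply: (IH (f \o simple_refl i)%FUN).
- by move=> b rb; apply/rf/root_simple_refl.
- by rewrite pos_sum_refl; apply: Pstep Pf; exact: ep.
rewrite pos_sum_refl /simple_refl linearB linearZ /= height_simple ep.
move: lt_n p0; rewrite /GRing.scale /=; lia.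
Qed.

(** This replaces the longest element of the Weyl group: - 2 rho is reached
    from 2 rho by simple reflections, and each of them is applied at a vector
    with an even coroot value. Evenness is what [trace_weyl] can handle. *)
Lemma two_rho_descent : P (two_rho g) -> P (- two_rho g).
Proof.
rewrite {1}two_rhoE => /(height_descent height_regular); set m := _ + _.
by apply; apply: (@le_lt_trans _ _ `|m|%:Z); rewrite ?ltz_nat ?ltnSn // ; lia.
Qed.

End Descent.

(** The reflection in alpha_i permutes the positive roots other than alpha_i:
    such a root has a positive coordinate at some j <> i, which the reflection
    does not change. Hence it maps 2 rho to 2 rho - 2 alpha_i. *)
Lemma coroot_two_rho i : coroot i (two_rho g) = 2.
Proof.
have rs := roots_simple g i.
have pos_refl b : b \in Phi -> b != simple i -> positive b -> positive (simple_refl i b).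
  move=> rb ne /forallP pb; have [/existsP [j /andP[ji bj]]|] :=
    boolP [exists j, (j != i) && (0 < b 0 j)].
    case: (roots_base (root_simple_refl i rb)) => [|nb]; first by move=> ?; apply/forallP.
    have := nb j; rewrite !mxE (negPf ji) andbF mulr0 subr0.
    by rewrite leNgt bj.
  rewrite negb_exists => /forallP b0.
  have eb : b = b 0 i *: simple i.
    apply/rowP => j; rewrite !mxE eqxx /=; case: eqVneq => [->|ji]; first by rewrite mulr1.
    by have := b0 j; rewrite ji /= -leNgt mulr0 => ?; apply: le_anti; rewrite pb andbT.
  move: ne (rb) (pb i); rewrite eb => ne rb' _.
  case: (roots_reduced rs rb') => e; first by rewrite e scale1r eqxx in ne.
  by have := pb i; rewrite e.
have : simple_refl i (two_rho g) = two_rho g - 2 *: simple i.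
  rewrite /two_rho linear_sum /=.
  have E : \sum_(b <- Phi | positive b && (b != simple i)) simple_refl i b =
           \sum_(b <- Phi | positive b && (b != simple i)) b.
    rewrite (root_sum_sym _ _ (simple_reflK i) (fun b => @root_simple_refl i b)).
    under eq_bigr => b _ do rewrite simple_reflK.
    rewrite [LHS]big_seq_cond [RHS]big_seq_cond; apply: eq_bigl => b.
    case rb: (b \in Phi) => //=.
    have nposN : positive (- simple i) = false.
      by apply/negP => /forallP /(_ i); rewrite !mxE !eqxx.
    have [->|bs] := eqVneq b (simple i); first by rewrite simple_refl_simple nposN andbF.
    have [sbs|sbs] := eqVneq (simple_refl i b) (simple i).
      by rewrite -(simple_reflK i b) sbs simple_refl_simple nposN andbF.
    rewrite !andbT; apply/idP/idP => [|pb]; last exact: pos_refl.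
    by move=> /(pos_refl _ (root_simple_refl i rb) sbs); rewrite simple_reflK.
  have split_s (F : weight -> weight) : \sum_(b <- Phi | positive b) F b =
      F (simple i) + \sum_(b <- Phi | positive b && (b != simple i)) F b.
    rewrite (bigID (pred1 (simple i))) /=; congr (_ + _).
    rewrite big_mkcond (bigD1_seq (simple i)) ?roots_uniq //= eqxx andbT.
    have -> : positive (simple i) by apply/forallP => j; rewrite mxE; case: eqP.
    by rewrite big1 ?addr0 // => b /negPf ->; rewrite andbF.
  rewrite !split_s E simple_refl_simple [simple i + _]addrC -addrA.
  have -> : simple i - 2 *: simple i = - simple i.
    by rewrite -{1}[simple i]scale1r -scalerBl -scaleN1r.
  by rewrite addrC.
rewrite {1}/simple_refl => /(congr1 (fun b : weight => b 0 i)).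
by rewrite !mxE !eqxx !mulr1 => /addrI/oppr_inj.
Qed.

End RootSystem.

(** * The torus of the quantized enveloping algebra *)

Section QCommutation.
Variables (k : fieldType) (B : algType k).

(** q-commutation with a fixed e: the scalars multiply along products and are
    inverted with x. *)
Definition qcomm (c : k) (x e : B) := x * e = c *: (e * x).

Lemma qcomm1 e : qcomm 1 1 e.
Proof. by rewrite /qcomm mul1r mulr1 scale1r. Qed.

Lemma qcommM c c' x x' e :
  qcomm c x e -> qcomm c' x' e -> qcomm (c * c') (x * x') e.
Proof.
rewrite /qcomm => h h'; rewrite -mulrA h' -scalerAr [x * (e * x')]mulrA h -scalerAl scalerA.
by rewrite [c' * c]mulrC mulrA.
Qed.

Lemma qcommX c x e n : qcomm c x e -> qcomm (c ^+ n) (x ^+ n) e.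
Proof.
move=> h; elim: n => [|n IH]; first exact: qcomm1.
by rewrite !exprS; apply: qcommM.
Qed.

Lemma qcommV c x x' e : c != 0 -> x * x' = 1 -> x' * x = 1 ->
  qcomm c x e -> qcomm c^-1 x' e.
Proof.
rewrite /qcomm => c0 xx' x'x h.
rewrite -[LHS]mulr1 -xx' -!mulrA [e * (x * x')]mulrA.
have -> : e * x = c^-1 *: (x * e) by rewrite h scalerA mulVf ?scale1r.
by rewrite -scalerAl -scalerAr !mulrA x'x mul1r.
Qed.

End QCommutation.

Section Torus.
Variables (k : fieldType) (l : nat) (g : semisimple_datum l) (q : k).
Variable U : Uq g q.
Local Notation E := (Uq_E U).
Local Notation F := (Uq_F U).
Local Notation K := (Uq_K U).
Local Notation Ki := (Uq_Ki U).
Local Notation Kexp := (Kexp U).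
Local Notation Kroot := (Kroot U).

Lemma mulKKi i : K i * Ki i = 1. Proof. exact: Uq_KKi (Uq_rel U) i. Qed.
Lemma mulKiK i : Ki i * K i = 1. Proof. exact: Uq_KiK (Uq_rel U) i. Qed.
Lemma K_comm i j : GRing.comm (K i) (K j). Proof. exact: Uq_KK (Uq_rel U) i j. Qed.

Lemma comm_Ki x i : GRing.comm x (K i) -> GRing.comm x (Ki i).
Proof.
rewrite /GRing.comm => h.
rewrite -[LHS]mul1r -(mulKiK i) mulrA -[Ki i * K i * x]mulrA -h mulrA -mulrA.
by rewrite mulKKi mulr1.
Qed.

Lemma comm_Kexp x i m : GRing.comm x (K i) -> GRing.comm x (Kexp i m).
Proof. by case: m => n h /=; apply: commrX => //; apply: comm_Ki. Qed.

Lemma comm_Kroot x lam : (forall i, GRing.comm x (K i)) -> GRing.comm x (Kroot lam).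
Proof. by move=> h; apply: commr_prod => i _; apply: comm_Kexp. Qed.

Lemma Kroot_comm lam mu : GRing.comm (Kroot lam) (Kroot mu).
Proof.
apply: comm_Kroot => i; apply: commr_sym; apply: comm_Kroot => j; exact: K_comm.
Qed.

Lemma Kexp_succ i m : Kexp i (m + 1) = Kexp i m * K i.
Proof.
case: m => [n|[|n]]; first by rewrite -PoszD addn1 /= exprSr.
  by rewrite /= expr1 mulKiK.
have -> : Negz n.+1 + 1 = Negz n by lia.
by rewrite /= [in RHS]exprSr -mulrA mulKiK mulr1.
Qed.

Lemma Kexp_pred i m : Kexp i (m - 1) = Kexp i m * Ki i.
Proof. by rewrite -[in RHS](subrK 1 m) Kexp_succ -mulrA mulKKi mulr1. Qed.

Lemma KexpD i m n : Kexp i (m + n) = Kexp i m * Kexp i n.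
Proof.
elim/int_rect: n => [|n IH|n IH]; first by rewrite addr0 mulr1.
  by rewrite -[n.+1]addn1 PoszD addrA !Kexp_succ IH mulrA.
by rewrite -[n.+1]addn1 PoszD opprD addrA !Kexp_pred IH mulrA.
Qed.

Lemma Kroot0 : Kroot 0 = 1.
Proof. by rewrite /Defs.Kroot big1 // => i _; rewrite mxE. Qed.

Lemma KrootD lam mu : Kroot (lam + mu) = Kroot lam * Kroot mu.
Proof.
rewrite /Defs.Kroot -prodrM_comm.
  by apply: eq_bigr => i _; rewrite mxE KexpD.
move=> i j _ _; apply: commr_sym; apply: comm_Kexp; apply: commr_sym.
by apply: comm_Kexp; apply: K_comm.
Qed.

Lemma KrootN lam : Kroot lam * Kroot (- lam) = 1.
Proof. by rewrite -KrootD subrr Kroot0. Qed.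

Lemma Kroot_simple i (m : int) : Kroot (m *: delta_mx 0 i) = Kexp i m.
Proof.
rewrite /Defs.Kroot (@big_only1 _ _ _ _ i) // => [|j ji _].
  by rewrite !mxE !eqxx mulr1.
by rewrite !mxE (negPf ji) andbF mulr0.
Qed.

Lemma mul_sigmaV : sigma U * sigma_inv U = 1. Proof. exact: KrootN. Qed.
Lemma mulV_sigma : sigma_inv U * sigma U = 1.
Proof. by rewrite /sigma_inv /sigma Kroot_comm KrootN. Qed.

Hypothesis q0 : q != 0.

Lemma qi_neq0 i : qi g q i != 0. Proof. exact: expf_neq0. Qed.

(** Both sides are q to the power d_i a_ij. *)
Lemma qi_cartan i j : qi g q j ^ cartan g j i = qi g q i ^ cartan g i j.
Proof. by rewrite /qi !exprnP !exprz_exp cartan_symm. Qed.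

Lemma qi_cartanN i j : qi g q j ^ (- cartan g j i) = qi g q i ^ (- cartan g i j).
Proof. by rewrite /qi !exprnP !exprz_exp !mulrN cartan_symm. Qed.

Lemma qcomm_Kroot (c : 'I_l -> int) i e (lam : 'rV[int]_l) :
  (forall j, qcomm (qi g q i ^ c j) (K j) e) ->
  qcomm (qi g q i ^ (\sum_j c j * lam 0 j)) (Kroot lam) e.
Proof.
move=> h; have x0 := qi_neq0 i.
rewrite (big_morph _ (fun m n => expfzDr m n x0) (expr0z _)) /Defs.Kroot.
apply: (big_rec2 (fun a b => qcomm a b e)); first exact: qcomm1.
move=> j a b _; apply: qcommM; rewrite -exprz_exp.
case: (lam 0 j) => n; first exact: qcommX.
rewrite NegzE -exprnN -exprVn; apply: qcommX; apply: qcommV (h j).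
- by rewrite expfz_neq0.
- exact: mulKKi.
- exact: mulKiK.
Qed.

Lemma qcomm_KE i lam : qcomm (qi g q i ^ coroot g i lam) (Kroot lam) (E i).
Proof.
apply: qcomm_Kroot => j; rewrite /qcomm -qi_cartan scalerAl -(Uq_KE (Uq_rel U)).
by rewrite -!mulrA mulKiK mulr1.
Qed.

Lemma qcomm_KF i lam : qcomm (qi g q i ^ (- coroot g i lam)) (Kroot lam) (F i).
Proof.
rewrite /coroot -sumrN; under eq_bigr => j _ do rewrite -mulNr.
apply: (qcomm_Kroot (c := fun j => - cartan g i j)) => j.
rewrite /qcomm -qi_cartanN scalerAl -(Uq_KF (Uq_rel U)).
by rewrite -!mulrA mulKiK mulr1.
Qed.

End Torus.

(** * The square of the antipode *)

Section AntipodeSquare.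
Variables (k : fieldType) (l : nat) (g : semisimple_datum l) (q : k).
Variable U : Uq g q.
Hypothesis q0 : q != 0.
Local Notation S := (antipode U).

(** The two algebra endomorphisms compared in [antipodeK_sigma]; both are
    equipped with their morphism structure, so that it is enough to compare
    them on generators. *)
Definition antipode_sq (y : U) : U := S (S y).
Definition conj_sigma (y : U) : U := sigma U * y * sigma_inv U.

Lemma antipode_sq_linear : linear antipode_sq.
Proof. by move=> a x y; rewrite /antipode_sq !linearP. Qed.
HB.instance Definition _ := GRing.isLinear.Build k U U _ antipode_sq
  antipode_sq_linear.
Lemma antipode_sq_monoid : monoid_morphism antipode_sq.
Proof. by split=> [|x y]; rewrite /antipode_sq ?antipode1 // !antipodeM. Qed.
HB.instance Definition _ := GRing.isMonoidMorphism.Build U U antipode_sq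
  antipode_sq_monoid.

Lemma conj_sigma_linear : linear conj_sigma.
Proof. by rewrite /conj_sigma; lin. Qed.
HB.instance Definition _ := GRing.isLinear.Build k U U _ conj_sigma
  conj_sigma_linear.
Lemma conj_sigma_monoid : monoid_morphism conj_sigma.
Proof.
rewrite /conj_sigma; split=> [|x y]; first by rewrite mulr1 mul_sigmaV.
by rewrite -!mulrA; congr (_ * (_ * _)); rewrite [in RHS]mulrA mulV_sigma mul1r.
Qed.
HB.instance Definition _ := GRing.isMonoidMorphism.Build U U conj_sigma
  conj_sigma_monoid.

(** On E_i and F_i both sides are conjugation by K_i, as the coroot i takes
    the value 2 both at alpha_i and at 2 rho. *)
Lemma antipodeK_sigma y : S (S y) = sigma U * y * sigma_inv U.
Proof.
have sK i : conj_sigma (Uq_K U i) = Uq_K U i.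
  rewrite /conj_sigma /sigma -(comm_Kroot _ (K_comm U i)) -mulrA.
  by rewrite -/(sigma U) mul_sigmaV mulr1.
apply: (@Uq_gen _ _ _ _ U U antipode_sq conj_sigma) => i.
split; rewrite /= /antipode_sq.
- rewrite Uq_antipodeE linearN antipodeM Uq_antipodeE Uq_antipodeKi.
  rewrite mulrN opprK mulrA (Uq_KE (Uq_rel U)) cartan_diag /conj_sigma.
  by rewrite (qcomm_KE U q0) coroot_two_rho -scalerAl -mulrA mul_sigmaV mulr1.
- rewrite Uq_antipodeF linearN antipodeM Uq_antipodeF Uq_antipodeK.
  rewrite mulNr opprK (Uq_KF (Uq_rel U)) cartan_diag /conj_sigma.
  by rewrite (qcomm_KF U q0) coroot_two_rho -scalerAl -mulrA mul_sigmaV mulr1.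
- by rewrite Uq_antipodeK Uq_antipodeKi sK.
- rewrite Uq_antipodeKi Uq_antipodeK /conj_sigma.
  have := comm_Ki (commr_sym (comm_Kroot (two_rho g) (K_comm U i))).
  by rewrite /GRing.comm -/(sigma U) => ->; rewrite -mulrA mul_sigmaV mulr1.
Qed.

Lemma antipode_sigma : S (sigma U) = sigma_inv U.
Proof. by have [c e] := Kroot_grouplike U (two_rho g);
  exact: (antipode_grouplike c e (mul_sigmaV U)). Qed.

Lemma antipode_sigma_inv : S (sigma_inv U) = sigma U.
Proof. by have [c e] := Kroot_grouplike U (- two_rho g);
  exact: (antipode_grouplike c e (mulV_sigma U)). Qed.

End AntipodeSquare.

(** * Traces and quantum sl2 *)

Section QuantumSl2.
Variables (k : fieldType) (B : algType k) (x : k).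
Hypotheses (x0 : x != 0) (x2 : x ^+ 2 != 1).

Lemma sqr_sub1_neq0 : x * x - 1 != 0.
Proof. by rewrite subr_eq0 -expr2. Qed.

(** Copies of quantum sl2 in an arbitrary algebra. The relations are symmetric
    under the exchange of E with F and of K with its inverse, which halves the
    computations. *)
Record qsl2 (E F K Ki : B) : Prop := Qsl2 {
  qsl2_KKi : K * Ki = 1;
  qsl2_KiK : Ki * K = 1;
  qsl2_KE : qcomm (x ^+ 2) K E;
  qsl2_KF : qcomm (x ^- 2) K F;
  qsl2_EF : E * F - F * E = (x - x^-1)^-1 *: (K - Ki) }.

Lemma sub_inv_neq0 : x - x^-1 != 0.
Proof.
apply: contraNneq x2 => /eqP; rewrite subr_eq0 => /eqP e.
by rewrite expr2 {1}e mulVf.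
Qed.

Lemma qsl2_sym E F K Ki : qsl2 E F K Ki -> qsl2 F E Ki K.
Proof.
case=> mulKKi mulKiK KE KF EF; split=> //.
- by rewrite -[x ^+ 2]invrK; apply: qcommV KF; rewrite ?invr_eq0 ?expf_neq0.
- by apply: qcommV KE; rewrite ?expf_neq0.
- by rewrite -opprB EF -scalerN opprB.
Qed.

Definition casimir (E F K Ki : B) : B :=
  F * E + ((x - x^-1) ^- 2) *: (x *: K + x^-1 *: Ki).

Lemma casimir_FE E F K Ki :
  F * E = casimir E F K Ki - ((x - x^-1) ^- 2) *: (x *: K + x^-1 *: Ki).
Proof. by rewrite addrK. Qed.

(** The Casimir element is fixed by the symmetry [qsl2_sym]; this gives its
    commutation with F from that with E. *)
Lemma casimir_sym E F K Ki : qsl2 E F K Ki ->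
  casimir F E Ki K = casimir E F K Ki.
Proof.
case=> _ _ _ _ EF; rewrite /casimir -(subrK (F * E) (E * F)) EF.
rewrite [_ + F * E]addrC -addrA; congr (_ + _).
rewrite !(scalerDr, scalerN, scalerA) [_ *: Ki + _]addrC addrACA.
rewrite -scaleNr -!scalerDl; congr (_ *: _ + _ *: _); by field; rewrite x0 sqr_sub1_neq0.
Qed.

Lemma casimir_commE E F K Ki : qsl2 E F K Ki -> GRing.comm (casimir E F K Ki) E.
Proof.
case=> mulKKi mulKiK KE KF EF; rewrite /GRing.comm /casimir.
have KiE : Ki * E = x ^- 2 *: (E * Ki) by apply: qcommV KE; rewrite ?expf_neq0.
have KE' : K * E = x ^+ 2 *: (E * K) by [].
rewrite mulrDl mulrDr mulrA -[in RHS](subrK (F * E) (E * F)) EF mulrDl.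
rewrite [_ + F * E * E]addrC -addrA; congr (_ + _).
rewrite -!(scalerAl, scalerAr) !(mulrDl, mulrDr, mulNr) -!(scalerAl, scalerAr).
rewrite KE' KiE !(scalerDr, scalerN, scalerA) addrACA.
rewrite -scaleNr -!scalerDl; congr (_ *: _ + _ *: _); by field; rewrite x0 sqr_sub1_neq0.
Qed.

Lemma casimir_commF E F K Ki : qsl2 E F K Ki -> GRing.comm (casimir E F K Ki) F.
Proof. by move=> h; rewrite -casimir_sym //; apply/casimir_commE/qsl2_sym. Qed.

Lemma casimir_commK E F K Ki : qsl2 E F K Ki -> GRing.comm (casimir E F K Ki) K.
Proof.
case=> mulKKi mulKiK KE KF _; apply: commr_sym; rewrite /casimir.
apply: commrD.
  rewrite /GRing.comm mulrA [K * F]KF -scalerAl -[F * K * E]mulrA [K * E]KE.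
  by rewrite -scalerAr scalerA mulVf ?expf_neq0 // scale1r mulrA.
rewrite /GRing.comm -scalerAl -scalerAr mulrDl mulrDr -!(scalerAl, scalerAr).
by rewrite mulKKi mulKiK.
Qed.

Variable tau : {scalar B}.
Hypothesis tau_trace : forall a b, tau (a * b) = tau (b * a).

(** Moving E around the trace of T K^(m+1) E F multiplies it by a power of x;
    writing E F and F E through the Casimir element turns this into a relation
    between the traces of K^(m+2), K^m and K^(m+1) times the Casimir. The same
    relation holds with K replaced by its inverse. *)
Lemma trace_step E F K Ki T m : qsl2 E F K Ki -> GRing.comm T E ->
  (1 - x ^+ (2 * m.+1)) * tau (T * K ^+ m.+1 * casimir E F K Ki) =
  (x - x^-1) ^- 2 *
   ((x^-1 - x ^+ (2 * m.+1).+1) * tau (T * K ^+ m.+2) +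
    (x - x ^+ (2 * m).+1) * tau (T * K ^+ m)).
Proof.
move=> h TE; have h' := qsl2_sym h; case: (h) => mulKKi mulKiK KE KF EF.
have := tau_trace E (T * K ^+ m.+1 * F).
have -> : E * (T * K ^+ m.+1 * F) = x ^- (2 * m.+1) *: (T * K ^+ m.+1 * (E * F)).
  have := qcommX m.+1 KE; rewrite /qcomm -exprM => e.
  rewrite !mulrA -TE -[T * E * _]mulrA -[T * _ * E]mulrA e -scalerAr -scalerAl.
  by rewrite scalerA mulVf ?expf_neq0 // scale1r.
rewrite -[T * _ * F * E]mulrA.
move: (casimir_FE E F K Ki) (casimir_FE F E Ki K); rewrite (casimir_sym h).
move: (casimir E F K Ki) => C -> ->.
rewrite !mulrBr -!(scalerAr) !mulrDr -!(scalerAr).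
have -> : T * K ^+ m.+1 * K = T * K ^+ m.+2 by rewrite -mulrA -exprSr.
have -> : T * K ^+ m.+1 * Ki = T * K ^+ m.
  by rewrite -mulrA exprSr -mulrA mulKKi mulr1.
rewrite !(linearB, linearD, linearZ) /=.
rewrite mulnS (exprS x (2 + 2 * m)) (exprS x (2 * m)) exprD.
have y0 : x ^+ (2 * m) != 0 by rewrite expf_neq0.
move: (x ^+ (2 * m)) y0 (tau _) (tau _) (tau _) => y y0 t1 t2 t3.
move=> /eqP; rewrite -subr_eq0 => /eqP e; apply/eqP; rewrite -subr_eq0.
rewrite -(mulr0 (x ^+ 2 * y)) -e; apply/eqP; field.
by rewrite x0 y0 sqr_sub1_neq0.
Qed.

Hypothesis x_generic : forall m, x ^+ m.+1 != 1.

(** Induction on m for all T at once: [trace_step] expresses the trace of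
    T K^(m+2) by the traces of T K^m and T casimir K^(m+1), where T casimir
    satisfies the same hypotheses as T. The coefficient of the new term is
    nonzero since x is not a root of unity. At m = 1 the claim says that the
    commutator of E and F, times T, has trace zero. *)
Lemma trace_weyl E F K Ki T m : qsl2 E F K Ki ->
  GRing.comm T E -> GRing.comm T F -> GRing.comm T K ->
  tau (T * K ^+ m) = tau (T * Ki ^+ m).
Proof.
move=> h; have h' := qsl2_sym h.
pose P m := forall T, GRing.comm T E -> GRing.comm T F -> GRing.comm T K ->
  tau (T * K ^+ m) = tau (T * Ki ^+ m).
suff: P m /\ P m.+1 by move=> [Pm _]; apply: Pm.
elim: m => [|m [Pm Pm1]]; split=> // {}T TE TF TK.
  have := tau_trace E (T * F); rewrite mulrA -TE -!mulrA => /eqP.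
  rewrite -subr_eq0 -linearB -mulrBr (qsl2_EF h) -scalerAr linearZ /= mulf_eq0.
  by rewrite invr_eq0 (negPf sub_inv_neq0) /= mulrBr linearB subr_eq0 => /eqP.
have e := trace_step m h TE; have e' := trace_step m h' TF.
move: e'; rewrite casimir_sym // -[T * _ * _]mulrA.
have comC n : GRing.comm (casimir E F K Ki) (K ^+ n).
  exact: commrX (casimir_commK h).
have comC' n : GRing.comm (casimir E F K Ki) (Ki ^+ n).
  by rewrite -casimir_sym //; apply: commrX; apply: casimir_commK.
have TC (y : B) : GRing.comm T y -> GRing.comm (casimir E F K Ki) y ->
    GRing.comm (T * casimir E F K Ki) y.
  by move=> Ty Cy; apply/commr_sym/commrM; apply: commr_sym.
move: e; rewrite -[T * _ * _]mulrA -!comC -!comC' ![T * (casimir _ _ _ _ * _)]mulrA.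
rewrite Pm1; first last.
- by apply: TC (casimir_commK h).
- by apply: TC (casimir_commF h).
- by apply: TC (casimir_commE h).
have c0 : (x - x^-1) ^- 2 != 0 by rewrite invr_eq0 expf_neq0 ?sub_inv_neq0.
have b0 : x^-1 - x ^+ (2 * m.+1).+1 != 0.
  apply/negP => /eqP b0; have /eqP := x_generic (2 * m.+1).+1; apply.
  by rewrite exprS -[x ^+ _](subKr x^-1) b0 subr0 mulfV.
by rewrite Pm // => -> /(mulfI c0)/addIr/(mulfI b0).
Qed.

End QuantumSl2.

(** * Weyl invariance of traces *)

Section TraceSigma.
Variables (k : fieldType) (l : nat) (g : semisimple_datum l) (q : k).
Variable U : Uq g q.
Hypotheses (q0 : q != 0) (q2 : forall i, qi g q i ^+ 2 != 1).
Variable tau : {scalar U}.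
Hypothesis tau_trace : forall a b, tau (a * b) = tau (b * a).
Hypothesis q_generic : forall m, q ^+ m.+1 != 1.

Lemma qi_not_root_of_unity i m : qi g q i ^+ m.+1 != 1.
Proof.
rewrite /qi -exprM; have := symd_range g i.
by case: (symd g i) => // d _; rewrite mulSn addSn.
Qed.

Lemma Uq_qsl2 i : qsl2 (qi g q i) (Uq_E U i) (Uq_F U i) (Uq_K U i) (Uq_Ki U i).
Proof.
split; [exact: mulKKi | exact: mulKiK | | |].
- have := qcomm_KE U q0 i (delta_mx 0 i).
  by rewrite coroot_simple cartan_diag -[delta_mx _ _]scale1r Kroot_simple.
- have := qcomm_KF U q0 i (delta_mx 0 i).
  by rewrite coroot_simple cartan_diag -[delta_mx _ _]scale1r Kroot_simple.
- by have := Uq_EF (Uq_rel U) i i; rewrite eqxx.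
Qed.

(** With T = K_(lam - p alpha_i), which commutes with E_i, F_i and K_i because
    lam - p alpha_i is orthogonal to alpha_i, the two sides are the traces of
    T K_i^p and T K_i^(- p). *)
Lemma trace_reflect i lam p : coroot g i lam = 2 * p ->
  tau (Kroot U lam) = tau (Kroot U (simple_refl g i lam)).
Proof.
move=> ep; pose mu := lam - p *: delta_mx 0 i.
have mu0 : coroot g i mu = 0.
  by rewrite linearB linearZ /= coroot_simple cartan_diag ep /GRing.scale /=; ring.
have -> : lam = mu + p *: delta_mx 0 i by rewrite subrK.
have -> : simple_refl g i (mu + p *: delta_mx 0 i) = mu + (- p) *: delta_mx 0 i.
  rewrite linearD linearZ /= simple_refl_simple scalerN scaleNr /simple_refl mu0.
  by rewrite scale0r subr0.
rewrite (KrootD _ mu) (KrootD _ mu) !Kroot_simple.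
have TE : GRing.comm (Kroot U mu) (Uq_E U i).
  by have := qcomm_KE U q0 i mu; rewrite mu0 expr0z /qcomm scale1r.
have TF : GRing.comm (Kroot U mu) (Uq_F U i).
  by have := qcomm_KF U q0 i mu; rewrite mu0 oppr0 expr0z /qcomm scale1r.
have TK : GRing.comm (Kroot U mu) (Uq_K U i).
  by apply/commr_sym/comm_Kroot => j; apply: K_comm.
have H m := trace_weyl (qi_neq0 g q0 i) (q2 i) tau_trace (qi_not_root_of_unity i) m
  (Uq_qsl2 i) TE TF TK.
move: (Kroot U mu) H => T H.
case: p {ep mu mu0 TE TF TK} => [[|n]|n]; first by [].
  exact: (H n.+1).
exact: (esym (H n.+1)).
Qed.

(** For the trace in a representation: a module and its dual have the same
    quantum dimension. *)
Lemma trace_sigma : tau (sigma U) = tau (sigma_inv U).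
Proof.
pose P lam := tau (sigma U) = tau (Kroot U lam).
apply: (@two_rho_descent _ g P) => [i b p eb Pb|]; last by [].
by rewrite /P Pb; apply: trace_reflect eb.
Qed.

End TraceSigma.

(** * The two actions on the function algebra *)

Section Pairing.
Variables (k : fieldType) (l : nat) (g : semisimple_datum l) (q : k).
Variables (U : Uq g q) (X : {pred 'rV[int]_l}) (A : OGq U X).
Local Notation "<< y , f >>" := (pairing (o := A) y f) (format "<< y ,  f >>").
Local Notation "y |> f" := (lact (A := A) y f) (at level 40, left associativity).
Local Notation "f <| y" := (ract (A := A) f y) (at level 40, left associativity).

Lemma pairing_ext (f f' : A) : (forall y, <<y, f>> = <<y, f'>>) -> f = f'.
Proof.
move=> e; apply/eqP; rewrite -subr_eq0; apply/eqP/(pairing_inj (o := A)) => y.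
by rewrite addrC -scaleN1r pairing_linr e mulN1r addNr.
Qed.

Lemma pairingZ y c (f : A) : <<y, c *: f>> = c * <<y, f>>.
Proof. exact: (@linZ _ A k^o _ c f (pairing_linr y)). Qed.

Lemma lin_pairl (V : lmodType k) (y : V -> U) (f : A) :
  linear y -> linear (fun v => <<y v, f>> : k^o).
Proof. by move=> ly a u v; rewrite ly pairing_linl. Qed.

Lemma lin_pairr (V : lmodType k) (y : U) (f : V -> A) :
  linear f -> linear (fun v => <<y, f v>> : k^o).
Proof. by move=> lf a u v; rewrite lf pairing_linr. Qed.

End Pairing.

Ltac lin_action ::= first [apply: lin_pairl | apply: lin_pairr].

Section ActionLinearity.
Variables (k : fieldType) (l : nat) (g : semisimple_datum l) (q : k).
Variables (U : Uq g q) (X : {pred 'rV[int]_l}) (A : OGq U X).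
Local Notation "<< y , f >>" := (pairing (o := A) y f) (format "<< y ,  f >>").
Local Notation "y |> f" := (lact (A := A) y f) (at level 40, left associativity).
Local Notation "f <| y" := (ract (A := A) f y) (at level 40, left associativity).

Lemma lin_lactl (V : lmodType k) (y : V -> U) (f : A) :
  linear y -> linear (fun v => y v |> f).
Proof.
by move=> ly; apply: (@lin_sw _ _ _ _ _ (fun v a b => <<y v, b>> *: a)); lin.
Qed.

Lemma lin_lactr (V : lmodType k) (y : U) (f : V -> A) :
  linear f -> linear (fun v => y |> f v).
Proof.
by move=> lf; apply: (@lin_swx _ _ _ _ _ (fun a b => <<y, b>> *: a)) => //; split; lin.
Qed.

Lemma lin_ractl (V : lmodType k) (y : U) (f : V -> A) :
  linear f -> linear (fun v => f v <| y).
Proof.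
by move=> lf; apply: (@lin_swx _ _ _ _ _ (fun a b => <<y, a>> *: b)) => //; split; lin.
Qed.

Lemma lin_ractr (V : lmodType k) (y : V -> U) (f : A) :
  linear y -> linear (fun v => f <| y v).
Proof.
by move=> ly; apply: (@lin_sw _ _ _ _ _ (fun v a b => <<y v, a>> *: b)); lin.
Qed.

End ActionLinearity.

Ltac lin_action ::= first
  [ apply: lin_pairl | apply: lin_pairr | apply: lin_lactl | apply: lin_lactr
  | apply: lin_ractl | apply: lin_ractr ].

Section Actions.
Variables (k : fieldType) (l : nat) (g : semisimple_datum l) (q : k).
Variables (U : Uq g q) (X : {pred 'rV[int]_l}) (A : OGq U X).
Local Notation "<< y , f >>" := (pairing (o := A) y f) (format "<< y ,  f >>").
Local Notation "y |> f" := (lact (A := A) y f) (at level 40, left associativity).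
Local Notation "f <| y" := (ract (A := A) f y) (at level 40, left associativity).

Lemma lactE y f : y |> f = sw f (fun a b => <<y, b>> *: a).
Proof. by []. Qed.

Lemma ractE y f : f <| y = sw f (fun a b => <<y, a>> *: b).
Proof. by []. Qed.

Lemma pairing_mulU y z f :
  <<y * z, f>> = sw f (fun a b => <<y, a>> *: (<<z, b>> : k^o)).
Proof. by rewrite pairing_mull. Qed.

Lemma pairing_lact y z f : <<y, z |> f>> = <<y * z, f>>.
Proof.
rewrite pairing_mulU lactE (linear_sw (f := fun a => <<y, a>> : k^o)); last by lin.
apply: (@eq_sw _ _ k^o) => a b.
by rewrite pairingZ [LHS]mulrC.
Qed.

Lemma pairing_ract y z f : <<y, f <| z>> = <<z * y, f>>.
Proof.
rewrite pairing_mulU ractE (linear_sw (f := fun a => <<y, a>> : k^o)); last by lin.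
by apply: (@eq_sw _ _ k^o) => a b; rewrite pairingZ.
Qed.

Lemma pairingM y f f' :
  <<y, f * f'>> = sw y (fun a b => <<a, f>> *: (<<b, f'>> : k^o)).
Proof. by rewrite pairing_mulr. Qed.

Lemma lactM y z f : (y * z) |> f = y |> (z |> f).
Proof. by apply: pairing_ext => w; rewrite !pairing_lact mulrA. Qed.

Lemma ractM y z f : f <| (y * z) = (f <| y) <| z.
Proof. by apply: pairing_ext => w; rewrite !pairing_ract mulrA. Qed.

Lemma lact_ract y z f : y |> (f <| z) = (y |> f) <| z.
Proof.
by apply: pairing_ext => w; rewrite pairing_lact !pairing_ract pairing_lact mulrA.
Qed.

Lemma lact1 f : 1 |> f = f.
Proof. by apply: pairing_ext => w; rewrite pairing_lact mulr1. Qed.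

Lemma ract1 f : f <| 1 = f.
Proof. by apply: pairing_ext => w; rewrite pairing_ract mul1r. Qed.

Lemma sw_lact (W : lmodType k) y f (phi : A -> A -> W) : bilinear2 phi ->
  sw (y |> f) phi = sw f (fun a b => phi a (y |> b)).
Proof.
move=> [bl br]; have lphi : linear (fun v : A => sw v phi) by exact: (lin_swx (@lin_id _ _)).

rewrite lactE (linear_sw _ _ lphi).
transitivity (sw f (fun a b => sw a (fun c d => <<y, b>> *: phi c d))).
  by apply: eq_sw => a b; rewrite (linZ _ _ lphi) (linear_sw _ _ (lin_scaler _ (@lin_id _ _))).
rewrite (sw_coassoc f (phi := fun c d b => <<y, b>> *: phi c d)); try by lin.
apply: eq_sw => a b; rewrite lactE (linear_sw _ _ (br a)).
by apply: eq_sw => c d; rewrite (linZ _ _ (br a)).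
Qed.

Lemma sw_ract (W : lmodType k) y f (phi : A -> A -> W) : bilinear2 phi ->
  sw (f <| y) phi = sw f (fun a b => phi (a <| y) b).
Proof.
move=> [bl br]; have lphi : linear (fun v : A => sw v phi) by exact: (lin_swx (@lin_id _ _)).

rewrite ractE (linear_sw _ _ lphi).
transitivity (sw f (fun a b => sw b (fun c d => <<y, a>> *: phi c d))).
  by apply: eq_sw => a b; rewrite (linZ _ _ lphi) (linear_sw _ _ (lin_scaler _ (@lin_id _ _))).
rewrite -(sw_coassoc f (phi := fun a c d => <<y, a>> *: phi c d)); try by lin.
apply: eq_sw => a b; rewrite ractE (linear_sw _ _ (bl b)).
by apply: eq_sw => c d; rewrite (linZ _ _ (bl b)).
Qed.

(** Both sides are the sum of <y, f_(2)> phi f_(1) f_(3). *)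
Lemma sw_balance (W : lmodType k) y f (phi : A -> A -> W) : bilinear2 phi ->
  sw f (fun a b => phi (y |> a) b) = sw f (fun a b => phi a (b <| y)).
Proof.
move=> [bl br].
transitivity (sw f (fun a b => sw a (fun c d => <<y, d>> *: phi c b))).
  apply: eq_sw => a b; rewrite lactE (linear_sw _ _ (bl b)).
  by apply: eq_sw => c d; rewrite (linZ _ _ (bl b)).
rewrite (sw_coassoc f (phi := fun c d b => <<y, d>> *: phi c b)); try by lin.
apply: eq_sw => a b; rewrite ractE (linear_sw _ _ (br a)).
by apply: eq_sw => c d; rewrite (linZ _ _ (br a)).
Qed.

Lemma lact_mul y f f' : y |> (f * f') = sw y (fun a b => (a |> f) * (b |> f')).
Proof.
apply: pairing_ext => w; rewrite pairing_lact pairingM.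
rewrite (linear_sw (f := fun v => <<w, v>> : k^o)); last by lin.
rewrite swM; last by bilin.
rewrite sw_exchange; apply: (@eq_sw _ _ k^o) => a b; rewrite pairingM.
by apply: (@eq_sw _ _ k^o) => c d; rewrite !pairing_lact.
Qed.

Lemma ract_mul y f f' : (f * f') <| y = sw y (fun a b => (f <| a) * (f' <| b)).
Proof.
apply: pairing_ext => w; rewrite pairing_ract pairingM.
rewrite (linear_sw (f := fun v => <<w, v>> : k^o)); last by lin.
rewrite swM; last by bilin.
apply: (@eq_sw _ _ k^o) => a b; rewrite pairingM.
by apply: (@eq_sw _ _ k^o) => c d; rewrite !pairing_ract.
Qed.

Local Notation SA := (antipode A).
Local Notation SU := (antipode U).

Lemma pairing_antipodeE y f : <<y, SA f>> = <<SU y, f>>.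
Proof. by rewrite pairing_antipode. Qed.

(** The antipode exchanges the two actions. *)
Lemma lact_antipode y f : y |> SA f = SA (f <| SU y).
Proof.
apply: pairing_ext => w.
by rewrite pairing_lact !pairing_antipodeE pairing_ract antipodeM.
Qed.

Lemma ract_antipode y f : SA f <| y = SA (SU y |> f).
Proof.
apply: pairing_ext => w.
by rewrite pairing_ract !pairing_antipodeE pairing_lact antipodeM.
Qed.

Section Haar.
Variable h : {scalar A}.
Hypothesis h_left : forall f, sw f (fun a b => h b *: a) = h f *: 1.
Hypothesis h_right : forall f, sw f (fun a b => h a *: b) = h f *: 1.

Lemma haar_lact y f : h (y |> f) = counit U y * h f.
Proof.
rewrite lactE (linear_sw _ _ (lin_scalar h)).
have := congr1 (fun a => <<y, a>>) (h_right f).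
rewrite (linear_sw (f := fun v => <<y, v>> : k^o)); last by lin.
rewrite pairingZ pairing_1r mulrC => <-.
by apply: (@eq_sw _ _ k^o) => a b; rewrite linearZ /= pairingZ [LHS]mulrC.
Qed.

Lemma haar_ract y f : h (f <| y) = counit U y * h f.
Proof.
rewrite ractE (linear_sw _ _ (lin_scalar h)).
have := congr1 (fun a => <<y, a>>) (h_left f).
rewrite (linear_sw (f := fun v => <<y, v>> : k^o)); last by lin.
rewrite pairingZ pairing_1r mulrC => <-.
by apply: (@eq_sw _ _ k^o) => a b; rewrite linearZ /= pairingZ [LHS]mulrC.
Qed.

(** Expand the invariance of h under the element z_(1) acting on
    f (S(z_(2)) |> f'). *)
Lemma haar_lact_adj z f f' : h ((z |> f) * f') = h (f * (SU z |> f')).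
Proof.
rewrite -(sw_counitl z (f := fun v => h (f * (SU v |> f')) : k^o)); last by lin.
transitivity (sw z (fun a b => h (a |> (f * (SU b |> f'))) : k^o)); last first.
  by apply: (@eq_sw _ _ k^o) => a b; rewrite haar_lact.
transitivity (h (sw z (fun a b => a |> (f * (SU b |> f'))))); last first.
  by rewrite (linear_sw _ _ (lin_scalar h)).
congr (h _).
transitivity (sw z (fun a b => sw a (fun c d => (c |> f) * (d |> (SU b |> f')))));
  last by apply: eq_sw => a b; rewrite lact_mul.
rewrite (sw_coassoc z (phi := fun c d b => (c |> f) * (d |> (SU b |> f')))); try by lin.
rewrite -[in LHS](sw_counitr z (f := fun v => (v |> f) * f')); last by lin.
apply: eq_sw => a b; rewrite -[f' in LHS]lact1.
rewrite -(sw_antipoder b (f := fun v => (a |> f) * (v |> f'))); last by lin.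
by apply: eq_sw => c d; rewrite lactM.
Qed.

Lemma haar_ract_adj z f f' : h (f * (f' <| z)) = h ((f <| SU z) * f').
Proof.
rewrite -(sw_counitr z (f := fun v => h ((f <| SU v) * f') : k^o)); last by lin.
transitivity (sw z (fun a b => h (((f <| SU a) * f') <| b) : k^o)); last first.
  by apply: (@eq_sw _ _ k^o) => a b; rewrite haar_ract.
transitivity (h (sw z (fun a b => ((f <| SU a) * f') <| b))); last first.
  by rewrite (linear_sw _ _ (lin_scalar h)).
congr (h _).
transitivity (sw z (fun a b => sw b (fun c d => ((f <| SU a) <| c) * (f' <| d))));
  last by apply: eq_sw => a b; rewrite ract_mul.
rewrite -(sw_coassoc z (phi := fun a c d => ((f <| SU a) <| c) * (f' <| d))); try by lin.
rewrite -[in LHS](sw_counitl z (f := fun v => f * (f' <| v))); last by lin.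
apply: eq_sw => a b; rewrite -[f in LHS]ract1.
rewrite -(sw_antipodel a (f := fun v => (f <| v) * (f' <| b))); last by lin.
by apply: eq_sw => c d; rewrite ractM.
Qed.

End Haar.
End Actions.

(** * The trace attached to two functions *)

Section Modular.
Variables (k : fieldType) (l : nat) (g : semisimple_datum l) (q : k).
Variables (U : Uq g q) (X : {pred 'rV[int]_l}) (A : OGq U X).
Hypothesis q0 : q != 0.
Local Notation "<< y , f >>" := (pairing (o := A) y f) (format "<< y ,  f >>").
Local Notation "y |> f" := (lact (A := A) y f) (at level 40, left associativity).
Local Notation "f <| y" := (ract (A := A) f y) (at level 40, left associativity).
Local Notation SA := (antipode A).
Local Notation SU := (antipode U).
Local Notation sg := (sigma U).
Local Notation sv := (sigma_inv U).

Lemma antipodeK_lact_ract f : SA (SA f) = sv |> (f <| sg).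
Proof.
apply: pairing_ext => w; rewrite !pairing_antipodeE antipodeK_sigma //.
by rewrite pairing_lact pairing_ract mulrA.
Qed.

Lemma lact_sigmaK f : sv |> (sg |> f) = f.
Proof. by rewrite -lactM mulV_sigma lact1. Qed.
Lemma ract_sigmaVK f : f <| sv <| sg = f.
Proof. by rewrite -ractM mulV_sigma ract1. Qed.

Lemma ract_sigmaE f : f <| sg = SA (SA (sg |> f)).
Proof. by rewrite antipodeK_lact_ract -lact_ract lact_sigmaK. Qed.
Lemma lact_sigma_invE f : sv |> f = SA (SA (f <| sv)).
Proof. by rewrite antipodeK_lact_ract ract_sigmaVK. Qed.

(** The square of the antipode is inner, so the antipode is invertible. *)
Lemma antipode_surj z : {z' | SU z' = z}.
Proof.
exists (sv * SU z * sg).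
rewrite !antipodeM antipode_sigma antipode_sigma_inv antipodeK_sigma //.
by rewrite !mulrA mulV_sigma mul1r -mulrA mulV_sigma mulr1.
Qed.

Variable h : {scalar A}.
Hypothesis h_left : forall f, sw f (fun a b => h b *: a) = h f *: 1.
Hypothesis h_right : forall f, sw f (fun a b => h a *: b) = h f *: 1.
Hypothesis h1 : h 1 = 1.

(** The two bilinear forms through which the Haar functional tests
    commutativity: the twisted trace property compares h (a S(b)) with
    h (S(b) a). *)
Definition formR (a b : A) : k^o := h (a * SA b).
Definition formL (a b : A) : k^o := h (SA b * a).

Lemma formR_linl b : linear (formR^~ b). Proof. by rewrite /formR; lin. Qed.
Lemma formR_linr a : linear (formR a). Proof. by rewrite /formR; lin. Qed.
Lemma formL_linl b : linear (formL^~ b). Proof. by rewrite /formL; lin. Qed.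
Lemma formL_linr a : linear (formL a). Proof. by rewrite /formL; lin. Qed.

Lemma formL_adj z a b : formL (z |> a) b = formL a (b <| z).
Proof.
have [z' <-] := antipode_surj z.
by rewrite /formL -lact_antipode haar_lact_adj.
Qed.

Lemma formR_adj z a b : formR (a <| z) b = formR a (z |> b).
Proof.
have [z' <-] := antipode_surj z.
by rewrite /formR -ract_antipode haar_ract_adj.
Qed.

Ltac form_lin := rewrite /formR /formL; lin.
Ltac form_bilin := rewrite /formR /formL; bilin.

(** The adjunction [formL_adj] for all y at once, as an identity in A. *)
Lemma formL_transfer a b :
  sw a (fun a1 a2 => formL a1 b *: a2) = sw b (fun b1 b2 => formL a b2 *: b1).
Proof.
apply: pairing_ext => y.
rewrite !(linear_sw (f := fun v => <<y, v>> : k^o)); try by lin.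
transitivity (formL (y |> a) b).
  rewrite lactE (linear_sw _ _ (formL_linl b)); apply: (@eq_sw _ _ k^o) => c d.
  by rewrite pairingZ (linZ _ _ (formL_linl b)) mulrC.
rewrite formL_adj ractE (linear_sw _ _ (formL_linr a)).
by apply: (@eq_sw _ _ k^o) => c d; rewrite pairingZ (linZ _ _ (formL_linr a)) mulrC.
Qed.

Lemma formR_transfer a b :
  sw a (fun a1 a2 => formR a2 b *: a1) = sw b (fun b1 b2 => formR a b1 *: b2).
Proof.
apply: pairing_ext => y.
rewrite !(linear_sw (f := fun v => <<y, v>> : k^o)); try by lin.
transitivity (formR (a <| y) b).
  rewrite ractE (linear_sw _ _ (formR_linl b)); apply: (@eq_sw _ _ k^o) => c d.
  by rewrite pairingZ (linZ _ _ (formR_linl b)) mulrC.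
rewrite formR_adj lactE (linear_sw _ _ (formR_linr a)).
by apply: (@eq_sw _ _ k^o) => c d; rewrite pairingZ (linZ _ _ (formR_linr a)) mulrC.
Qed.

(** In terms of matrix coefficients of corepresentations u and v, the forms
    [formR] and [formL] define averages over the Haar functional that map
    matrices to intertwiners between u and v, and this functional is
    y |-> trace (v(y) d) for the composite d of two such intertwiners. *)
Definition haar_char (a b : A) (y : U) : k^o :=
  sw a (fun a1 a2 => sw b (fun b1 b2 => formR a2 b1 *: formL a1 (b2 <| y))).

Lemma haar_char_linear a b : linear (haar_char a b).
Proof. by rewrite /haar_char; form_lin. Qed.

(** A factor z is moved once around the circle formed by the coproducts of a
    and b and by the two invariant forms: each of the two forms and of the two
    coproducts lets z pass, by [formL_adj], [formR_adj] and [sw_balance]. *)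
Lemma haar_char_tracial a b y z : haar_char a b (y * z) = haar_char a b (z * y).
Proof.
pose phi a1 a2 := sw b (fun b1 b2 => formR a2 b1 *: formL a1 (b2 <| y)).
transitivity (sw a (fun a1 a2 => phi (z |> a1) a2)).
  apply: (@eq_sw _ _ k^o) => a1 a2; apply: (@eq_sw _ _ k^o) => b1 b2.
  by rewrite ractM formL_adj.
rewrite sw_balance; last by rewrite /phi; form_bilin.
apply: (@eq_sw _ _ k^o) => a1 a2; rewrite /phi.
transitivity (sw b (fun b1 b2 => formR a2 (z |> b1) *: formL a1 (b2 <| y))).
  by apply: (@eq_sw _ _ k^o) => b1 b2; rewrite formR_adj.
rewrite (sw_balance z b (phi := fun b1 b2 => formR a2 b1 *: formL a1 (b2 <| y)));
  last by form_bilin.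
by apply: (@eq_sw _ _ k^o) => b1 b2; rewrite ractM.
Qed.

Lemma counit_lact y f : counit A (y |> f) = <<y, f>>.
Proof. by rewrite -(pairing_1l (o := A)) pairing_lact mul1r. Qed.
Lemma counit_ract y f : counit A (f <| y) = <<y, f>>.
Proof. by rewrite -(pairing_1l (o := A)) pairing_ract mulr1. Qed.

(** Contract a against b by [formL_transfer]. There remains, in the variable
    b_(1) = x, the sum of h ((x_(2) <| sigma) S(x_(1))). Because of
    x <| sigma = S^2 (sigma |> x), this is h of S applied to e_(1) S(e_(2)) for
    e = sigma |> x, that is <sigma, x>. *)
Lemma haar_char_sigma a b : haar_char a b sg = formL a (b <| sg).
Proof.
have contract x : sw x (fun e1 e2 => formR (e2 <| sg) e1) = <<sg, x>>.
  transitivity (sw x (fun e1 e2 => formR (SA (SA (sg |> e2))) e1)).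
    by apply: (@eq_sw _ _ k^o) => e1 e2; rewrite ract_sigmaE.
  rewrite -(sw_lact sg x (phi := fun e1 e2 => formR (SA (SA e2)) e1)); last by form_bilin.
  rewrite -counit_lact -[RHS]mulr1 -h1 -antipode1.
  rewrite -[RHS](sw_antipoder (sg |> x) (f := fun v => h (SA v) : k^o)); last by lin.
  by apply: (@eq_sw _ _ k^o) => e1 e2; rewrite antipodeM.
rewrite /haar_char sw_exchange.
transitivity (sw b (fun b1 b2 => sw b2 (fun e1 e2 => formL a e2 *: formR (e1 <| sg) b1))).
  apply: (@eq_sw _ _ k^o) => b1 b2.
  rewrite -(sw_ract sg b2 (phi := fun e1 e2 => formL a e2 *: formR e1 b1)); last by form_bilin.
  have e := congr1 (formR^~ b1) (formL_transfer a (b2 <| sg)).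
  rewrite !(linear_sw _ _ (formR_linl b1)) in e.
  transitivity (sw a (fun c d => formR (formL c (b2 <| sg) *: d) b1)).
    by apply: (@eq_sw _ _ k^o) => c d; rewrite (linZ _ _ (formR_linl b1)) [LHS]mulrC.
  rewrite e.
  by apply: (@eq_sw _ _ k^o) => c d; rewrite (linZ _ _ (formR_linl b1)).
rewrite -(sw_coassoc b (phi := fun e1 e2 b2 => formL a b2 *: formR (e2 <| sg) e1));
  try by form_lin.
rewrite ractE (linear_sw _ _ (formL_linr a)).
apply: (@eq_sw _ _ k^o) => b1 b2.
rewrite -(linear_sw (f := fun v : k^o => formL a b2 *: v)); last by lin.
by rewrite contract (linZ _ _ (formL_linr a)) [LHS]mulrC.
Qed.

(** Mirror image of [haar_char_sigma]: contract a by [formR_transfer] and use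
    sigma^-1 |> x = S^2 (x <| sigma^-1). *)
Lemma haar_char_sigma_inv a b : haar_char a b sv = formR a (sv |> b).
Proof.
have contract x : sw x (fun e1 e2 => formL e1 (e2 <| sv)) = <<sv, x>>.
  transitivity (sw x (fun e1 e2 => formL (SA (SA (e1 <| sv))) e2)).
    by apply: (@eq_sw _ _ k^o) => e1 e2; rewrite -formL_adj lact_sigma_invE.
  rewrite -(sw_ract sv x (phi := fun e1 e2 => formL (SA (SA e1)) e2)); last by form_bilin.
  rewrite -counit_ract -[RHS]mulr1 -h1 -antipode1.
  rewrite -[RHS](sw_antipodel (x <| sv) (f := fun v => h (SA v) : k^o)); last by lin.
  by apply: (@eq_sw _ _ k^o) => e1 e2; rewrite antipodeM.
rewrite /haar_char sw_exchange.
transitivity (sw b (fun b1 b2 => sw b1 (fun c1 c2 => formR a c1 *: formL c2 (b2 <| sv)))).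
  apply: (@eq_sw _ _ k^o) => b1 b2.
  have e := congr1 (formL^~ (b2 <| sv)) (formR_transfer a b1).
  rewrite !(linear_sw _ _ (formL_linl _)) in e.
  transitivity (sw a (fun c d => formL (formR d b1 *: c) (b2 <| sv))).
    by apply: (@eq_sw _ _ k^o) => c d; rewrite (linZ _ _ (formL_linl _)).
  rewrite e.
  by apply: (@eq_sw _ _ k^o) => c d; rewrite (linZ _ _ (formL_linl _)).
rewrite (sw_coassoc b (phi := fun c1 c2 b2 => formR a c1 *: formL c2 (b2 <| sv)));
  try by form_lin.
rewrite lactE (linear_sw _ _ (formR_linr a)).
apply: (@eq_sw _ _ k^o) => b1 b2.
rewrite -(linear_sw (f := fun v : k^o => formR a b1 *: v)); last by lin.
by rewrite contract (linZ _ _ (formR_linr a)) [LHS]mulrC.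
Qed.

(** Equality of the two values is h (S(b <| sigma) a) = h (a S(sigma^-1 |> b));
    substitute for b the element S(f) for which the two arguments become
    c <| sigma^-1 and sigma |> c. *)
Lemma haar_modular :
    (forall a b, haar_char a b sg = haar_char a b sv) ->
  forall a c, h (a * (sg |> c)) = h ((c <| sv) * a).
Proof.
move=> T a c; pose f := sg |> (sg |> (c <| sv <| sv)).
have := T a (SA f); rewrite haar_char_sigma haar_char_sigma_inv /formR /formL.
rewrite ract_antipode lact_antipode antipode_sigma antipode_sigma_inv.
rewrite !antipodeK_lact_ract /f lact_sigmaK -!lact_ract !ract_sigmaVK.
by rewrite !lact_sigmaK.
Qed.

End Modular.

(** * Positive matrices over an algebraically closed number field *)

Section Positivity.
Variable C : numClosedFieldType.

Definition adj m n (M : 'M[C]_(m, n)) : 'M[C]_(n, m) := (map_mx Num.conj M)^T.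

Lemma adjM m n p (M : 'M[C]_(m, n)) (N : 'M[C]_(n, p)) :
  adj (M *m N) = adj N *m adj M.
Proof. by rewrite /adj map_mxM trmx_mul. Qed.

Lemma adj_involutive m n (M : 'M[C]_(m, n)) : adj (adj M) = M.
Proof. by apply/matrixP => i j; rewrite !mxE conjCK. Qed.

Lemma adjD m n (M N : 'M[C]_(m, n)) : adj (M + N) = adj M + adj N.
Proof. by apply/matrixP => i j; rewrite !mxE rmorphD. Qed.

Lemma adj0 m n : adj (0 : 'M[C]_(m, n)) = 0.
Proof. by apply/matrixP => i j; rewrite !mxE rmorph0. Qed.

(** Positive semidefinite matrices, given as sums of rank one squares. This
    form is closed under the operations needed below, and it avoids spectral
    theory. *)
Definition psd n (H : 'M[C]_n) :=
  exists ts : seq 'rV[C]_n, H = \sum_(t <- ts) adj t *m t.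

Lemma psd0 n : psd (0 : 'M[C]_n).
Proof. by exists [::]; rewrite big_nil. Qed.

Lemma psdD n (H H' : 'M[C]_n) : psd H -> psd H' -> psd (H + H').
Proof. by move=> [s ->] [s' ->]; exists (s ++ s'); rewrite big_cat. Qed.

Lemma psd_sum n (I : Type) (r : seq I) (F : I -> 'M[C]_n) :
  (forall i, psd (F i)) -> psd (\sum_(i <- r) F i).
Proof. by move=> h; apply: big_ind => //; [exact: psd0 | exact: psdD]. Qed.

Lemma psd_congr n (H Y : 'M[C]_n) : psd H -> psd (adj Y *m H *m Y).
Proof.
move=> [ts ->]; exists [seq t *m Y | t <- ts]; rewrite big_map.
rewrite mulmx_sumr mulmx_suml; apply: eq_bigr => t _.
by rewrite adjM !mulmxA.
Qed.

Lemma psd1 n : psd (1%:M : 'M[C]_n).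
Proof.
exists [seq row i 1%:M | i <- enum 'I_n]; rewrite big_map big_enum /=.
apply/matrixP => a b; rewrite summxE (bigD1 a) //= big1 => [|i ia].
  by rewrite !mxE big_ord1 !mxE eqxx rmorph1 mul1r addr0.
by rewrite !mxE big_ord1 !mxE (negPf ia) rmorph0 mul0r.
Qed.

Lemma psd_adj n (H : 'M[C]_n) : psd H -> adj H = H.
Proof.
move=> [ts ->]; rewrite (big_morph _ (@adjD _ _) (@adj0 _ _)).
by apply: eq_bigr => t _; rewrite adjM adj_involutive.
Qed.

Lemma tr_adj_ge0 m n (M : 'M[C]_(m, n)) : 0 <= \tr (adj M *m M).
Proof.
apply: sumr_ge0 => i _; rewrite !mxE; apply: sumr_ge0 => j _.
by rewrite !mxE mulrC mul_conjC_ge0.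
Qed.

Lemma tr_adj_eq0 m n (M : 'M[C]_(m, n)) : \tr (adj M *m M) = 0 -> M = 0.
Proof.
move=> /psumr_eq0P h; apply/matrixP => j i; rewrite mxE.
have {}h : (adj M *m M) i i = 0.
  apply: h => // r _; rewrite !mxE; apply: sumr_ge0 => s _.
  by rewrite !mxE mulrC mul_conjC_ge0.
rewrite mxE in h; apply/eqP; rewrite -mul_conjC_eq0 mulrC.
move/psumr_eq0P: h => h; have := h _ j isT; rewrite !mxE => -> // r _.
by rewrite !mxE mulrC mul_conjC_ge0.
Qed.

(** Expanding both matrices as sums of squares, the trace is a sum of squared
    moduli of the numbers t x s^*. *)
Lemma psd_form_ge0 n (H K x : 'M[C]_n) : psd H -> psd K ->
  0 <= \tr (adj x *m H *m x *m K).
Proof.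
move=> [ts ->] [ss ->].
rewrite mulmx_sumr raddf_sum; apply: sumr_ge0 => s _ /=.
rewrite mulmx_sumr !mulmx_suml raddf_sum; apply: sumr_ge0 => t _ /=.
rewrite !mulmxA mxtrace_mulC !mulmxA.
have := tr_adj_ge0 (t *m x *m adj s).
by rewrite !adjM adj_involutive !mulmxA.
Qed.

(** G^(k+2) = G^* G^k G, so it is enough to treat the exponents 0 and 1. *)
Lemma psd_exp n (G : 'M[C]_n) k : psd G -> psd (G ^+ k).
Proof.
move=> pG; suff: psd (G ^+ k) /\ psd (G ^+ k.+1) by case.
elim: k => [|k [IH IH1]]; split=> //; first by rewrite expr0; apply: psd1.
have -> : G ^+ k.+2 = adj G *m G ^+ k *m G.
  by rewrite (psd_adj pG) exprS exprSr mulrA.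
exact: psd_congr.
Qed.

Lemma psd_inv n (G : 'M[C]_n) : psd G -> G \in unitmx -> psd (invmx G).
Proof.
move=> pG uG; have -> : invmx G = adj (invmx G) *m G *m invmx G.
  by rewrite -mulmxA mulmxV // mulmx1 -{1}(psd_adj pG) /adj map_invmx trmx_inv.
exact: psd_congr.
Qed.

(** A positive matrix commutes with whatever commutes with one of its powers.
    Put x = G b G^-1 - b. The sum of G^k x G^-k over k <= N telescopes to zero;
    pairing it with x gives a vanishing sum of nonnegative terms, the term
    k = 0 of which is the squared norm of x. *)
Lemma psd_root_comm n (G b : 'M[C]_n) N : psd G -> G \in unitmx ->
  G ^+ N.+1 *m b = b *m G ^+ N.+1 -> G *m b = b *m G.
Proof.
move=> pG uG e; set Gi := invmx G.
pose c k := G ^+ k *m b *m Gi ^+ k; pose x := c 1%N - b.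
have GGi k : G ^+ k *m Gi ^+ k = 1%:M.
  elim: k => [|k IH]; first by rewrite mulmx1.
  by rewrite exprSr exprS -!mulmxA [G *m _]mulmxA mulmxV // mul1mx.
have sum0 : \sum_(k < N.+1) G ^+ k *m x *m Gi ^+ k = 0.
  transitivity (\sum_(k < N.+1) (c k.+1 - c k)).
    apply: eq_bigr => k _; rewrite /x /c mulmxBr mulmxBl; congr (_ - _).
    by rewrite !expr1 [in RHS]exprSr [in RHS]exprS !mulmxA.
  rewrite -(big_mkord xpredT (fun k => c k.+1 - c k)) telescope_sumr //.
  by rewrite /c e -mulmxA GGi mulmx1 !expr0 mul1mx mulmx1 subrr.
suff x0 : x = 0.
  move/eqP: x0; rewrite /x subr_eq0 /c !expr1 => /eqP e2.
  by rewrite -[in RHS]e2 -[RHS]mulmxA mulVmx // mulmx1.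
apply: tr_adj_eq0; have /psumr_eq0P : \sum_(k < N.+1)
    \tr (adj x *m G ^+ k *m x *m Gi ^+ k) = 0.
  transitivity (\tr (adj x *m \sum_(k < N.+1) G ^+ k *m x *m Gi ^+ k)).
    by rewrite mulmx_sumr raddf_sum; apply: eq_bigr => k _; rewrite !mulmxA.
  by rewrite sum0 mulmx0 mxtrace0.
move=> /(_ _ ord0 isT); rewrite !expr0 !mulmx1; apply=> k _.
apply: psd_form_ge0; first exact: psd_exp.
by apply/psd_exp/psd_inv.
Qed.

Lemma psd_definite_unit n (G : 'M[C]_n) : psd G ->
  (forall w : 'cV[C]_n, adj w *m G *m w = 0 -> w = 0) -> G \in unitmx.
Proof.
move=> pG dG; rewrite -row_free_unit -kermx_eq0; apply/rowV0P => v /sub_kermxP e.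
by rewrite -[v]adj_involutive [adj v]dG ?adj0 // adj_involutive e mul0mx.
Qed.

End Positivity.

(** * Unitary corepresentations *)

Section Coreps.
Variables (C : numClosedFieldType) (A : hopf_alg C) (star : A -> A).
Hypothesis starA : hopf_star star.
Local Notation SA := (antipode A).

Lemma star_sum (I : Type) (r : seq I) (c : I -> C) (x : I -> A) :
  star (\sum_(i <- r) c i *: x i) = \sum_(i <- r) (c i)^* *: star (x i).
Proof.
have star0 : star 0 = 0.
  have := star_semilinear starA (-1) 0 0.
  by rewrite scaler0 addr0 rmorphN1 scaleN1r addNr.
elim: r => [|i r IH]; first by rewrite !big_nil.
by rewrite !big_cons (star_semilinear starA) IH.
Qed.

Lemma sw_corep n (u : 'I_n -> 'I_n -> A) i j (W : lmodType C) (phi : A -> A -> W) :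
    comul A (u i j) = \sum_(r < n) pure [tuple u i r; u r j] ->
    bilinear2 phi ->
  sw (u i j) phi = \sum_(r < n) phi (u i r) (u r j).
Proof.
move=> cu bphi; have m := bilinear2_multilinear bphi.
rewrite /sw cu; transitivity (\sum_(r < n) teval
   (fun p : 2.-tuple A => phi p`_0 p`_1) (pure [tuple u i r; u r j])).
  apply: (big_morph _ (fun x y => linD x y (teval_linear m))).
  exact: linear_at0 (teval_linear m).
by apply: eq_bigr => r _; rewrite teval_pure.
Qed.

Variables (n : nat) (u : 'M[A]_n).
Hypothesis cu : unitary_corep star u.

(** The matrices of S(u_ij) and of the adjoint of u are both inverse to u. *)
Lemma corep_antipode i j : SA (u i j) = star (u j i).
Proof.
have e1 r : \sum_a SA (u i a) * u a r = (i == r)%:R.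
  transitivity (sw (u i r) (fun a b => SA a * b)).
    rewrite sw_corep //; first exact: (corep_comul cu).
    by split=> a; [exact: lin_mull (lin_fun _) | exact: lin_mulr (@lin_id _ _)].
  rewrite (sw_antipodel _ (f := id)) // (corep_counit cu) scaler_nat.
  by case: eqP.
transitivity (\sum_a SA (u i a) * (a == j)%:R).
  rewrite (bigD1 j) //= eqxx mulr1 big1 ?addr0 // => a /negPf ->.
  by rewrite mulr0.
under eq_bigr => a _ do rewrite -(corep_unitaryr cu) mulr_sumr.
rewrite exchange_big /=.
transitivity (\sum_r (i == r)%:R * star (u j r)).
  by apply: eq_bigr => r _; rewrite -e1 mulr_suml; apply: eq_bigr => a _; rewrite mulrA.
rewrite (bigD1 i) //= eqxx mul1r big1 ?addr0 // => a /negPf; rewrite eq_sym => ->.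
by rewrite mul0r.
Qed.

(** The entrywise conjugate of u: again a corepresentation, in general not a
    unitary one. *)
Definition conj_corep i j : A := star (u i j).

Lemma conj_corep_comul i j :
  comul A (conj_corep i j) = \sum_(r < n) pure [tuple conj_corep i r; conj_corep r j].
Proof.
rewrite /conj_corep (star_comul starA (s := [seq (u i r, u r j) | r <- enum 'I_n])).
  by rewrite big_map big_enum.
by rewrite big_map big_enum /= (corep_comul cu).
Qed.

Lemma conj_corep_antipode i j : SA (conj_corep i j) = SA (SA (u j i)).
Proof. by rewrite /conj_corep -corep_antipode. Qed.

Lemma conj_corep_inv i j : \sum_r conj_corep i r * SA (conj_corep r j) = (i == j)%:R.
Proof.
transitivity (sw (conj_corep i j) (fun a b => a * SA b)).
  rewrite (sw_corep (conj_corep_comul i j)) //.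
  by split=> a; [exact: lin_mull (@lin_id _ _) | exact: lin_mulr (lin_fun _)].
rewrite (sw_antipoder _ (f := id)) // /conj_corep (star_counit starA) (corep_counit cu).
by rewrite conjC_nat scaler_nat; case: eqP.
Qed.

End Coreps.

(** * The case of a root of unity *)

Section Torsion.
Variables (C : numClosedFieldType) (l : nat) (g : semisimple_datum l) (q : C).
Variables (U : Uq g q) (X : {pred 'rV[int]_l}) (A : OGq U X).
Hypotheses (q0 : q != 0) (q2 : forall i, qi g q i ^+ 2 != 1).
Variable star : A -> A.
Hypothesis cqgA : CQG star.
Variable h : {scalar A}.
Hypothesis h_left : forall f, sw f (fun a b => h b *: a) = h f *: 1.
Hypothesis h_right : forall f, sw f (fun a b => h a *: b) = h f *: 1.
Hypothesis h1 : h 1 = 1.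
Local Notation "<< y , f >>" := (pairing (o := A) y f) (format "<< y ,  f >>").
Local Notation SA := (antipode A).
Local Notation SU := (antipode U).

Let starA : hopf_star star := proj1 cqgA.

Section OneCorep.
Variables (n : nat) (u : 'M[A]_n).
Hypothesis cu : unitary_corep star u.
Local Notation ubar := (conj_corep star u).

(** P is a positive sesquilinear form that is invariant under the conjugate
    corepresentation of u. *)
Definition invariant_form (P : 'M[C]_n) : Prop := psd P /\
  forall a b, \sum_i \sum_j P j i *: (u i a * ubar j b) = P b a *: 1.

Lemma invariant_form0 : invariant_form 0.
Proof.
split=> [|a b]; first exact: psd0.
by rewrite mxE scale0r big1 // => i _; rewrite big1 // => j _; rewrite mxE scale0r.
Qed.

Lemma invariant_formD P P' :
  invariant_form P -> invariant_form P' -> invariant_form (P + P').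
Proof.
move=> [pP iP] [pP' iP']; split=> [|a b]; first exact: psdD.
rewrite mxE scalerDl -iP -iP' -big_split; apply: eq_bigr => i _ /=.
by rewrite -big_split; apply: eq_bigr => j _ /=; rewrite mxE scalerDl.
Qed.

Definition hermitian_form (P : 'M[C]_n) (w : 'cV[C]_n) : C := (adj w *m P *m w) 0 0.

Lemma hermitian_form_ge0 P w : psd P -> 0 <= hermitian_form P w.
Proof.
move=> [ts ->]; rewrite /hermitian_form mulmx_sumr mulmx_suml summxE.
apply: sumr_ge0 => t _; have := tr_adj_ge0 (t *m w).
by rewrite adjM !mulmxA [\tr _]big_ord1.
Qed.

Lemma hermitian_formD_eq0 P P' w : psd P -> psd P' -> hermitian_form (P + P') w = 0 ->
  hermitian_form P w = 0 /\ hermitian_form P' w = 0.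
Proof.
move=> pP pP'; rewrite /hermitian_form mulmxDr mulmxDl mxE => /eqP.
by rewrite paddr_eq0 ?hermitian_form_ge0 // => /andP[/eqP-> /eqP->].
Qed.

(** Some invariant form has its kernel inside the zero set of the
    (conjugate-linear) form with coefficients h (a S(ubar_kr)). *)
Definition kernel_bound (a : A) (k : 'I_n) : Prop := exists2 P, invariant_form P &
  forall w, hermitian_form P w = 0 -> \sum_r formR h a (ubar k r) * (w r 0)^* = 0.

(** For a coefficient v_ij of a unitary corepresentation, the numbers
    T_cr = h (v_cj S(ubar_kr)) form an intertwiner T from ubar to v. As v is
    unitary, pulling back the standard inner product along T gives an
    invariant form, with the kernel of T as kernel, up to conjugation. *)
Lemma kernel_bound_coef m (v : 'M[A]_m) (i j : 'I_m) k :
  unitary_corep star v -> kernel_bound (v i j) k.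
Proof.
move=> cv; pose T i r := formR h (v i j) (ubar k r).
have inter a b : \sum_r T r a *: v b r = \sum_r T b r *: ubar r a.
  have := formR_transfer q0 h_left (v b j) (ubar k a).
  rewrite (sw_corep (corep_comul cv b j)); last first.
    by split=> c; [exact: lin_scaler (@lin_id _ _) | apply: lin_scalel; exact: formR_linl].
  rewrite (sw_corep (conj_corep_comul starA cu k a)) //.
  by split=> c; [apply: lin_scalel; exact: formR_linr | exact: lin_scaler (@lin_id _ _)].
pose t i : 'rV[C]_n := \row_r (T i r)^*.
exists (\sum_i adj (t i) *m t i).
  split=> [|a b]; first by apply: psd_sum => r; exists [:: t r]; rewrite big_seq1.
  have tE c d : (\sum_i adj (t i) *m t i) c d = \sum_i T i c * (T i d)^*.
    by rewrite summxE; apply: eq_bigr => r _; rewrite mxE big_ord1 !mxE conjCK.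
  transitivity (\sum_r (star (\sum_s T r s *: ubar s a) * \sum_s T r s *: ubar s b)).
    transitivity (\sum_c \sum_i0 \sum_j0 ((T c i0)^* * T c j0) *: (u i0 a * ubar j0 b)).
      rewrite [RHS]exchange_big; apply: eq_bigr => i0 _ /=.
      rewrite [RHS]exchange_big; apply: eq_bigr => j0 _ /=.
      by rewrite tE scaler_suml; apply: eq_bigr => c _; rewrite mulrC.
    apply: eq_bigr => c _; rewrite (star_sum starA) mulr_suml.
    apply: eq_bigr => i0 _; rewrite mulr_sumr; apply: eq_bigr => j0 _.
    by rewrite -scalerAl -scalerAr scalerA /conj_corep (starK starA).
  transitivity (\sum_s \sum_s' ((T s a)^* * T s' b) *:
      \sum_r (star (v r s) * v r s')).
    under eq_bigr => r _ do rewrite -!inter (star_sum starA) mulr_suml.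
    rewrite exchange_big; apply: eq_bigr => s _ /=.
    under eq_bigr => r _ do rewrite mulr_sumr.
    rewrite exchange_big; apply: eq_bigr => s' _ /=.
    rewrite scaler_sumr; apply: eq_bigr => r _.
    by rewrite -scalerAl -scalerAr scalerA.
  rewrite tE scaler_suml; apply: eq_bigr => s _.
  under eq_bigr => s' _ do rewrite (corep_unitaryl cv).
  rewrite (bigD1 s) //= big1 => [|s' /negPf ss'].
    by rewrite eqxx addr0 mulrC.
  by rewrite eq_sym ss' scaler0.
move=> w; rewrite /hermitian_form mulmx_sumr mulmx_suml summxE => /psumr_eq0P w0.
have e c : (adj w *m (adj (t c) *m t c) *m w) 0 0 = \tr (adj (t c *m w) *m (t c *m w)).
  by rewrite adjM !mulmxA [\tr _]big_ord1.
have /tr_adj_eq0 /matrixP /(_ 0 0) : \tr (adj (t i *m w) *m (t i *m w)) = 0.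
  by rewrite -e w0 // => c _; rewrite e tr_adj_ge0.
rewrite !mxE => /(congr1 Num.conj); rewrite rmorph0 rmorph_sum => e0; rewrite -[RHS]e0.
by apply: eq_bigr => r _; rewrite mxE rmorphM /= conjCK.
Qed.

(** The matrix elements of unitary corepresentations span, and the kernel of
    a sum of positive forms is the intersection of the kernels. *)
Lemma kernel_boundP a k : kernel_bound a k.
Proof.
have [s hs ->] := proj2 cqgA a.
elim: s hs => [|p s IH] hs.
  exists 0 => [|w _]; first exact: invariant_form0.
  rewrite big_nil big1 // => r _.
  by rewrite (linear_at0 (formR_linl h _)) mul0r.
have [|P iP dP] := IH; first by move=> p' p's; apply: hs; rewrite inE p's orbT.
have [n' [v [i [j [cv ev]]]]] := hs p (mem_head _ _).
have [P' iP' dP'] := kernel_bound_coef i j k cv.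
exists (P' + P) => [|w]; first exact: invariant_formD.
move=> /(hermitian_formD_eq0 iP'.1 iP.1) [/dP' d' /dP d].
rewrite big_cons ev.
transitivity (p.1 * (\sum_r formR h (v i j) (ubar k r) * (w r 0)^*) +
    \sum_r formR h (\sum_(j <- s) j.1 *: j.2) (ubar k r) * (w r 0)^*).
  rewrite mulr_sumr -big_split; apply: eq_bigr => r _ /=.
  by rewrite (formR_linl h _) mulrDl mulrA.
by rewrite d' d mulr0 addr0.
Qed.

(** Apply [kernel_boundP] to a = ubar_mk for all m and k and add up. If w is in
    the kernel of the sum P, then summing over k the relations for a = ubar_mk
    gives w_m = 0, as ubar times its antipode is 1 and h 1 = 1. *)
Lemma invertible_invariant_form : exists2 P, invariant_form P & P \in unitmx.
Proof.
have [P iP dP] : exists2 P, invariant_form P & forall w, hermitian_form P w = 0 ->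
    forall p, p \in enum {: 'I_n * 'I_n} ->
      \sum_r formR h (ubar p.1 p.2) (ubar p.2 r) * (w r 0)^* = 0.
  elim: (enum _) => [|p s [P iP dP]].
    by exists 0 => //; exact: invariant_form0.
  have [P' iP' dP'] := kernel_boundP (ubar p.1 p.2) p.2.
  exists (P' + P) => [|w]; first exact: invariant_formD.
  move=> /(hermitian_formD_eq0 iP'.1 iP.1) [/dP' d' /dP d] p'.
  by rewrite inE => /orP[/eqP->|/d].
exists P => //; apply: psd_definite_unit iP.1 _ => w w0.
have {}w0 : hermitian_form P w = 0 by rewrite /hermitian_form w0 mxE.
apply/matrixP => m j; rewrite ord1 mxE {j}; apply/eqP; rewrite -conjC_eq0.
suff: \sum_c \sum_r formR h (ubar m c) (ubar c r) * (w r 0)^* = (w m 0)^*.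
  by rewrite big1 => [->|c _] //; apply: (dP w w0 (m, c)); rewrite mem_enum.
rewrite exchange_big /=.
transitivity (\sum_r (m == r)%:R * (w r 0)^*).
  apply: eq_bigr => r _; rewrite -mulr_suml; congr (_ * _).
  rewrite /formR -linear_sum /= (conj_corep_inv starA cu).
  by case: eqP => _; rewrite ?h1 ?linear0.
rewrite (bigD1 m) //= eqxx mul1r big1 ?addr0 // => r /negPf.
by rewrite eq_sym => ->; rewrite mul0r.
Qed.

Definition corep_rep (y : U) : 'M[C]_n := \matrix_(i, j) <<y, u i j>>.

(** Multiply the invariance relation by the inverse of the conjugate
    corepresentation, whose entries are S^2 (u_ji). *)
Lemma invariant_form_intertwines P y : invariant_form P ->
  P *m corep_rep y = corep_rep (SU (SU y)) *m P.
Proof.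
move=> [_ iP]; apply/matrixP => c a.
have e : \sum_i P c i *: u i a = \sum_b P b a *: SA (SA (u c b)).
  transitivity (\sum_b (P b a *: 1) * SA (ubar b c)); last first.
    by apply: eq_bigr => b _; rewrite (conj_corep_antipode cu) -scalerAl mul1r.
  under [RHS]eq_bigr => b _ do rewrite -iP mulr_suml.
  rewrite exchange_big; apply: eq_bigr => i _ /=.
  under [RHS]eq_bigr => b _ do rewrite mulr_suml.
  rewrite exchange_big /=.
  transitivity (\sum_j P j i *: (u i a * (j == c)%:R)).
    rewrite (bigD1 c) //= eqxx mulr1 big1 ?addr0 // => j /negPf ->.
    by rewrite mulr0 scaler0.
  apply: eq_bigr => j _; rewrite -(conj_corep_inv starA cu) mulr_sumr scaler_sumr.
  by apply: eq_bigr => b _; rewrite -scalerAl mulrA.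
have ly : linear (fun f => <<y, f>> : C^o) := lin_pairr y (@lin_id _ _).
have := congr1 (fun f => <<y, f>>) e; rewrite !mxE.
rewrite !(linear_sum_scale _ _ _ ly) => e'.
transitivity (\sum_i P c i * <<y, u i a>>).
  by apply: eq_bigr => i _; rewrite mxE.
rewrite e'; apply: eq_bigr => b _.
by rewrite mxE !pairing_antipodeE mulrC.
Qed.

End OneCorep.

(** Equality of two elements of U as functionals on A: U need not be separated
    by A. *)
Definition same_pairing (y z : U) : Prop := forall f, <<y, f>> = <<z, f>>.

Lemma same_pairingM y y' z z' :
  same_pairing y y' -> same_pairing z z' -> same_pairing (y * z) (y' * z').
Proof.
by move=> e e' f; rewrite -pairing_lact e pairing_lact -pairing_ract e' pairing_ract.
Qed.

Lemma same_pairingX y y' n : same_pairing y y' -> same_pairing (y ^+ n) (y' ^+ n).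
Proof.
by move=> e; elim: n => [|n IH]; rewrite ?expr0 // !exprS; apply: same_pairingM.
Qed.

Variable N : nat.
Hypothesis qN : q ^+ N.+1 = 1.

Lemma K_torsion i : same_pairing (Uq_K U i ^+ N.+1) 1.
Proof.
move=> f; have [_ /(_ f)] : True /\ forall f, matrix_coeff X (fun y => <<y, f>>).
  by split=> // f'; apply/pairing_image; exists f'.
move=> [n [pi [u [v [[mu _ piK] e]]]]].
rewrite !e; congr ((_ *m _ *m _) 0 0); rewrite rmorphXn rmorph1 /= piK.
have dX (d : 'rV[C]_n.+1) m : diag_mx d ^+ m = diag_mx (\row_j d 0 j ^+ m).
  elim: m => [|m IH]; first by apply/matrixP => a b; rewrite !mxE.
  rewrite exprS IH -mulmxE mulmx_diag; congr diag_mx.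
  by apply/rowP => j; rewrite !mxE exprS.
rewrite dX; apply/matrixP => a b; rewrite !mxE.
congr (_ *+ _).
have x1 : qi g q i ^+ N.+1 = 1 by rewrite /qi -exprM mulnC exprM qN expr1n.
by rewrite exprnP exprz_exp mulrC -exprz_exp -exprnP x1 exp1rz.
Qed.

Lemma Ki_torsion i : same_pairing (Uq_Ki U i ^+ N.+1) 1.
Proof.
have e : Uq_K U i ^+ N.+1 * Uq_Ki U i ^+ N.+1 = 1.
  by rewrite -exprMn_comm ?mulKKi ?expr1n //; apply: comm_Ki.
move=> f; rewrite -[in RHS]e -[X in <<X, _>> = _]mul1r; apply: same_pairingM => // f'.
by rewrite K_torsion.
Qed.

(** In a weight representation K_i is diagonal with powers of q as
    eigenvalues. *)
Lemma Kroot_torsion (lam : 'rV[int]_l) : same_pairing (Kroot U lam ^+ N.+1) 1.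
Proof.
have KX n : Kroot U lam ^+ n = Kroot U (lam *+ n).
  elim: n => [|n IH]; first by rewrite mulr0n Kroot0.
  by rewrite exprS mulrS KrootD IH.
rewrite KX /Kroot; apply: (big_ind (same_pairing^~ 1)) => // [y z ey ez|i _].
  by rewrite -[X in same_pairing _ X](mulr1 1); apply: same_pairingM.
rewrite mulmxnE; have -> : lam 0 i *+ N.+1 = N.+1%:Z * lam 0 i.
  by rewrite -mulr_natl natz.
case: (lam 0 i) => m.
  rewrite -PoszM /= exprM -[X in same_pairing _ X](expr1n _ m).
  exact/same_pairingX/K_torsion.
have -> : N.+1%:Z * Negz m = Negz (N * m.+1 + m) by lia.
rewrite [Kexp U i _]/(Uq_Ki U i ^+ (N * m.+1 + m).+1).
have -> : ((N * m.+1 + m).+1 = N.+1 * m.+1)%N by lia.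
change (same_pairing (Uq_Ki U i ^+ (N.+1 * m.+1)) 1); rewrite exprM.
rewrite -[X in same_pairing _ X](expr1n _ m.+1).
exact/same_pairingX/Ki_torsion.
Qed.

(** P intertwines u with S^2 applied to u, and S^2 is conjugation by sigma, of
    finite order on A; so a power of P commutes with the representation on u.
    By positivity P commutes with it, which makes S^2 trivial on u. *)
Lemma antipode_sq_trivial y : same_pairing (SU (SU y)) y.
Proof.
move=> f; have [s hs ->] := proj2 cqgA f.
have ly z : linear (fun f => <<z, f>> : C^o) := lin_pairr z (@lin_id _ _).
rewrite !(linear_sum_scale _ _ _ (ly _)) big_seq [RHS]big_seq.
apply: eq_bigr => p /hs [n [u [i [j [cu ->]]]]]; apply: (congr1 ( *%R p.1)).
have [P iP uP] := invertible_invariant_form cu.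
pose S2 m := iter m (fun z => SU (SU z)).
have S2E m z : S2 m z = sigma U ^+ m * z * sigma_inv U ^+ m.
  elim: m => [|m IH]; first by rewrite mul1r mulr1.
  rewrite /S2 iterS -/(S2 m z) IH antipodeK_sigma // exprS [in RHS]exprSr.
  by rewrite !mulrA.
have PX m z : P ^+ m *m corep_rep u z = corep_rep u (S2 m z) *m P ^+ m.
  elim: m => [|m IH]; first by rewrite expr0 mul1mx mulmx1.
  rewrite exprS -mulmxE -mulmxA IH mulmxA (invariant_form_intertwines cu _ iP).
  by rewrite -mulmxA.
have S2N z : corep_rep u (S2 N.+1 z) = corep_rep u z.
  apply/matrixP => a b; rewrite !mxE S2E -[z in RHS]mul1r -[_ * z in RHS]mulr1.
  apply: same_pairingM; last exact: Kroot_torsion.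
  by apply: same_pairingM; first exact: Kroot_torsion.
have Py := psd_root_comm iP.1 uP (etrans (PX N.+1 y) (congr1 (mulmx^~ _) (S2N y))).
have := invariant_form_intertwines cu y iP; rewrite Py.
move=> /(congr1 (mulmx^~ (invmx P))); rewrite -!mulmxA mulmxV // !mulmx1.
by move=> /matrixP /(_ i j); rewrite !mxE.
Qed.

Lemma pairing0l f : <<0, f>> = 0.
Proof. exact: (linear_at0 (lin_pairl f (@lin_id _ _))). Qed.

Lemma pairingBl y z f : <<y - z, f>> = <<y, f>> - <<z, f>>.
Proof. by rewrite addrC -scaleN1r pairing_linl mulN1r addrC. Qed.

Lemma pairingZl c y f : <<c *: y, f>> = c * <<y, f>>.
Proof. exact: (@linZ _ U C^o _ c y (lin_pairl f (@lin_id _ _))). Qed.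

(** S^2 multiplies E_i by q_i^2, which differs from 1. *)
Lemma E_trivial i : same_pairing (Uq_E U i) 0.
Proof.
move=> f; have := antipode_sq_trivial (Uq_E U i) f.
rewrite antipodeK_sigma // (qcomm_KE U q0) coroot_two_rho -scalerAl -mulrA.
rewrite mul_sigmaV mulr1 pairingZl pairing0l => /eqP.
rewrite -[X in _ == X]mul1r -subr_eq0 -mulrBl mulf_eq0 subr_eq0.
by rewrite (negPf (q2 i)) => /eqP.
Qed.

(** The commutator of E_i and F_i vanishes on A by [E_trivial]. *)
Lemma K_selfinverse i : same_pairing (Uq_K U i) (Uq_Ki U i).
Proof.
move=> f; have := Uq_EF (Uq_rel U) i i; rewrite eqxx => e.
have : <<Uq_E U i * Uq_F U i - Uq_F U i * Uq_E U i, f>> = 0.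
  rewrite pairingBl -pairing_lact E_trivial -[X in _ - X]pairing_ract E_trivial.
  by rewrite !pairing0l subrr.
rewrite e pairingZl pairingBl => /eqP; rewrite mulf_eq0 invr_eq0.
by rewrite (negPf (sub_inv_neq0 (qi_neq0 g q0 i) (q2 i))) subr_eq0 => /eqP.
Qed.

Lemma sigma_selfinverse : same_pairing (sigma U) (sigma_inv U).
Proof.
rewrite /sigma /sigma_inv /Kroot.
apply: (big_ind2 same_pairing) => // [y y' z z'|i _]; first exact: same_pairingM.
rewrite mxE; case: (two_rho g 0 i) => [[|m]|m] //=.
  exact/same_pairingX/K_selfinverse.
by apply: same_pairingX => f; rewrite K_selfinverse.
Qed.

End Torsion.

(** * The twisted trace property of the Haar functional *)

Section HaarTheta.
Variables (C : numClosedFieldType) (l : nat) (g : semisimple_datum l) (q : C).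
Variables (U : Uq g q) (X : {pred 'rV[int]_l}) (A : OGq U X).
Hypotheses (q0 : q != 0) (q2 : forall i, qi g q i ^+ 2 != 1).
Variable star : A -> A.
Hypothesis cqgA : CQG star.
Variable h : {scalar A}.
Hypothesis haar_h : haar_functional h.

HB.instance Definition _ (a b : A) :=
  GRing.isLinear.Build C U C *%R (haar_char h a b : U -> C) (haar_char_linear h a b).

(** If q is not a root of unity, every trace takes the same value at sigma and
    its inverse. If it is one, the two elements agree on all of A. *)
Lemma haar_char_sigma_symm a b :
  haar_char h a b (sigma U) = haar_char h a b (sigma_inv U).
Proof.
have [[hl hr] h1] := (haar_left haar_h, haar_right haar_h, haar1 haar_h).
have [[N qN]|qN] := EM (exists N, q ^+ N.+1 = 1); last first.
  have qg m : q ^+ m.+1 != 1 by apply/eqP => qm; apply: qN; exists m.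
  exact: (@trace_sigma _ _ _ _ U q0 q2 (haar_char h a b : U -> C)
    (haar_char_tracial q0 hl hr a b) qg).
apply: eq_sw => a1 a2; apply: eq_sw => b1 b2; congr (_ *: formL _ _ _).
rewrite !ractE; apply: eq_sw => c d.
by rewrite (sigma_selfinverse q0 q2 cqgA hl h1 qN).
Qed.

Lemma haar_theta a c : h (a * lact (A := A) (sigma U) c) = h (theta A c * a).
Proof.
have [[hl hr] h1] := (haar_left haar_h, haar_right haar_h, haar1 haar_h).
exact: (haar_modular q0 hl hr h1 haar_char_sigma_symm).
Qed.

End HaarTheta.

(** * Maps induced on cyclic cohomology *)

Section InducedMap.
Variables (k : fieldType) (D D' : cocyclic_data k).
Variable phi : forall n, {linear cochain D n -> cochain D' n}.
Hypothesis phi_coface : forall n i (c : cochain D n), (i < n.+2)%N ->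
  phi n.+1 (coface i c) = coface i (phi n c).
Hypothesis phi_cyclic : forall n (c : cochain D n),
  phi n (cyclic_op c) = cyclic_op (phi n c).

Lemma cochain_map_cob n (c : cochain D n) : phi n.+1 (cob c) = cob (phi n c).
Proof.
rewrite /cob linear_sum; apply: eq_bigr => i _.
by rewrite linearZ /= phi_coface.
Qed.

Lemma cochain_map_is_cyclic n (c : cochain D n) : is_cyclic c -> is_cyclic (phi n c).
Proof. by rewrite /is_cyclic /clambda -phi_cyclic -linearZ => ->. Qed.

Lemma cochain_map_cocycle n (z : subspace_type (cyclic_cocycle D n)) :
  cyclic_cocycle D' n (phi n (val z)).
Proof.
have [cz bz] := subspace_valP z; split; first exact: cochain_map_is_cyclic.
by rewrite -cochain_map_cob bz linear0.
Qed.

(** The cochain map, restricted to cyclic cocycles. *)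
Definition cocycle_map n (z : subspace_type (cyclic_cocycle D n)) :
    subspace_type (cyclic_cocycle D' n) :=
  Sub_subspace (cochain_map_cocycle z).

Lemma cocycle_map_linear n : linear (@cocycle_map n).
Proof.
move=> a x y; apply: val_inj; rewrite subspace_val_linear /= !linearP.
by [].
Qed.

Lemma cocycle_map_coboundary n (z : subspace_type (cyclic_cocycle D n)) :
  cyclic_coboundary D n z -> cyclic_coboundary D' n (cocycle_map z).
Proof.
case: n z => [|n] z /=; first by move=> ->; rewrite linear0.
move=> [c cc ->]; exists (phi n c); first exact: cochain_map_is_cyclic.
by rewrite cochain_map_cob.
Qed.

(** Defined on representatives; [HC_mapE] shows independence of the choice. *)
Definition HC_map n (x : HC D n) : HC D' n := HC_class (cocycle_map (repr x)).

Lemma HC_mapE n z : @HC_map n (HC_class z) = HC_class (cocycle_map z).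
Proof.
apply/eqP; rewrite /HC_map /HC_class qclass_eq.
have -> : cocycle_map (repr (qclass (cyclic_coboundary D n) z)) -
   cocycle_map z = cocycle_map (repr (qclass (cyclic_coboundary D n) z) - z).
  by rewrite addrC -scaleN1r -cocycle_map_linear scaleN1r addrC.
apply/asboolP/cocycle_map_coboundary/asboolP.
by rewrite -[asbool _]/(subspace_mem _ _) -qclass_eq /qclass reprK.
Qed.

Lemma HC_map_linear n : linear (@HC_map n).
Proof.
move=> a; elim/qclass_ind=> x; elim/qclass_ind=> y.
rewrite -[in LHS]qclass_linear -!/(HC_class _) !HC_mapE.
by rewrite cocycle_map_linear /HC_class qclass_linear.
Qed.
HB.instance Definition _ n :=
  GRing.isLinear.Build k (HC D n) (HC D' n) _ (@HC_map n) (@HC_map_linear n).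

Lemma induced_HC n : exists chiHC : {linear HC D n -> HC D' n},
  forall z : subspace_type (cyclic_cocycle D n),
    exists2 w : subspace_type (cyclic_cocycle D' n),
      val w = phi n (val z) & chiHC (HC_class z) = HC_class w.
Proof.
by exists (@HC_map n) => z; exists (cocycle_map z) => //=; rewrite HC_mapE.
Qed.
End InducedMap.

(** * The characteristic map *)

Lemma lin_prod (k : fieldType) (V : lmodType k) (B : algType k) n
    (F : V -> nat -> B) (j : nat) : (j < n)%N ->
    (forall i, i != j -> forall x, F x i = F 0 i) ->
    linear (fun x => F x j) ->
  linear (fun x => \prod_(0 <= i < n) F x i).
Proof.
move=> jn cF lF.
have e x : \prod_(0 <= i < n) F x i =
    (\prod_(0 <= i < j) F 0 i) * F x j * \prod_(j.+1 <= i < n) F 0 i.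
  rewrite (big_cat_nat _ (n := j)) //=; last exact: ltnW.
  rewrite [X in _ * X]big_ltn // mulrA; congr (_ * _ * _).
    by apply: eq_big_nat => i /andP[_ ij]; rewrite cF // ltn_eqF.
  by apply: eq_big_nat => i /andP[ij _]; rewrite cF // gtn_eqF.
move=> a x y; rewrite !e lF mulrDr mulrDl -scalerAr -scalerAl.
by [].
Qed.

Lemma tpow_ext (k : fieldType) (V W : lmodType k) n (f f' : tpow V n -> W) :
  linear f -> linear f' -> (forall t, f (pure t) = f' (pure t)) -> f =1 f'.
Proof.
move=> lf lf' e z; have [s ->] := pureP z.
by rewrite !linear_sum_scale //; apply: eq_bigr => p _; rewrite e.
Qed.

Section CharacteristicMap.
Variables (C : fieldType) (l : nat) (g : semisimple_datum l) (q : C).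
Variables (U : Uq g q) (X : {pred 'rV[int]_l}) (A : OGq U X).
Variable h : {scalar A}.
Hypothesis h_left : forall f, sw f (fun a b => h b *: a) = h f *: 1.
Hypothesis h_right : forall f, sw f (fun a b => h a *: b) = h f *: 1.
Hypothesis h_theta : forall a c, h (a * lact (A := A) (sigma U) c) = h (theta A c * a).
Local Notation "y |> f" := (lact (A := A) y f) (at level 40, left associativity).
Local Notation "f <| y" := (ract (A := A) f y) (at level 40, left associativity).

(** The product of the y_i |> f_i with indices in nat, so that it can be
    split and shifted freely. *)
Definition act_prod n (y : nat -> U) (f : nat -> A) : A :=
  \prod_(0 <= i < n) (y i |> f i).

Lemma eq_act_prod n y y' f f' :
  (forall i, (i < n)%N -> y i = y' i /\ f i = f' i) ->
  act_prod n y f = act_prod n y' f'.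
Proof. by move=> e; apply: eq_big_nat => i /= lt_i; have [-> ->] := e i lt_i. Qed.

Lemma act_prod_linl n (t : n.-tuple U) f (i : 'I_n) :
  linear (fun x => act_prod n (fun j => (tset t i x)`_j) f).
Proof.
apply: (@lin_prod _ _ _ _ (fun x j => (tset t i x)`_j |> f j) i) => //.
  by move=> j ji x; rewrite !nth_tset (negPf ji).
by apply: lin_lactl => a x y; rewrite !nth_tset eqxx.
Qed.

Lemma act_prodM n y z f :
  act_prod n (fun j => y j * z j) f = act_prod n y (fun j => z j |> f j).
Proof. by apply: eq_big_nat => i _; rewrite lactM. Qed.

Lemma act_prod_recl n y f : act_prod n.+1 y f =
  (y 0%N |> f 0%N) * act_prod n (fun j => y j.+1) (fun j => f j.+1).
Proof. by rewrite /act_prod big_nat_recl. Qed.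

Lemma act_prod_recr n y f : act_prod n.+1 y f = act_prod n y f * (y n |> f n).
Proof. by rewrite /act_prod big_nat_recr. Qed.

Lemma act_prod_split n i y f : (i < n)%N -> act_prod n y f =
  act_prod i y f * (y i |> f i) *
  act_prod (n - i.+1) (fun j => y (i.+1 + j)%N) (fun j => f (i.+1 + j)%N).
Proof.
move=> lt_in; rewrite /act_prod (big_cat_nat _ (n := i)) //=; last exact: ltnW.
rewrite [X in _ * X]big_ltn // mulrA; congr (_ * _).
rewrite -[X in \big[_/_]_(X <= _ < _) _]add0n big_addn.
by apply: eq_big_nat => j _; rewrite addnC.
Qed.

(** A is a module algebra: applying the coproduct to the i-th tensor factor
    amounts to multiplying the i-th and (i+1)-st functions. *)
Lemma act_prod_comul n i (t : n.-tuple U) f : (i < n)%N ->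
  sw t`_i (fun a b => act_prod n.+1 (fun j => (insert2 i t [tuple a; b])`_j) f) =
  act_prod n (fun j => t`_j) (fun j => if (j < i)%N then f j else
     if j == i then f i * f i.+1 else f j.+1).
Proof.
move=> lt_in; rewrite (act_prod_split _ _ lt_in) ltnn eqxx.
rewrite [t`_i |> _]lact_mul.
set p := act_prod i _ _; set r := act_prod (n - _) _ _.
rewrite (linear_sw (f := fun x => p * x * r)); last by lin.
apply: eq_sw => a b; have lt_i1 : (i < n.+1)%N by apply: ltnW.
rewrite (act_prod_split _ _ lt_i1) subSS -[(n - i)%N]prednK ?subn_gt0 //.
rewrite act_prod_recl -subnS addn0 !nth_insert2 // ltnn eqxx.
have [-> ->] : (i.+1 < i)%N = false /\ (i.+1 == i) = false by lia.
rewrite eqxx !mulrA; congr (_ * _ * _ * _).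
  apply: eq_act_prod => j lt_ji; rewrite lt_ji; split; last by [].
  by rewrite nth_insert2 ?lt_ji //; lia.
apply: eq_act_prod => j lt_j; rewrite nth_insert2; last by lia.
by do ?case: ifP => //; try lia; rewrite ?addnS ?addSn.
Qed.

Definition chi_form n (y : n.-tuple U) (f : n.+1.-tuple A) : C^o :=
  h (f`_0 * act_prod n (fun i => y`_i) (fun i => f`_i.+1)).

Lemma haar_theta_invariant f : h (theta A f) = h f.
Proof. by rewrite -[RHS]mul1r -(Kroot_grouplike U (- two_rho g)).2 -haar_ract. Qed.

Lemma theta_lact y f : y |> theta A f = theta A (y |> f).
Proof. exact: lact_ract. Qed.

(** Invariance under theta: theta is multiplicative, commutes with the left
    action and preserves h. *)
Lemma chi_form_twisted n y : is_twisted_cochain (theta A) (@chi_form n y).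
Proof.
split=> [[[|i] lt_i] t|f].
- have e x : chi_form y (tset t (Ordinal lt_i) x) =
      h (x * act_prod n (fun i => y`_i) (fun i => t`_i.+1)).
    rewrite /chi_form nth_tset; congr (h (_ * _)).
    by apply: eq_act_prod => j _; rewrite nth_tset.
  by move=> a u v; rewrite !e mulrDl -scalerAl linearP.
- have e x : chi_form y (tset t (Ordinal lt_i) x) =
      h (t`_0 * act_prod n (fun i => y`_i) (fun j => (tset t (Ordinal lt_i) x)`_j.+1)).
    by rewrite /chi_form nth_tset.
  move=> a u v; rewrite !e; move: a u v.
  apply: (lin_comp (lin_scalar h)); apply: lin_mulr.
  apply: (@lin_prod _ _ _ _ (fun x j => y`_j |> (tset t (Ordinal lt_i) x)`_j.+1) i) => //.
    by move=> j ji x; rewrite !nth_tset eqSS (negPf ji).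
  by apply: lin_lactr => a x z; rewrite !nth_tset eqxx.
rewrite /chi_form nth_theta -[RHS]haar_theta_invariant rmorphM rmorph_prod /=.
by congr (h (_ * _)); apply: eq_big_nat => i _; rewrite nth_theta theta_lact.
Qed.

Definition chi_tuple n (y : n.-tuple U) : twisted_cochain (theta A) n :=
  Sub_subspace (P := twisted_subspace (theta A) n) (chi_form_twisted y).

Lemma chi_tuple_multilinear n : multilinear (@chi_tuple n).
Proof.
move=> i t a x y; apply: val_inj; rewrite subspace_val_linear; apply/funext => f.
have := lin_comp (lin_scalar h) (lin_mulr f`_0 (act_prod_linl t (fun i => f`_i.+1) i)).
exact.
Qed.

Definition chi n (z : tpow U n) : twisted_cochain (theta A) n := teval (@chi_tuple n) z.
Lemma chi_linear n : linear (@chi n).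
Proof. exact/teval_linear/chi_tuple_multilinear. Qed.
HB.instance Definition _ n := GRing.isLinear.Build C (tpow U n)
  (twisted_cochain (theta A) n) _ (@chi n) (@chi_linear n).

Lemma chi_pure n (y : n.-tuple U) : chi (pure y) = chi_tuple y.
Proof. exact/teval_pure/chi_tuple_multilinear. Qed.

Lemma chi_pureE n (y : n.-tuple U) f : val (chi (pure y)) f = chi_form y f.
Proof. by rewrite chi_pure. Qed.

Lemma val_coface n i (c : twisted_cochain (theta A) n) f :
  val (twisted_coface i c) f = val c (contract_args (theta A) i f).
Proof. by []. Qed.

Lemma val_cyclic_op n (c : twisted_cochain (theta A) n) f :
  val (twisted_cyclic_op c) f = val c (rotate_args (theta A) f).
Proof. by []. Qed.

Lemma cochain_eval_linear n f :
  linear (fun c : twisted_cochain (theta A) n => val c f : C^o).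
Proof. by move=> a x y; rewrite subspace_val_linear. Qed.

Lemma nth_contract n i (f : n.+2.-tuple A) r : (r < n.+1)%N ->
  (contract_args (theta A) i f)`_r =
  if (i <= n)%N then (if (r < i)%N then f`_r
                      else if r == i then f`_i * f`_i.+1 else f`_r.+1)
  else if r == 0 then theta A f`_n.+1 * f`_0 else f`_r.
Proof.
move=> lt_r; rewrite /contract_args; case: (leqP i n) => _.
  exact: (nth_mktup (fun j => if (j < i)%N then f`_j else
    if j == i then f`_i * f`_i.+1 else f`_j.+1)).
exact: (nth_mktup (fun j => if j == 0 then theta A f`_n.+1 * f`_0 else f`_j)).
Qed.

(** The first and last cofaces insert 1 and sigma: the cases p = 0 and
    p = n. *)
Lemma insert_multilinear n p (c : U) : (p <= n)%N ->
  multilinear (fun y : n.-tuple U => pure [tuple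
    if (j < p)%N then y`_j else if j == p :> nat then c else y`_j.-1 | j < n.+1]).
Proof.
move=> le_pn j t; have lt_j := ltn_ord j.
apply: (@linear_slot _ _ _ _ _ _ _ (if (j < p)%N then j : nat else j.+1) id) => //.
- exact: pure_multilinear.
- by case: ifP; lia.
move=> x r rn.
rewrite !(nth_mktup (fun j =>
  if (j < p)%N then _`_j else if j == p then c else _`_j.-1)) // !nth_tset.
by do ?case: ifP => //; lia.
Qed.

(** Three cases: inserting 1 multiplies the first two functions; the
    coproducts are [act_prod_comul]; in the last coface sigma acts on the last
    function, which the twisted trace property moves to the front. *)
Lemma chi_coface n i (z : tpow U n) : (i < n.+2)%N ->
  chi (hopf_coface (sigma U) i z) = twisted_coface i (chi z).
Proof.
move=> lt_i; move: z; apply: tpow_ext.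
- apply: lin_comp (@chi_linear _) (hopf_coface_linear _ lt_i).
- apply: lin_comp (twisted_coface_linear lt_i) (@chi_linear _).
move=> t; apply: val_inj; apply/funext => f.
rewrite val_coface chi_pureE /chi_form nth_contract // /hopf_coface.
case: i lt_i => [|i] lt_i; rewrite ?eqxx.
  rewrite (teval_pure t (@insert_multilinear n 0 1 (leq0n n))) chi_pureE.
  rewrite /chi_form act_prod_recl !mulrA.
  rewrite !(nth_mktup (fun j => if j == 0 then 1 else t`_j.-1)) // lact1.
  congr (h (_ * _)); apply: eq_act_prod => j lt_j.
  by rewrite nth_contract // (nth_mktup (fun j => if j == 0 then 1 else t`_j.-1)).
have -> : (i.+1 == 0) = false by [].
rewrite -[i.+1.-1]/i; case: (leqP i.+1 n) => [lt_in|ge_in].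
  rewrite /comul_at teval_pure; last exact: comul_at_multilinear.
  rewrite (linear_teval _ _ (@chi_linear _)) (linear_teval _ _ (cochain_eval_linear f)).
  transitivity (sw t`_i (fun a b => chi_form (insert2 i t [tuple a; b]) f)).
    by congr teval; apply/funext => p; rewrite chi_pureE.
  rewrite -(linear_sw (f := fun x => h (f`_0 * x) : C^o)); last by lin.
  rewrite (act_prod_comul _ (fun j => f`_j.+1)) //; congr (h (_ * _)).
  apply: eq_act_prod => j lt_j; split=> //.
  by rewrite nth_contract // lt_in ltnS eqSS.
have {ge_in lt_i} -> : i = n by lia.
have e : (fun y : n.-tuple U =>
    pure [tuple if j == n :> nat then sigma U else y`_j | j < n.+1])
  = (fun y => pure [tuple if (j < n)%N then y`_j else if j == n :> nat then sigma U
        else y`_j.-1 | j < n.+1]).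
  apply/funext => y; congr pure; apply: eq_from_tnth => r; rewrite !tnth_mktuple.
  by have := ltn_ord r; do ?case: ifP => //; lia.
rewrite e (teval_pure t (insert_multilinear _ (leqnn n))) chi_pureE.
rewrite /chi_form act_prod_recr mulrA.
pose F j := if (j < n)%N then t`_j else if j == n then sigma U else t`_j.-1.
rewrite (nth_mktup F) // {1}/F ltnn eqxx h_theta mulrA.
congr (h (_ * _)); apply: eq_act_prod => j lt_j.
rewrite nth_contract // ltnn (nth_mktup F) /F ?lt_j //.
exact: leq_trans lt_j _.
Qed.

(** The iterated coproduct acts diagonally on a product, by induction through
    [act_prod_comul] at the first place. *)
Lemma teval_iter_comul m z (f : nat -> A) :
  teval (fun s : m.+1.-tuple U => act_prod m.+1 (fun j => s`_j) f)
    (iter_comul (comul U) m z) = z |> \prod_(0 <= j < m.+1) f j.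
Proof.
have mul n f' : multilinear (fun s : n.-tuple U => act_prod n (fun j => s`_j) f').
  by move=> i t; exact: act_prod_linl.
elim: m f => [|m IH] f /=.
  by rewrite teval_pure //= /act_prod !big_nat1.
rewrite /comul_at (linear_teval _ _ (teval_linear (mul _ f))).
transitivity (teval (fun s : m.+1.-tuple U => act_prod m.+1 (fun j => s`_j)
   (fun j => if j == 0 then f 0%N * f 1%N else f j.+1)) (iter_comul (comul U) m z)).
  congr teval; apply/funext => s.
  rewrite (linear_teval _ _ (teval_linear (mul _ f))).
  rewrite -(act_prod_comul s f (ltn0Sn m)); congr teval; apply/funext => p.
  by rewrite teval_pure.
rewrite IH big_nat_recl // [in RHS]big_nat_recl // [in RHS]big_nat_recl //.
by rewrite mulrA.
Qed.

Lemma hopf_cyclic_multilinear m : multilinear (fun y : m.+1.-tuple U =>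
  tmul (iter_comul (comul U) m (antipode U y`_0))
   (pure [tuple if j == m :> nat then sigma U else y`_j.+1 | j < m.+1])).
Proof.
move=> [[|j] lt_j] t.
  have e x : [tuple if j == m :> nat then sigma U else
      (tset t (Ordinal lt_j) x)`_j.+1 | j < m.+1] =
      [tuple if j == m :> nat then sigma U else t`_j.+1 | j < m.+1].
    by apply: eq_from_tnth => r; rewrite !tnth_mktuple nth_tset.
  move=> a x y; rewrite !e !nth_tset /= linearP iter_comul_linear.
  by rewrite tmul_linear_l.
move=> a x y; rewrite !nth_tset /= -tmul_linear_r; congr tmul; move: a x y.
apply: (@linear_slot _ _ _ _ _ _ _ j id) => //; first exact: pure_multilinear.
  exact: ltnW.
move=> x r rn.
rewrite !(nth_mktup (fun j => if j == m then sigma U else _`_j.+1)) //.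
by rewrite !nth_tset /= eqSS; do ?case: eqP => //; lia.
Qed.

(** The diagonal action of S(y^1) on the product of the remaining functions is
    moved by [haar_lact_adj] to y^1 acting on f^0; then sigma |> f^n is moved to
    the front by the twisted trace property. *)
Lemma chi_cyclic n (z : tpow U n) :
  chi (hopf_cyclic_op (sigma U) z) = twisted_cyclic_op (chi z).
Proof.
move: z; apply: tpow_ext.
- apply: lin_comp (@chi_linear _) (@hopf_cyclic_op_linear _ _ _ _).
- apply: lin_comp (@twisted_cyclic_op_linear _ _ _ _) (@chi_linear _).
move=> t; apply: val_inj; apply/funext => f; rewrite val_cyclic_op [RHS]chi_pureE.
have nr r : (r < n.+1)%N -> (rotate_args (theta A) f)`_r =
    if r == 0 then theta A f`_n else f`_r.-1.
  exact: (nth_mktup (fun j => if j == 0 then theta A f`_n else f`_j.-1)).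
case: n t f nr => [|m] t f nr.
  by rewrite [LHS]chi_pureE /chi_form /act_prod !big_geq // nr // !mulr1 haar_theta_invariant.
have -> : hopf_cyclic_op (sigma U) (pure t) = _ :=
  teval_pure t (@hopf_cyclic_multilinear m).
set w := [tuple _ | _ < _]; have nw j : (j < m.+1)%N ->
   w`_j = if j == m then sigma U else t`_j.+1.
  exact: (nth_mktup (fun j => if j == m then sigma U else t`_j.+1)).
rewrite /tmul (linear_teval _ _ (@chi_linear _)) (linear_teval _ _ (cochain_eval_linear f)).
transitivity (teval (fun s : m.+1.-tuple U => h (f`_0 *
    act_prod m.+1 (fun j => s`_j) (fun j => w`_j |> f`_j.+1)) : C^o)
    (iter_comul (comul U) m (antipode U t`_0))).
  congr teval; apply/funext => s.
  rewrite (teval_pure w (tmul_multilinear_r s)) chi_pureE /chi_form.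
  rewrite -act_prodM; congr (h (_ * _)); apply: eq_act_prod => j lt_j; split=> //.
  exact: (nth_mktup (fun j => s`_j * w`_j)).
rewrite -(linear_teval (f := fun x => h (f`_0 * x) : C^o)); last by lin.
rewrite teval_iter_comul -haar_lact_adj // -/(act_prod m.+1 (fun j => w`_j) (fun j => f`_j.+1)).
rewrite act_prod_recr nw // eqxx mulrA h_theta.
rewrite /chi_form nr // act_prod_recl nr //=; congr (h (_ * (_ * _))).
apply: eq_act_prod => j lt_j; rewrite nw; last by apply: ltnW.
by rewrite ltn_eqF // nr.
Qed.

End CharacteristicMap.

Theorem theorem2p2 (C : numClosedFieldType) (l : nat) (g : semisimple_datum l)
    (q : C) (q_neq0 : q != 0) (q_neq1 : forall i, qi g q i ^+ 2 != 1)
    (U : Uq g q) (X : {pred 'rV[int]_l}) (latticeX : weight_lattice g X)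
    (A : OGq U X) (star : A -> A) (cqgA : CQG star)
    (h : {scalar A}) (haar_h : haar_functional h) :
  exists chi : forall n,
      {linear tpow U n -> twisted_cochain (theta A) n},
    (forall n (y : n.-tuple U) (f : n.+1.-tuple A),
       val (chi n (pure y)) f =
         h (f`_0 * \prod_(i < n) lact (A := A) y`_i f`_i.+1)) /\
    (forall n, exists chiHC :
         {linear HC (hopf_cocyclic (sigma U)) n ->
                 HC (twisted_cocyclic (theta A)) n},
       forall z : subspace_type (cyclic_cocycle (hopf_cocyclic (sigma U)) n),
         exists2 w : subspace_type
             (cyclic_cocycle (twisted_cocyclic (theta A)) n),
           val w = chi n (val z)
           & chiHC (HC_class z) = HC_class w).
Proof.
have hl := haar_left haar_h; have hr := haar_right haar_h.
have ht := haar_theta q_neq0 q_neq1 cqgA haar_h.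
exists (fun n => chi hl (n := n)); split=> [n y f|n].
  by rewrite chi_pureE /chi_form /act_prod big_mkord.
apply: (@induced_HC _ (hopf_cocyclic (sigma U)) (twisted_cocyclic (theta A))
  (fun n => chi hl (n := n))) => m.
  by move=> i c lt_i; apply: chi_coface.
by move=> c; apply: chi_cyclic.
Qed.
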